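(* For every integer $n>1$ there exist complex analytic unipotent germs of diffeomorphisms $\varphi$ at $(\mathbb{C}^n,0)$ whose formal class is non-embeddable; that is, $\log\varphi$ is not formally conjugated (by any formal diffeomorphism of $(\mathbb{C}^n,0)$) to any germ of convergent vector field.
   Context: A formal vector field on $(\mathbb{C}^n,0)$ is a derivation $\hat X=\sum_j \hat a_j\,\partial/\partial x_j$ of $\mathbb{C}[[x_1,\dots,x_n]]$; it is nilpotent if $\hat X(0)=0$ and its linear part $j^1\hat X$ is nilpotent. A formal diffeomorphism $\hat\sigma$ is an $n$-tuple of formal power series without constant term with invertible linear part; it is unipotent if $1$ is the only eigenvalue of $j^1\hat\sigma$. For $\hat X$ nilpotent, $\exp(\hat X)$ is the unipotent formal diffeomorphism determined by $g\circ\exp(\hat X)=\sum_{j\ge 0}\hat X^j(g)/j!$ for all $g\in\mathbb{C}[[x_1,\dots,x_n]]$. The map $\exp$ is a bijection from formal nilpotent vector fields onto formal unipotent diffeomorphisms; its inverse is denoted $\log$, and $\log\varphi$ is called the infinitesimal generator of $\varphi$. A formal diffeomorphism $\hat\sigma$ conjugates formal vector fields $X$ and $Y$ if $\hat\sigma_*X=Y$, where $(\hat\sigma_*X)(g)=[X(g\circ\hat\sigma)]\circ\hat\sigma^{-1}$. The formal class of a unipotent germ $\varphi$ is embeddable if $\log\varphi$ is formally conjugated to a convergent (complex analytic) germ of vector field. *)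

(* Defs.v *)
From HB Require Import structures.
From mathcomp Require Import all_boot all_order all_algebra.
From mathcomp Require Import boolp classical_sets reals complex mpoly.

Set Implicit Arguments.
Unset Strict Implicit.
Unset Printing Implicit Defensive.

Import Order.TTheory GRing.Theory Num.Theory.

Local Open Scope ring_scope.

(* K[[x_1, ..., x_n]]: a series is the family of its coefficients, indexed by
   the multi-indices m : 'X_{1..n}, where mdeg m is the total degree. *)
Definition fps (n : nat) (K : comNzRingType) : Type := 'X_{1..n} -> K.

Section Ring.

Variables (n : nat) (K : comNzRingType).
Implicit Types (f g h : fps n K) (m : 'X_{1..n}) (a b : K).

HB.instance Definition _ := Choice.copy (fps n K) ('X_{1..n} -> K).

Definition fps_zero : fps n K := fun=> 0.
Definition fps_one : fps n K := fun m => (m == 0%MM)%:R.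
Definition fps_opp f : fps n K := fun m => - f m.
Definition fps_add f g : fps n K := fun m => f m + g m.
Definition fps_scale a f : fps n K := fun m => a * f m.

(* Cauchy product *)
Definition fps_mul f g : fps n K := fun m =>
  \sum_(k : 'X_{1..n < (mdeg m).+1, (mdeg m).+1} | m == (k.1 + k.2)%MM)
     f k.1 * g k.2.

Fact fps_addA : associative fps_add.
Proof. by move=> f g h; apply/funext => m; rewrite /fps_add addrA. Qed.

Fact fps_addC : commutative fps_add.
Proof. by move=> f g; apply/funext => m; rewrite /fps_add addrC. Qed.

Fact fps_add0 : left_id fps_zero fps_add.
Proof. by move=> f; apply/funext => m; rewrite /fps_add add0r. Qed.

Fact fps_addN : left_inverse fps_zero fps_opp fps_add.
Proof. by move=> f; apply/funext => m; rewrite /fps_add addNr. Qed.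

HB.instance Definition _ := GRing.isZmodule.Build (fps n K)
  fps_addA fps_addC fps_add0 fps_addN.

Definition fps_trunc d f : {mpoly K[n]} :=
  \sum_(k : 'X_{1..n < d}) f k *: 'X_[k].

Lemma fps_truncE d f m : (mdeg m < d)%N -> (fps_trunc d f)@_m = f m.
Proof. exact: (mcoeff_mpoly f). Qed.

Lemma fps_mul_trunc d f g m : (mdeg m < d)%N ->
  fps_mul f g m = (fps_trunc d f * fps_trunc d g)@_m.
Proof.
move=> md; rewrite mcoeffM; apply: eq_bigr => k _.
by rewrite !fps_truncE // (leq_trans (bmdeg _)).
Qed.

Fact fps_mulC : commutative fps_mul.
Proof.
move=> f g; apply/funext => m.
by rewrite !(fps_mul_trunc _ _ (ltnSn (mdeg m))) mulrC.
Qed.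

Fact fps_mulA : associative fps_mul.
Proof.
move=> f g h; apply/funext => m; pose d := (mdeg m).+1.
transitivity (fps_trunc d f * (fps_trunc d g * fps_trunc d h))@_m.
  rewrite mcoeffM; apply: eq_bigr => k _.
  by rewrite fps_truncE ?bmdeg // -fps_mul_trunc ?bmdeg.
rewrite mulrA mcoeffM; apply: eq_bigr => k _.
by rewrite fps_truncE ?bmdeg // -fps_mul_trunc ?bmdeg.
Qed.

Fact fps_mul1 : left_id fps_one fps_mul.
Proof.
move=> f; apply/funext => m; pose d := (mdeg m).+1.
rewrite -[RHS](fps_truncE _ (ltnSn (mdeg m))) -[X in X@_m]mul1r mcoeffM.
by apply: eq_bigr => k _; rewrite mcoeff1 fps_truncE ?bmdeg.
Qed.

Fact fps_mulDl : left_distributive fps_mul +%R.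
Proof.
move=> f g h; apply/funext => m; rewrite -[RHS]big_split /=.
by apply: eq_bigr => k _; rewrite -mulrDl.
Qed.

Fact fps_one_neq0 : fps_one != 0.
Proof.
apply/eqP => /(congr1 (fun f : fps n K => f 0%MM)) /eqP.
by rewrite /fps_one eqxx oner_eq0.
Qed.

HB.instance Definition _ := GRing.Zmodule_isComNzRing.Build (fps n K)
  fps_mulA fps_mulC fps_mul1 fps_mulDl fps_one_neq0.

Fact fps_scaleA a b f : fps_scale a (fps_scale b f) = fps_scale (a * b) f.
Proof. by apply/funext => m; rewrite /fps_scale mulrA. Qed.

Fact fps_scale1 : left_id 1 fps_scale.
Proof. by move=> f; apply/funext => m; rewrite /fps_scale mul1r. Qed.

Fact fps_scaleDr : right_distributive fps_scale +%R.
Proof. by move=> a f g; apply/funext => m; rewrite /fps_scale mulrDr. Qed.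

Fact fps_scaleDl f : {morph fps_scale^~ f : a b / a + b}.
Proof. by move=> a b; apply/funext => m; rewrite /fps_scale mulrDl. Qed.

HB.instance Definition _ := GRing.Zmodule_isLmodule.Build K (fps n K)
  fps_scaleA fps_scale1 fps_scaleDr fps_scaleDl.

Definition fps_X (i : 'I_n) : fps n K := fun m => (m == U_(i)%MM)%:R.

Definition fps_deriv (i : 'I_n) f : fps n K := fun m =>
  f (m + U_(i))%MM *+ (m i).+1.

(* The composite f o sigma = \sum_k f_k sigma^k. It is only meaningful when the
   components of sigma have no constant term: then sigma^k has order at least
   mdeg k, so that only the finitely many k with mdeg k <= mdeg m contribute to
   the coefficient of x^m. *)
Definition fps_comp f (sigma : 'I_n -> fps n K) : fps n K := fun m =>
  \sum_(k : 'X_{1..n < (mdeg m).+1}) f k * (\prod_i sigma i ^+ k i) m.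

(* Convergence in the Krull (i.e., (x_1, ..., x_n)-adic) topology. *)
Definition krull_cvg (u : nat -> fps n K) f : Prop :=
  forall d, exists N0, forall N, (N0 <= N)%N ->
    forall m, (mdeg m < d)%N -> u N m = f m.

(* The n-tuple X stands for the derivation \sum_j (X j) d/dx_j, which acts on
   series as follows. *)
Definition vf_act (X : 'I_n -> fps n K) f : fps n K :=
  \sum_j X j * fps_deriv j f.

Definition vanish_at0 (F : 'I_n -> fps n K) : Prop :=
  forall i, F i 0%MM = 0.

Definition linear_part (F : 'I_n -> fps n K) : 'M[K]_n :=
  \matrix_(i, j) F i U_(j)%MM.

Definition vf_nilpotent (X : 'I_n -> fps n K) : Prop :=
  vanish_at0 X /\ exists k, linear_part X ^+ k = 0.

End Ring.

(* Absolute convergence at every point of an open polydisc around the origin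
   (note that 0 < r forces r to be real). *)
Definition convergent (n : nat) (K : numClosedFieldType) (f : fps n K) :
    Prop :=
  exists2 r : K, 0 < r & forall z : 'I_n -> K, (forall i, `|z i| < r) ->
    exists M : K, forall d,
      \sum_(k : 'X_{1..n < d}) `|f k * \prod_i z i ^+ k i| <= M.

Section Diffeomorphisms.

Variables (n : nat) (K : numClosedFieldType).
Implicit Types (phi sigma tau X Y : 'I_n -> fps n K).

Definition formal_diffeo sigma : Prop :=
  vanish_at0 sigma /\ linear_part sigma \in unitmx.

Definition unipotent phi : Prop :=
  formal_diffeo phi /\ (eigenvalue (linear_part phi) =1 pred1 1).

Definition is_exp X phi : Prop :=
  unipotent phi /\ forall g,
    krull_cvg (fun N => \sum_(j < N) (j`!%:R^-1 : K) *: iter j (vf_act X) g)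
              (fps_comp g phi).

(* The inverse of the bijection exp from nilpotent vector fields onto unipotent
   diffeomorphisms; outside of the image of exp its value would be 0. *)
Definition log phi : 'I_n -> fps n K :=
  xget (fun=> 0) [set X | vf_nilpotent X /\ is_exp X phi]%classic.

Definition is_inverse sigma tau : Prop :=
  [/\ formal_diffeo tau,
      forall i, fps_comp (sigma i) tau = fps_X K i
    & forall i, fps_comp (tau i) sigma = fps_X K i].

(* sigma_* X = Y, where (sigma_* X) g = X (g o sigma) o sigma^-1 *)
Definition conjugates sigma X Y : Prop :=
  exists2 tau, is_inverse sigma tau &
    forall g, fps_comp (vf_act X (fps_comp g sigma)) tau = vf_act Y g.

Definition embeddable phi : Prop :=
  exists sigma Y, [/\ formal_diffeo sigma, forall i, convergent (Y i)
                    & conjugates sigma (log phi) Y].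

End Diffeomorphisms.

(* Main.v *)
(* Let f = y (x + 2 y) and phi_l = exp(f d/dy) o theta_l, where l is a real
   number in [1, 2] and theta_l adds (l^2 f^2, l f^2) to (x, y). Then
   log phi_l = f d/dy modulo f^2, and H_l = x - l^2 G_l is a first integral of
   it, where G_l o phi_l - G_l = f^2 and G_l vanishes on y = 0.

   Suppose that log phi_l is conjugated to a convergent vector field Y, with the
   linear part of the conjugation normalized to the identity. Then Y = A W with
   A = y (x + 2 y) + O(3) and W = d/dy + O(1) convergent, and W is rectified by a
   convergent change of coordinates. In these coordinates the zeros of A form two
   convergent curves, close to y = 0 and to x + 2 y = 0. The derivatives of A
   along W on these curves are the eigenvalues of log phi_l at its singular
   points, and H_l has the same value at the two singular points of a leaf. This
   expresses the restriction of H_l, hence of G_l, to x + 2 y = 0 by convergent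
   series.

   The coefficients of that restriction of G_l are polynomials in l of degree
   linear in the order. If it converged for every l in [1, 2], then by Baire's
   theorem its coefficients would be geometrically bounded, uniformly for l in some
   interval, and by Lagrange interpolation so would be their coefficients of l^1.
   But these are, up to geometric factors, (2 m)! times products of rescaled
   Bernoulli numbers, which are themselves bounded below geometrically. *)
Require Import Defs.
From mathcomp Require Import all_boot all_order all_algebra.
From mathcomp Require Import reals complex.
From HB Require Import structures.
From mathcomp Require Import boolp classical_sets mpoly polyrcf.
From mathcomp Require Import zify ring lra.

Set Implicit Arguments.
Unset Strict Implicit.
Unset Printing Implicit Defensive.

Import Order.TTheory GRing.Theory Num.Theory.

Local Open Scope ring_scope.

(** * Formal power series *)

(** The two displacements in theta_l play different roles. Since f d/dy annihilates x, the first
    gives x o phi_l - x = l^2 f^2, which is what makes x - l^2 G_l invariant. The second is of first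
    order in l, hence it alone determines the coefficient K of l^1 in G_l.

    At a fixed l there is no manageable formula for G_l, while modulo l^2 the equation is linear in
    D = f d/dy. The coefficient of l^0 is useless: its restriction to x + 2 y = 0 is a polynomial.
    For K, one Bernoulli factor comes from the inverse of (e^z - 1) / z evaluated at D, the other
    from integrating D^j (f^2) along the leaves between the two lines. This is why a whole interval
    of parameters is considered and no explicit l is exhibited.

    The same series are needed over the complex numbers and over real polynomials in l, so the
    coefficient ring is kept abstract. Equations are solved by contractions for the Krull topology
    that preserve a closed property: a filtration, a congruence, or a norm bound. One formal
    argument thus yields degree bounds in l as well as convergence. *)

Section Basics.
Variables (n : nat) (A : comUnitRingType).
Implicit Types (f g h : fps n A) (m k : 'X_{1..n}) (a b : A).

Lemma fpsD f g m : (f + g) m = f m + g m. Proof. by []. Qed.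
Lemma fpsN f m : (- f) m = - f m. Proof. by []. Qed.
Lemma fpsB f g m : (f - g) m = f m - g m. Proof. by []. Qed.
Lemma fps0 m : (0 : fps n A) m = 0. Proof. by []. Qed.
Lemma fpsZ a f m : (a *: f) m = a * f m. Proof. by []. Qed.
Lemma fps1E m : (1 : fps n A) m = (m == 0%MM)%:R. Proof. by []. Qed.

Lemma fps_sum (I : Type) (r : seq I) (P : pred I) (F : I -> fps n A) m :
  (\sum_(i <- r | P i) F i) m = \sum_(i <- r | P i) F i m.
Proof. by apply: (big_morph (fun f : fps n A => f m)). Qed.

Lemma fpsMn f m j : (f *+ j) m = f m *+ j.
Proof. by elim: j => [|j IH]; rewrite ?mulr0n // !mulrS fpsD IH. Qed.

Lemma fps_mulE f g m d : (mdeg m < d)%N ->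
  (f * g) m = (fps_trunc d f * fps_trunc d g)@_m.
Proof. exact: fps_mul_trunc. Qed.

Lemma fps_mulD f g m : (f * g) m =
  \sum_(k : 'X_{1..n < (mdeg m).+1, (mdeg m).+1} | m == (k.1 + k.2)%MM)
     f k.1 * g k.2.
Proof. by []. Qed.

Lemma fps_mul_pred (P : A -> Prop) f g m : P 0 ->
  (forall a b, P a -> P b -> P (a + b)) ->
  (forall k l, m = (k + l)%MM -> P (f k * g l)) -> P ((f * g) m).
Proof. by move=> P0 PD h; rewrite fps_mulD; apply: big_ind => // k /eqP; apply: h. Qed.

Definition pf (p : {mpoly A[n]}) : fps n A := fun m => p@_m.

Lemma pf_is_zmod : zmod_morphism pf.
Proof. by move=> p q; apply/funext => m; rewrite /pf mcoeffB. Qed.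

Lemma pf_is_monoid : monoid_morphism pf.
Proof.
split; first by apply/funext => m; rewrite /pf mcoeff1.
by move=> p q; apply/funext => m; rewrite /pf mcoeffM fps_mulD.
Qed.

HB.instance Definition _ := GRing.isZmodMorphism.Build _ _ pf pf_is_zmod.
HB.instance Definition _ := GRing.isMonoidMorphism.Build _ _ pf pf_is_monoid.

Definition cst a : fps n A := a *: (1 : fps n A).

Lemma cstE a m : cst a m = a * (m == 0%MM)%:R. Proof. by []. Qed.

Lemma pfC a : pf a%:MP = cst a.
Proof. by apply/funext => m; rewrite /pf mcoeffC. Qed.

Lemma cst_is_zmod : zmod_morphism cst.
Proof. by move=> a b; rewrite /cst scalerBl. Qed.

Lemma cst_is_monoid : monoid_morphism cst.
Proof.
split; first by rewrite /cst scale1r.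
by move=> a b; rewrite -!pfC mpolyCM rmorphM.
Qed.

HB.instance Definition _ := GRing.isZmodMorphism.Build _ _ cst cst_is_zmod.
HB.instance Definition _ := GRing.isMonoidMorphism.Build _ _ cst cst_is_monoid.

Lemma fps_mulC_E a f m : (cst a * f) m = a * f m.
Proof.
rewrite (fps_mulE _ _ (ltnSn (mdeg m))).
have -> : fps_trunc (mdeg m).+1 (cst a) = a%:MP.
  apply/mpolyP => k; rewrite mcoeffC.
  case: (ltnP (mdeg k) (mdeg m).+1) => hk; first by rewrite fps_truncE.
  rewrite /fps_trunc raddf_sum /= big1 => [|i _]; last first.
    rewrite mcoeffZ mcoeffX; case: eqP => [e|]; last by rewrite mulr0.
    by move: (bmdeg i); rewrite e ltnNge hk.
  case: eqP => [e|]; last by rewrite mulr0.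
  by move: hk; rewrite e mdeg0.
by rewrite mcoeffCM fps_truncE.
Qed.

Lemma scaleE a f : a *: f = cst a * f.
Proof. by apply/funext => m; rewrite fps_mulC_E. Qed.

Lemma pfX i : pf 'X_i = fps_X A i.
Proof. by apply/funext => m; rewrite /pf mcoeffX eq_sym. Qed.

Lemma pf_trunc d f m : (mdeg m < d)%N -> pf (fps_trunc d f) m = f m.
Proof. exact: fps_truncE. Qed.

Lemma fps_mulX_U i f m : (fps_X A i * f) (m + U_(i))%MM = f m.
Proof.
pose d := (mdeg m).+2.
have dm : (mdeg (m + U_(i))%MM < d)%N by rewrite mdegD mdeg1 addn1.
rewrite (fps_mulE _ _ dm).
have -> : fps_trunc d (fps_X A i) = 'X_i.
  apply/mpolyP => k; rewrite mcoeffX.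
  case: (ltnP (mdeg k) d) => hk; first by rewrite fps_truncE // /fps_X eq_sym.
  rewrite /fps_trunc raddf_sum /= big1 => [|j _]; last first.
    rewrite mcoeffZ mcoeffX; case: eqP => [e|]; last by rewrite mulr0.
    by move: (bmdeg j); rewrite e ltnNge hk.
  by case: eqP => [e|] //; move: hk; rewrite -e mdeg1.
by rewrite mulrC [(m + _)%MM]addmC mcoeffMX fps_truncE // (leq_trans (ltnSn _)).
Qed.

Lemma fps_mulX_0 i f m : m i = 0%N -> (fps_X A i * f) m = 0.
Proof.
move=> mi; rewrite fps_mulD big1 // => k /eqP e.
rewrite /fps_X; case: eqP => [e1|]; last by rewrite mul0r.
by move/mnmP: e => /(_ i); rewrite mi mnmDE e1 mnm1E eqxx.
Qed.

Lemma mnm_subU m i : (0 < m i)%N -> (m - U_(i) + U_(i))%MM = m.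
Proof. by move=> mi; apply: submK; rewrite lep1mP -lt0n. Qed.

Lemma fps_mulXE i f m :
  (fps_X A i * f) m = if m i == 0%N then 0 else f (m - U_(i))%MM.
Proof.
case: eqP => [e|/eqP e]; first exact: fps_mulX_0.
by rewrite -{1}(@mnm_subU m i) ?lt0n // fps_mulX_U.
Qed.

Definition ordge d f := forall m, (mdeg m < d)%N -> f m = 0.

Lemma ordge0 f : ordge 0 f. Proof. by []. Qed.
Lemma ordgeD d f g : ordge d f -> ordge d g -> ordge d (f + g).
Proof. by move=> hf hg m md; rewrite fpsD hf // hg // addr0. Qed.
Lemma ordgeN d f : ordge d f -> ordge d (- f).
Proof. by move=> hf m md; rewrite fpsN hf // oppr0. Qed.
Lemma ordgeB d f g : ordge d f -> ordge d g -> ordge d (f - g).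
Proof. by move=> hf hg; apply/ordgeD => //; apply/ordgeN. Qed.
Lemma ordgeW d e f : (e <= d)%N -> ordge d f -> ordge e f.
Proof. by move=> ed hf m md; apply/hf/(leq_trans md). Qed.
Lemma ordgeM d e f g : ordge d f -> ordge e g -> ordge (d + e)%N (f * g).
Proof.
move=> hf hg m md; apply: (@fps_mul_pred (fun a => a = 0)) => [//|a b -> ->|k l ek].
  by rewrite addr0.
have [kd|kd] := ltnP (mdeg k) d; first by rewrite hf // mul0r.
rewrite (hg l) ?mulr0 //; move: md; rewrite ek mdegD; lia.
Qed.
Lemma ordgeMl d f g : ordge d f -> ordge d (f * g).
Proof. by move=> hf; rewrite -[d]addn0; apply: ordgeM. Qed.
Lemma ordgeMr d f g : ordge d f -> ordge d (g * f).
Proof. by move=> hf; rewrite mulrC; apply: ordgeMl. Qed.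
Lemma ordge_sum d (I : Type) (r : seq I) (P : pred I) (F : I -> fps n A) :
  (forall i, P i -> ordge d (F i)) -> ordge d (\sum_(i <- r | P i) F i).
Proof. by move=> h; apply: big_ind => //; apply: ordgeD. Qed.

Lemma ordge_all f : (forall d, ordge d f) -> f = 0.
Proof. by move=> h; apply/funext => m; apply: (h (mdeg m).+1). Qed.

Lemma ordge_eq f g : (forall d, ordge d (f - g)) -> f = g.
Proof. by move=> h; apply/eqP; rewrite -subr_eq0; apply/eqP/ordge_all. Qed.

Lemma ordge_ind f : (forall d, ordge d f -> ordge d.+1 f) -> f = 0.
Proof. by move=> h; apply: ordge_all; elim => [|d IH] //; apply: h. Qed.

Lemma ordge_X i : ordge 1 (fps_X A i).
Proof.
by move=> m md; rewrite /fps_X; case: eqP md => // ->; rewrite mdeg1.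
Qed.

Lemma ordge1E f : f 0%MM = 0 <-> ordge 1 f.
Proof.
split=> [f0 m|]; last by apply; rewrite mdeg0.
by rewrite ltnS leqn0 mdeg_eq0 => /eqP ->.
Qed.

Lemma ordge_trunc d f : ordge d (f - pf (fps_trunc d f)).
Proof. by move=> m md; rewrite fpsB pf_trunc // subrr. Qed.

Definition kclosed (P : fps n A -> Prop) :=
  forall f, (forall d, exists2 g, P g & ordge d (f - g)) -> P f.

(** Polynomials are dense for the Krull topology, so a closed property stable under sums and
    products can be checked on constants and variables. [comp_comp], [chain_rule] and [expv_comp]
    rest on this. *)
Lemma fps_dense (P : fps n A -> Prop) :
  (forall a, P (cst a)) -> (forall i, P (fps_X A i)) ->
  (forall f g, P f -> P g -> P (f + g)) ->
  (forall f g, P f -> P g -> P (f * g)) -> kclosed P -> forall f, P f.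
Proof.
move=> hC hX hD hM hcl f; apply: hcl => d.
exists (pf (fps_trunc d f)); last exact: ordge_trunc.
move: (fps_trunc d f) => q; elim/mpolyind: q => [|c m p _ _ hp].
  by rewrite rmorph0; have := hC 0; rewrite rmorph0.
rewrite rmorphD /=; apply: hD => //; rewrite -mul_mpolyC rmorphM /= pfC.
apply: (hM) => //; have h1 : P 1 by have := hC 1; rewrite rmorph1.
rewrite mpolyXE_id rmorph_prod.
apply: (big_ind P); [exact: h1|exact: hM|move=> i _].
rewrite rmorphXn /= pfX; elim: (m i) => [|j IH]; first by rewrite expr0.
by rewrite exprS; apply: hM.
Qed.

Definition monc (s : 'I_n -> fps n A) k : fps n A := \prod_i s i ^+ k i.

Lemma ordgeX d f j : ordge d f -> ordge (d * j)%N (f ^+ j).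
Proof.
move=> hf; elim: j => [|j IH]; first by rewrite muln0.
by rewrite exprS mulnS; apply: ordgeM.
Qed.

Lemma monc_ordge s k : (forall i, ordge 1 (s i)) -> ordge (mdeg k) (monc s k).
Proof.
move=> hs; rewrite mdegE /monc; apply: (big_rec2 (fun d f => ordge d f)) => //.
by move=> i f d _ hf; apply: ordgeM => //; rewrite -[X in ordge X]mul1n; apply: ordgeX.
Qed.

Definition ev s (p : {mpoly A[n]}) : fps n A := mmap cst s p.

Lemma ev_is_zmod s : zmod_morphism (ev s).
Proof. by move=> p q; rewrite /ev raddfB. Qed.
Lemma ev_is_monoid s : monoid_morphism (ev s).
Proof.
split; first by rewrite /ev /mmap msupp1 big_seq1 mpolyCK rmorph1 mul1r mmap11.
move=> p q; rewrite /ev.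
by apply: (fst (commr_mmap_is_multiplicative _ _)) => *; apply: mulrC.
Qed.
HB.instance Definition _ s := GRing.isZmodMorphism.Build _ _ (ev s) (ev_is_zmod s).
HB.instance Definition _ s := GRing.isMonoidMorphism.Build _ _ (ev s) (ev_is_monoid s).

Lemma ev_ordge s p d : (forall i, ordge 1 (s i)) ->
  (forall k, (mdeg k < d)%N -> p@_k = 0) -> ordge d (ev s p).
Proof.
move=> hs hp; apply: ordge_sum => k _.
have [kd|kd] := ltnP (mdeg k) d; first by rewrite hp // rmorph0 mul0r.
by apply/ordgeMr/(ordgeW kd)/monc_ordge.
Qed.

Lemma evX s i : ev s 'X_i = s i.
Proof.
rewrite /ev mmapX /mmap1 (bigD1 i) //= mnm1E eqxx expr1 big1 ?mulr1 // => j ji.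
by rewrite mnm1E eq_sym (negbTE ji) expr0.
Qed.

Lemma ev_truncE s f d :
  ev s (fps_trunc d f) = \sum_(k : 'X_{1..n < d}) cst (f k) * monc s k.
Proof.
by rewrite raddf_sum /=; apply: eq_bigr => k _; rewrite /ev mmapZ mmapX.
Qed.

Lemma fps_comp_ev0 f s m : fps_comp f s m = ev s (fps_trunc (mdeg m).+1 f) m.
Proof.
rewrite ev_truncE fps_sum; apply: eq_bigr => k _; by rewrite fps_mulC_E.
Qed.

Section Comp.
Variables (s : 'I_n -> fps n A) (hs : vanish_at0 s).

Let hs1 i : ordge 1 (s i). Proof. by apply/ordge1E; apply: hs. Qed.

Lemma fps_comp_ev f d : ordge d (fps_comp f s - ev s (fps_trunc d f)).
Proof.
move=> m md; rewrite fpsB fps_comp_ev0 -fpsB -rmorphB.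
apply: (@ev_ordge s _ (mdeg m).+1) => // k km; rewrite mcoeffB !fps_truncE ?subrr //.
by apply: leq_trans md; rewrite ltnS.
Qed.

Lemma fps_comp_pf p : fps_comp (pf p) s = ev s p.
Proof.
apply: ordge_eq => d.
have -> : fps_comp (pf p) s - ev s p =
   (fps_comp (pf p) s - ev s (fps_trunc d (pf p))) + ev s (fps_trunc d (pf p) - p).
  by rewrite rmorphB /= addrA subrK.
apply: ordgeD; first exact: fps_comp_ev.
by apply: ev_ordge => // k kd; rewrite mcoeffB fps_truncE // subrr.
Qed.

Lemma fps_comp_ordge f d : ordge d f -> ordge d (fps_comp f s).
Proof.
move=> hf; rewrite -[fps_comp f s](subrK (ev s (fps_trunc d f))).
apply: ordgeD; first exact: fps_comp_ev.
by apply: ev_ordge => // k kd; rewrite fps_truncE // hf.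
Qed.

Lemma fps_comp_is_zmod : zmod_morphism (fun f => fps_comp f s).
Proof.
move=> f g; apply/funext => m; rewrite fpsB !fps_comp_ev0 -fpsB -rmorphB.
congr (ev s _ m); rewrite /fps_trunc -sumrB; apply: eq_bigr => k _.
by rewrite -scalerBl.
Qed.

Lemma fps_comp_is_monoid : monoid_morphism (fun f => fps_comp f s).
Proof.
split; first by have := fps_comp_pf 1; rewrite !rmorph1.
move=> f g; apply: ordge_eq => d.
pose p := fps_trunc d f; pose q := fps_trunc d g.
have cB u v : fps_comp (u - v) s = fps_comp u s - fps_comp v s.
  exact: fps_comp_is_zmod.
have -> : fps_comp (f * g) s - fps_comp f s * fps_comp g s =
   fps_comp (f * g - pf (p * q)) s
    + (ev s p * ev s q - fps_comp f s * fps_comp g s).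
  by rewrite cB fps_comp_pf rmorphM addrA subrK.
apply: ordgeD.
  apply: fps_comp_ordge; rewrite rmorphM /=.
  have -> : f * g - pf p * pf q = (f - pf p) * g + pf p * (g - pf q) by ring.
  by apply: ordgeD; [apply: ordgeMl|apply: ordgeMr]; apply: ordge_trunc.
have -> : ev s p * ev s q - fps_comp f s * fps_comp g s =
  - ((fps_comp f s - ev s p) * fps_comp g s + ev s p * (fps_comp g s - ev s q)) by ring.
by apply/ordgeN/ordgeD; [apply: ordgeMl|apply: ordgeMr]; apply: fps_comp_ev.
Qed.

Lemma compB f g : fps_comp (f - g) s = fps_comp f s - fps_comp g s.
Proof. exact: fps_comp_is_zmod. Qed.
Lemma comp0 : fps_comp 0 s = 0.
Proof. by have := compB 0 0; rewrite !subrr. Qed.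
Lemma compN f : fps_comp (- f) s = - fps_comp f s.
Proof. by rewrite -sub0r compB comp0 sub0r. Qed.
Lemma compD f g : fps_comp (f + g) s = fps_comp f s + fps_comp g s.
Proof. by have := compB f (- g); rewrite opprK compN opprK. Qed.
Lemma compM f g : fps_comp (f * g) s = fps_comp f s * fps_comp g s.
Proof. exact: (snd fps_comp_is_monoid). Qed.
Lemma comp1 : fps_comp 1 s = 1.
Proof. exact: (fst fps_comp_is_monoid). Qed.
Lemma compC a : fps_comp (cst a) s = cst a.
Proof. by have := fps_comp_pf a%:MP; rewrite pfC /ev mmapC. Qed.
Lemma compX i : fps_comp (fps_X A i) s = s i.
Proof. by rewrite -pfX fps_comp_pf evX. Qed.
Lemma compXn f j : fps_comp (f ^+ j) s = fps_comp f s ^+ j.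
Proof. by elim: j => [|j IH]; rewrite ?expr0 ?comp1 // !exprS compM IH. Qed.
Lemma compZ a f : fps_comp (a *: f) s = a *: fps_comp f s.
Proof. by rewrite !scaleE compM compC. Qed.
Lemma compMn f j : fps_comp (f *+ j) s = fps_comp f s *+ j.
Proof. by elim: j => [|j IH]; rewrite ?mulr0n ?comp0 // !mulrS compD IH. Qed.
Lemma comp_sum (I : Type) (r : seq I) (P : pred I) (F : I -> fps n A) :
  fps_comp (\sum_(i <- r | P i) F i) s = \sum_(i <- r | P i) fps_comp (F i) s.
Proof. exact: (big_morph (fun f => fps_comp f s) compD comp0). Qed.
Lemma comp_at0 f : fps_comp f s 0%MM = f 0%MM.
Proof.
pose r := f - cst (f 0%MM); have e : f = cst (f 0%MM) + r by rewrite addrC subrK.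
have h : ordge 1 r by apply/ordge1E; rewrite /r fpsB cstE eqxx mulr1 subrr.
by rewrite [in LHS]e compD compC fpsD cstE eqxx mulr1 (fps_comp_ordge h) ?mdeg0 // addr0.
Qed.

End Comp.

Lemma vanish_X : vanish_at0 (fps_X A : 'I_n -> fps n A).
Proof. by move=> i; apply: ordge_X; rewrite mdeg0. Qed.

Lemma comp_id f : fps_comp f (fps_X A) = f.
Proof.
have v := vanish_X.
apply: (@fps_dense (fun f => fps_comp f (fps_X A) = f)) => [a|i|u w hu hw|u w hu hw|u h].
- by rewrite compC.
- by rewrite compX.
- by rewrite compD // hu hw.
- by rewrite compM // hu hw.
apply: ordge_eq => d; have [g hg ug] := h d.
have -> : fps_comp u (fps_X A) - u = fps_comp (u - g) (fps_X A) - (u - g).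
  by rewrite compB // hg; ring.
by apply: ordgeB => //; apply: fps_comp_ordge.
Qed.

Lemma vanish_comp (s t : 'I_n -> fps n A) : vanish_at0 s -> vanish_at0 t ->
  vanish_at0 (fun i => fps_comp (s i) t).
Proof. by move=> hs ht i; rewrite comp_at0. Qed.

Lemma comp_comp f (s t : 'I_n -> fps n A) : vanish_at0 s -> vanish_at0 t ->
  fps_comp (fps_comp f s) t = fps_comp f (fun i => fps_comp (s i) t).
Proof.
move=> hs ht; have hst := vanish_comp hs ht.
pose P f := fps_comp (fps_comp f s) t = fps_comp f (fun i => fps_comp (s i) t).
apply: (@fps_dense P) => [a|i|u w hu hw|u w hu hw|u h]; rewrite /P.
- by rewrite !compC.
- by rewrite !compX.
- by rewrite !compD // hu hw.
- by rewrite !compM // hu hw.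
apply: ordge_eq => d; have [g hg ug] := h d.
have -> : fps_comp (fps_comp u s) t - fps_comp u (fun i => fps_comp (s i) t) =
  fps_comp (fps_comp (u - g) s) t - fps_comp (u - g) (fun i => fps_comp (s i) t).
  by rewrite !compB // hg; ring.
by apply: ordgeB; do ?apply: fps_comp_ordge.
Qed.

Lemma comp_eq f (s t : 'I_n -> fps n A) : s =1 t -> fps_comp f s = fps_comp f t.
Proof. by move=> h; congr fps_comp; apply/funext. Qed.

Lemma derivD i f g : fps_deriv i (f + g) = fps_deriv i f + fps_deriv i g.
Proof. by apply/funext => m; rewrite /fps_deriv !fpsD mulrnDl. Qed.
Lemma derivN i f : fps_deriv i (- f) = - fps_deriv i f.
Proof. by apply/funext => m; rewrite /fps_deriv !fpsN mulNrn. Qed.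
Lemma derivB i f g : fps_deriv i (f - g) = fps_deriv i f - fps_deriv i g.
Proof. by rewrite derivD derivN. Qed.
Lemma deriv_ordge i d f : ordge d.+1 f -> ordge d (fps_deriv i f).
Proof.
by move=> hf m md; rewrite /fps_deriv hf ?mul0rn // mdegD mdeg1 addn1 ltnS.
Qed.
Lemma deriv_pf i p : fps_deriv i (pf p) = pf p^`M(i).
Proof. by apply/funext => m; rewrite /pf mcoeff_deriv /fps_deriv. Qed.
Lemma derivM i f g : fps_deriv i (f * g) = fps_deriv i f * g + f * fps_deriv i g.
Proof.
apply: ordge_eq => d; pose p := fps_trunc d.+1 f; pose q := fps_trunc d.+1 g.
have hp := @ordge_trunc d.+1 f; have hq := @ordge_trunc d.+1 g.
have e : fps_deriv i (pf p * pf q) = fps_deriv i (pf p) * pf q + pf p * fps_deriv i (pf q).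
  by rewrite -rmorphM !deriv_pf mderivM rmorphD !rmorphM.
have -> : fps_deriv i (f * g) - (fps_deriv i f * g + f * fps_deriv i g) =
  fps_deriv i ((f - pf p) * g + pf p * (g - pf q))
  - (fps_deriv i (f - pf p) * g + fps_deriv i (pf p) * (g - pf q)
     + (f - pf p) * fps_deriv i g + pf p * fps_deriv i (g - pf q)).
  have -> : (f - pf p) * g + pf p * (g - pf q) = f * g - pf p * pf q by ring.
  by rewrite !derivB e; ring.
apply: ordgeB.
  by apply/deriv_ordge/ordgeD; [apply: ordgeMl|apply: ordgeMr].
have hp' := ordgeW (leqnSn d) hp; have hq' := ordgeW (leqnSn d) hq.
apply: ordgeD; first apply: ordgeD; first apply: ordgeD.
- by apply/ordgeMl/deriv_ordge.
- exact: ordgeMr.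
- exact: ordgeMl.
- by apply/ordgeMr/deriv_ordge.
Qed.
Lemma derivC (i : 'I_n) a : fps_deriv i (cst a) = 0.
Proof. by rewrite -pfC deriv_pf mderivC rmorph0. Qed.
Lemma deriv0 (i : 'I_n) : fps_deriv i (0 : fps n A) = 0.
Proof. by have := derivC i 0; rewrite rmorph0. Qed.
Lemma deriv1 (i : 'I_n) : fps_deriv i (1 : fps n A) = 0.
Proof. by have := derivC i 1; rewrite rmorph1. Qed.
Lemma derivX (i j : 'I_n) : fps_deriv i (fps_X A j) = (i == j)%:R.
Proof.
rewrite -pfX deriv_pf mderivX mnm1E eq_sym; case: eqP => [->|_].
  have -> : (U_(j) - U_(j) = 0)%MM by apply/mnmP => k; rewrite mnmBE subnn mnm0E.
  by rewrite mpolyX0 scale1r rmorph1.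
by rewrite scale0r rmorph0.
Qed.

Lemma chain_rule i f s : vanish_at0 s ->
  fps_deriv i (fps_comp f s) = \sum_j fps_comp (fps_deriv j f) s * fps_deriv i (s j).
Proof.
move=> hs.
pose P f := fps_deriv i (fps_comp f s) = \sum_j fps_comp (fps_deriv j f) s * fps_deriv i (s j).
apply: (@fps_dense P) => [a|j|u w hu hw|u w hu hw|u h]; rewrite /P.
- rewrite compC // derivC big1 // => j _; by rewrite derivC comp0 // mul0r.
- rewrite compX // (bigD1 j) //= derivX eqxx comp1 // mul1r big1 ?addr0 // => k kj.
  by rewrite derivX (negbTE kj) comp0 // mul0r.
- rewrite compD // derivD hu hw -big_split /=; apply: eq_bigr => j _.
  by rewrite derivD compD // mulrDl.
- rewrite compM // derivM hu hw mulr_suml mulr_sumr -big_split /=.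
  by apply: eq_bigr => j _; rewrite derivM compD // !compM //; ring.
(* One degree more than the target order, since differentiation loses one. *)
apply: ordge_eq => d; have [g hg ug] := h d.+1.
pose T v := \sum_j fps_comp (fps_deriv j v) s * fps_deriv i (s j).
have TB : T (u - g) = T u - T g.
  by rewrite -sumrB; apply: eq_bigr => j _; rewrite derivB compB // mulrBl.
have -> : fps_deriv i (fps_comp u s) - T u = fps_deriv i (fps_comp (u - g) s) - T (u - g).
  by rewrite TB compB // derivB hg -/(T g); ring.
apply: ordgeB; first by apply/deriv_ordge/fps_comp_ordge.
by apply: ordge_sum => j _; apply/ordgeMl/fps_comp_ordge => //; apply/deriv_ordge.
Qed.

Implicit Types X : 'I_n -> fps n A.
Lemma vfD X f g : vf_act X (f + g) = vf_act X f + vf_act X g.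
Proof. by rewrite /vf_act -big_split; apply: eq_bigr => j _; rewrite derivD mulrDr. Qed.
Lemma vfN X f : vf_act X (- f) = - vf_act X f.
Proof. by rewrite /vf_act -sumrN; apply: eq_bigr => j _; rewrite derivN mulrN. Qed.
Lemma vfB X f g : vf_act X (f - g) = vf_act X f - vf_act X g.
Proof. by rewrite vfD vfN. Qed.
Lemma vf0 X : vf_act X (0 : fps n A) = 0.
Proof. by rewrite /vf_act big1 // => j _; rewrite deriv0 mulr0. Qed.
Lemma vfC X a : vf_act X (cst a) = 0.
Proof. by rewrite /vf_act big1 // => j _; rewrite derivC mulr0. Qed.
Lemma vfM X f g : vf_act X (f * g) = vf_act X f * g + f * vf_act X g.
Proof.
rewrite /vf_act mulr_suml mulr_sumr -big_split; apply: eq_bigr => j _ /=.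
by rewrite derivM; ring.
Qed.
Lemma vfZ X a f : vf_act X (a *: f) = a *: vf_act X f.
Proof. by rewrite !scaleE vfM vfC mul0r add0r. Qed.
Lemma vfX X i : vf_act X (fps_X A i) = X i.
Proof.
rewrite /vf_act (bigD1 i) //= derivX eqxx mulr1 big1 ?addr0 // => j ji.
by rewrite derivX (negbTE ji) mulr0.
Qed.
Lemma vf_sum X (I : Type) (r : seq I) (P : pred I) (F : I -> fps n A) :
  vf_act X (\sum_(i <- r | P i) F i) = \sum_(i <- r | P i) vf_act X (F i).
Proof. exact: (big_morph _ (vfD X) (vf0 X)). Qed.
Lemma vf_comp X f s : vanish_at0 s ->
  vf_act X (fps_comp f s) = \sum_j fps_comp (fps_deriv j f) s * vf_act X (s j).
Proof.
move=> hs; rewrite /vf_act; under eq_bigr do rewrite chain_rule // mulr_sumr.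
rewrite exchange_big /=; apply: eq_bigr => j _; rewrite mulr_sumr.
by apply: eq_bigr => i _; ring.
Qed.
Lemma vf_ordge X d f : (forall i, ordge 2 (X i)) -> ordge d f -> ordge d.+1 (vf_act X f).
Proof.
move=> hX hf; apply: ordge_sum => j _; case: d hf => [|d] hf.
  by apply/ordgeMl/(ordgeW _ (hX j)).
have -> : d.+2 = (2 + d)%N by [].
by apply: ordgeM => //; apply: deriv_ordge.
Qed.

End Basics.

(** * Filtrations, fixed points and exponentials *)

Section Filtration.
Variables (n : nat) (A : comUnitRingType).
Implicit Types (f g h : fps n A) (m k : 'X_{1..n}) (a b : A).

(* A filtration of the coefficient ring, to be combined with the degree: fil T j
   bounds the coefficient of a monomial of degree d by T (d + 1 - j). The trivial
   filtration T 0 = 0, T d.+1 = A gives the order of vanishing; with T d the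
   polynomials in a parameter of degree < 2 d - 1 one gets growth bounds. *)
Record coef_filt (T : nat -> A -> Prop) : Prop := CoefFilt {
  cf00 : forall a, T 0 a -> a = 0;
  cf0 : forall d, T d 0;
  cfD : forall d a b, T d a -> T d b -> T d (a + b);
  cfS : forall d a, T d a -> T d.+1 a;
  cfM : forall d e a b, T d.+1 a -> T e.+1 b -> T (d + e).+1%N (a * b);
  cf1 : T 1 1;
  cfN : T 1 (-1);
  cfV : forall j, T 1 (j.+1%:R^-1) }.

Variables (T : nat -> A -> Prop) (hT : coef_filt T).

Lemma cfW d e a : (d <= e)%N -> T d a -> T e a.
Proof.
move=> /subnKC <-; elim: (e - d)%N => [|j IH] ha; rewrite ?addn0 // addnS.
by apply: (cfS hT); apply: IH.
Qed.

Lemma cfMl d c a : T 1 c -> T d a -> T d (c * a).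
Proof.
case: d => [|d] hc ha; first by rewrite (cf00 hT ha) mulr0; apply: (cf0 hT).
exact: (cfM hT hc ha).
Qed.

Lemma cfMn d a j : T d a -> T d (a *+ j).
Proof.
move=> ha; elim: j => [|j IH]; first by rewrite mulr0n; apply: (cf0 hT).
by rewrite mulrS; apply: (cfD hT).
Qed.

Lemma cf_opp d a : T d a -> T d (- a).
Proof. by move=> ha; rewrite -mulN1r; apply: cfMl => //; apply: (cfN hT). Qed.

Definition fil j f := forall m, T ((mdeg m).+1 - j)%N (f m).

Lemma fil0 j : fil j 0. Proof. by move=> m; apply: (cf0 hT). Qed.
Lemma filD j f g : fil j f -> fil j g -> fil j (f + g).
Proof. by move=> hf hg m; apply: (cfD hT). Qed.
Lemma filN j f : fil j f -> fil j (- f).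
Proof. by move=> hf m; apply: cf_opp. Qed.
Lemma filB j f g : fil j f -> fil j g -> fil j (f - g).
Proof. by move=> hf hg; apply: filD => //; apply: filN. Qed.
Lemma filW i j f : (i <= j)%N -> fil j f -> fil i f.
Proof. by move=> ij hf m; apply: cfW (hf m); apply: leq_sub2l. Qed.
Lemma filM i j f g : fil i f -> fil j g -> fil (i + j)%N (f * g).
Proof.
move=> hf hg m; apply: (@fps_mul_pred _ _ (T _)); first exact: (cf0 hT).
  by move=> a b; apply: (cfD hT).
move=> k l ->; rewrite mdegD.
have := hf k; have := hg l.
have [ki|ki] := leqP (mdeg k).+1 i.
  by move: (ki); rewrite -subn_eq0 => /eqP -> _ /(cf00 hT) ->; rewrite mul0r; apply: (cf0 hT).
have [lj|lj] := leqP (mdeg l).+1 j.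
  by move: (lj); rewrite -subn_eq0 => /eqP -> /(cf00 hT) -> _; rewrite mulr0; apply: (cf0 hT).
rewrite (subSn (ki : (i <= mdeg k)%N)) (subSn (lj : (j <= mdeg l)%N)); have -> : ((mdeg k + mdeg l).+1 - (i + j) = ((mdeg k - i) + (mdeg l - j)).+1)%N by lia.
by move=> h1 h2; apply: (cfM hT).
Qed.
Lemma fil_cst a : T 1 a -> fil 0 (cst a).
Proof.
move=> ha m; rewrite cstE; case: eqP => _; last by rewrite mulr0; apply: (cf0 hT).
by rewrite mulr1; apply: cfW ha; rewrite subn0.
Qed.
Lemma fil1 : fil 0 1.
Proof. by have := fil_cst (cf1 hT); rewrite rmorph1. Qed.
Lemma fil_X i : fil 1 (fps_X A i).
Proof.
move=> m; rewrite /fps_X; case: eqP => [->|_]; last exact: (cf0 hT).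
by rewrite mdeg1; apply: (cf1 hT).
Qed.
Lemma filMn j f (e : nat) : fil j f -> fil j (f *+ e).
Proof. by move=> hf m; rewrite fpsMn; apply: cfMn. Qed.
Lemma filXn j f e : fil j f -> fil (j * e)%N (f ^+ e).
Proof.
move=> hf; elim: e => [|e IH]; first by rewrite muln0; apply: fil1.
by rewrite exprS mulnS; apply: filM.
Qed.
Lemma fil_deriv i j f : fil j.+1 f -> fil j (fps_deriv i f).
Proof.
move=> hf m; rewrite /fps_deriv; apply: cfMn; have := hf (m + U_(i))%MM.
by rewrite mdegD mdeg1 addn1 subSS.
Qed.
Lemma fil_closed j : kclosed (fil j).
Proof.
move=> f h m; have [g hg fg] := h (mdeg m).+1.
have -> : f m = g m by apply/eqP; rewrite -subr_eq0 -fpsB; apply/eqP/fg.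
exact: hg.
Qed.
Lemma fil_vanish f : fil 1 f -> f 0%MM = 0.
Proof. by move=> h; have := h 0%MM; rewrite mdeg0 subnn; apply: (cf00 hT). Qed.

(** Telescoping over the factors of the monomial: each replacement of an entry of s by one of t
    gains d over the filtration that the monomial has anyway. *)
Lemma fil_monc_diff d (s t : 'I_n -> fps n A) k :
  (forall i, fil 1 (s i)) -> (forall i, fil 1 (t i)) ->
  (forall i, fil d.+1 (s i - t i)) ->
  [/\ fil (mdeg k) (monc s k), fil (mdeg k) (monc t k)
    & fil (mdeg k + d)%N (monc s k - monc t k)].
Proof.
move=> hs ht hst; rewrite mdegE /monc.
apply: (big_rec3 (fun e u v => [/\ fil e u, fil e v & fil (e + d)%N (u - v)])).
  by split; [exact: fil1|exact: fil1|rewrite subrr; exact: fil0].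
move=> i e u v _ [hu hv huv].
have st j : [/\ fil j (s i ^+ j), fil j (t i ^+ j) & fil (j + d)%N (s i ^+ j - t i ^+ j)].
  elim: j => [|j [h1 h2 h3]].
    by rewrite !expr0 subrr; split; [exact: fil1|exact: fil1|exact: fil0].
  rewrite !exprS -[j.+1]add1n; split; [exact: filM|exact: filM|].
  have -> : s i * s i ^+ j - t i * t i ^+ j
     = (s i - t i) * s i ^+ j + t i * (s i ^+ j - t i ^+ j) by ring.
  apply: filD; last by rewrite -addnA; apply: filM.
  have -> : (1 + j + d = d.+1 + j)%N by lia.
  exact: filM.
have [h1 h2 h3] := st (k i); split; [exact: filM|exact: filM|].
have -> : s i ^+ k i * u - t i ^+ k i * v =
  (s i ^+ k i - t i ^+ k i) * u + t i ^+ k i * (u - v) by ring.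
apply: filD; last by rewrite -addnA; apply: filM.
by rewrite addnAC; apply: filM.
Qed.

(** The subtractions are truncated: when one of them is 0, the corresponding factor vanishes by
    [cf00], and otherwise the indices add up as in [cfM]. *)
Lemma cfMsub (p i q c : nat) x y : T (p.+1 - i)%N x -> T (q.+1 - (p + c))%N y ->
  T (q.+1 - (i + c))%N (x * y).
Proof.
have [ai|ai] := leqP p.+1 i.
  by move: (ai); rewrite -subn_eq0 => /eqP -> /(cf00 hT) -> _; rewrite mul0r; apply: (cf0 hT).
have [bc|bc] := leqP q.+1 (p + c).
  by move: (bc); rewrite -subn_eq0 => /eqP -> _ /(cf00 hT) ->; rewrite mulr0; apply: (cf0 hT).
rewrite (subSn (ai : (i <= p)%N)) (subSn (bc : (p + c <= q)%N)).
have -> : (q.+1 - (i + c) = ((p - i) + (q - (p + c))).+1)%N by lia.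
exact: (cfM hT).
Qed.

Lemma fil_comp j f (s : 'I_n -> fps n A) : (forall i, fil 1 (s i)) -> fil j f ->
  fil j (fps_comp f s).
Proof.
move=> hs hf m; rewrite /fps_comp; apply: big_ind => [||k _]; first exact: (cf0 hT).
  by move=> a b; apply: (cfD hT).
have h0 i : fil 1 (s i - s i) by rewrite subrr; apply: fil0.
have [h _ _] := fil_monc_diff k hs hs h0.
by rewrite -[j]addn0; apply: (@cfMsub (mdeg k)) => //; rewrite addn0; apply: h.
Qed.

Lemma fil_comp_diff d j f (s t : 'I_n -> fps n A) :
  (forall i, fil 1 (s i)) -> (forall i, fil 1 (t i)) ->
  (forall i, fil d.+1 (s i - t i)) -> fil j f ->
  fil (j + d)%N (fps_comp f s - fps_comp f t).
Proof.
move=> hs ht hst hf m; rewrite fpsB /fps_comp -sumrB.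
apply: big_ind => [||k _]; first exact: (cf0 hT).
  by move=> a b; apply: (cfD hT).
rewrite -mulrBr; have [_ _ h] := fil_monc_diff k hs ht hst.
by apply: (@cfMsub (mdeg k)) => //; apply: (h m).
Qed.

Definition fps_int (i : 'I_n) f : fps n A := fun m =>
  if m i == 0%N then 0 else (m i)%:R^-1 * f (m - U_(i))%MM.

(* the quotient of f - f(x_i = 0) by x_i *)
Definition dv (i : 'I_n) f : fps n A := fun m => f (m + U_(i))%MM.

Lemma mdeg_subU m i : m i != 0%N -> (mdeg (m - U_(i))%MM).+1 = mdeg m.
Proof.
by rewrite -lt0n => /(@mnm_subU _ m i) {2}<-; rewrite mdegD mdeg1 addn1.
Qed.

Lemma fil_int i j f : fil j f -> fil j.+1 (fps_int i f).
Proof.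
move=> hf m; rewrite /fps_int; case: eqP => [_|/eqP mi]; first exact: (cf0 hT).
have hv : T 1 ((m i)%:R^-1) by move: mi; case: (m i) => // k _; apply: (cfV hT).
by apply: cfMl => //; have := hf (m - U_(i))%MM; rewrite mdeg_subU // subSS.
Qed.

Lemma fil_dv i j f : fil j.+1 f -> fil j (dv i f).
Proof. by move=> hf m; have := hf (m + U_(i))%MM; rewrite mdegD mdeg1 addn1 subSS. Qed.

End Filtration.

Section OrderFiltration.
Variables (n : nat) (A : comUnitRingType).
Implicit Types (f g h : fps n A) (m k : 'X_{1..n}) (a b : A).

Definition ordT (d : nat) a := d = 0%N -> a = 0.

Lemma ordT_filt : coef_filt ordT.
Proof.
split=> //; rewrite /ordT.
- by move=> a; apply.
- by move=> d a b ha hb d0; rewrite ha // hb // addr0.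
Qed.

Lemma fil_ordT d f : fil ordT d f <-> ordge d f.
Proof.
split=> h m md; apply: h; first by apply/eqP; rewrite subn_eq0.
by rewrite -subn_eq0; apply/eqP.
Qed.

Lemma comp_ordge_diff d j f (s t : 'I_n -> fps n A) :
  (forall i, ordge 1 (s i)) -> (forall i, ordge 1 (t i)) ->
  (forall i, ordge d.+1 (s i - t i)) -> ordge j f ->
  ordge (j + d)%N (fps_comp f s - fps_comp f t).
Proof.
move=> hs ht hst hf; apply/fil_ordT/(fil_comp_diff ordT_filt); last exact/fil_ordT.
- by move=> i; apply/fil_ordT/hs.
- by move=> i; apply/fil_ordT/ht.
- by move=> i; apply/fil_ordT/hst.
Qed.

Lemma int_ordge i j f : ordge j f -> ordge j.+1 (fps_int i f).
Proof. by move=> hf; apply/fil_ordT/(fil_int ordT_filt)/fil_ordT. Qed.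

Lemma dv_ordge i j f : ordge j.+1 f -> ordge j (dv i f).
Proof. by move=> hf m md; apply: hf; rewrite mdegD mdeg1 addn1 ltnS. Qed.

End OrderFiltration.

(** * Fixed points in the Krull topology *)

Section KrullFix.
Variables (n : nat) (A : comUnitRingType) (I : Type).
Implicit Types u v : I -> fps n A.

(** Banach's fixed point theorem for the Krull topology, with an invariant [Pr] that survives limits
    and therefore holds for the solution. The index type I covers single series ([unit]) and tuples
    alike. *)
Lemma krull_fix (Pr : (I -> fps n A) -> Prop) (Phi : (I -> fps n A) -> I -> fps n A) u0 :
  Pr u0 -> (forall u, Pr u -> Pr (Phi u)) ->
  (forall u v d, Pr u -> Pr v -> (forall i, ordge d (u i - v i)) ->
     forall i, ordge d.+1 (Phi u i - Phi v i)) ->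
  (forall u, (forall d, exists2 v, Pr v & forall i, ordge d (u i - v i)) -> Pr u) ->
  exists2 u, Pr u & Phi u = u.
Proof.
move=> h0 hP hc hcl; pose w N := iter N Phi u0.
have hw N : Pr (w N) by elim: N => // N IH; apply: hP.
have step N i : ordge N (w N.+1 i - w N i).
  by elim: N i => [|N IH] i //; exact: (hc _ _ N (hw N.+1) (hw N) IH).
have far N e i : ordge N (w (N + e)%N i - w N i).
  elim: e => [|e IH]; first by rewrite addn0 subrr.
  rewrite addnS -(subrK (w (N + e)%N i) (w (N + e).+1 i)) -addrA.
  by apply: ordgeD => //; apply: ordgeW (step _ _); apply: leq_addr.
(* The iterate of rank N is already stationary in degrees below N, so this diagonal choice reads
   each coefficient once it is final. *)
pose L i : fps n A := fun m => w (mdeg m).+1 i m.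
have hL N i : ordge N (L i - w N i).
  move=> m mN; rewrite fpsB /L; have := far (mdeg m).+1 (N - (mdeg m).+1)%N i m (leqnn _).
  by rewrite subnKC // fpsB => /eqP; rewrite subr_eq0 => /eqP ->; rewrite subrr.
have PL : Pr L by apply: hcl => d; exists (w d).
exists L => //; apply/funext => i; apply: ordge_eq => d.
have -> : Phi L i - L i = (Phi L i - Phi (w d) i) + (w d.+1 i - L i).
  by rewrite /w iterS addrA subrK.
apply: ordgeW (leqnSn d) _; apply: ordgeD; first exact: (hc _ _ d PL (hw d) (hL d)).
by rewrite -opprB; apply/ordgeN/hL.
Qed.

Lemma tclosed_all (P : I -> fps n A -> Prop) : (forall i, kclosed (P i)) ->
  forall u, (forall d, exists2 v, (forall i, P i (v i)) & forall i, ordge d (u i - v i)) ->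
  forall i, P i (u i).
Proof.
by move=> h u hu i; apply: h => d; have [v hv uv] := hu d; exists (v i).
Qed.

Lemma kclosed_and (P Q : fps n A -> Prop) : kclosed P -> kclosed Q ->
  kclosed (fun f => P f /\ Q f).
Proof.
move=> hP hQ f h; split; [apply: hP|apply: hQ] => d; have [g [p q] fg] := h d; by exists g.
Qed.

Lemma kclosed_ordge j : kclosed (@ordge n A j).
Proof.
move=> f h; rewrite -(fil_ordT j f); apply: fil_closed => d; have [g hg fg] := h d.
by exists g => //; apply/fil_ordT.
Qed.

Lemma kclosed_eq (F G : fps n A -> fps n A) c :
  (forall f g d, ordge (d + c)%N (f - g) -> ordge d (F f - F g)) ->
  (forall f g d, ordge (d + c)%N (f - g) -> ordge d (G f - G g)) ->
  kclosed (fun f => F f = G f).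
Proof.
move=> hF hG f h; apply: ordge_eq => d; have [g e fg] := h (d + c)%N.
have -> : F f - G f = (F f - F g) - (G f - G g) by rewrite e; ring.
by apply: ordgeB; [apply: hF|apply: hG].
Qed.

(** P is a closed ideal; tuples congruent modulo P then give congruent substitutions into any
    series. *)
Lemma comp_mod_ideal (P : fps n A -> Prop) (s t : 'I_n -> fps n A) f : kclosed P -> P 0 ->
  (forall g h, P g -> P h -> P (g + h)) -> (forall g h, P g -> P (g * h)) ->
  vanish_at0 s -> vanish_at0 t -> (forall i, P (s i - t i)) -> P (fps_comp f s - fps_comp f t).
Proof.
move=> hc h0 hD hM hs ht st.
apply: (@fps_dense _ _ (fun f => P (fps_comp f s - fps_comp f t))) => [a|i|g h hg hh|g h hg hh|g hg].
- by rewrite !compC // subrr.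
- by rewrite !compX.
- by rewrite !compD // opprD addrACA; apply: hD.
- rewrite !compM //; have -> : fps_comp g s * fps_comp h s - fps_comp g t * fps_comp h t =
    (fps_comp g s - fps_comp g t) * fps_comp h s + (fps_comp h s - fps_comp h t) * fps_comp g t by ring.
  by apply: hD; apply: hM.
apply: hc => d; have [h Ph gh] := hg d; exists (fps_comp h s - fps_comp h t) => //.
have -> : fps_comp g s - fps_comp g t - (fps_comp h s - fps_comp h t) =
  fps_comp (g - h) s - fps_comp (g - h) t by rewrite !compB //; ring.
by apply: ordgeB; apply: fps_comp_ordge.
Qed.

End KrullFix.

(** * Inverses and restriction to a coordinate hyperplane *)

Section Inverse.
Variables (n : nat) (A : comUnitRingType).

(** The geometric series as a fixed point: with a f = 1 + r and r without constant term, the inverse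
    solves u = a - r u. *)
Lemma fps_inv (f : fps n A) : f 0%MM \is a GRing.unit -> exists g, f * g = 1.
Proof.
move=> hu; pose a := (f 0%MM)^-1; pose r : fps n A := cst a * f - 1.
have hr : ordge 1 r.
  by apply/ordge1E; rewrite /r fpsB fps_mulC_E /a mulVr // fps1E eqxx subrr.
have [//|u _ eu] := @krull_fix n A unit (fun _ => True) (fun u _ => cst a - r * u tt)
  (fun _ => 0) I (fun _ _ => I) _ (fun _ _ => I).
  move=> u v d _ _ uv _.
  have -> : cst a - r * u tt - (cst a - r * v tt) = - (r * (u tt - v tt)) by ring.
  by apply: ordgeN; rewrite -add1n; apply: ordgeM.
have e : cst a - r * u tt = u tt by rewrite -{2}eu.
exists (u tt); have {}e : cst a * (f * u tt) = cst a.
  by rewrite -[RHS](subrK (r * u tt)) e /r; ring.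
have := congr1 (fun g : fps n A => cst (f 0%MM) * g) e.
by rewrite mulrA -rmorphM /= divrr // rmorph1 mul1r.
Qed.

End Inverse.

Section Restriction.
Variables (n : nat) (A : comUnitRingType).
Hypothesis hQ : forall j, (j.+1%:R : A) \is a GRing.unit.
Implicit Types (f g h : fps n A) (m k : 'X_{1..n}) (a b : A) (i : 'I_n).
Notation X i := (fps_X A i : fps n A).

Lemma deriv_int i f : fps_deriv i (fps_int i f) = f.
Proof.
apply/funext => m; rewrite /fps_deriv /fps_int mnmDE mnm1E eqxx addn1 /= addmK.
by rewrite -mulrnAl -[_^-1 *+ _]mulr_natr mulVr ?mul1r //; apply: hQ.
Qed.

Lemma intD i f g : fps_int i (f + g) = fps_int i f + fps_int i g.
Proof.
by apply/funext => m; rewrite /fps_int !fpsD; case: eqP; rewrite ?addr0 // mulrDr.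
Qed.
Lemma intN i f : fps_int i (- f) = - fps_int i f.
Proof. by apply/funext => m; rewrite /fps_int !fpsN; case: eqP; rewrite ?oppr0 // mulrN. Qed.
Lemma intB i f g : fps_int i (f - g) = fps_int i f - fps_int i g.
Proof. by rewrite intD intN. Qed.
Lemma intZ i a f : fps_int i (a *: f) = a *: fps_int i f.
Proof.
by apply/funext => m; rewrite /fps_int !fpsZ; case: eqP; rewrite ?mulr0 // mulrCA.
Qed.

Lemma dvB i f g : dv i (f - g) = dv i f - dv i g. Proof. by []. Qed.

Lemma dvX i f : dv i (X i * f) = f.
Proof. by apply/funext => m; rewrite /dv fps_mulX_U. Qed.

Lemma mulX_inj i f g : X i * f = X i * g -> f = g.
Proof. by move=> e; rewrite -(dvX i f) e dvX. Qed.

(** Substituting this tuple restricts a series to the hyperplane x_i = 0. *)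
Definition res i : 'I_n -> fps n A := fun j => if j == i then 0 else X j.

Lemma res_ordge i j : ordge 1 (res i j).
Proof. by rewrite /res; case: eqP => // _; apply: ordge_X. Qed.

Lemma res_vanish i : vanish_at0 (res i).
Proof. by move=> j; apply: res_ordge; rewrite mdeg0. Qed.

(** Modulo the closed ideal generated by x_i, a series agrees with its restriction to x_i = 0. *)
Lemma res_dvd i f : fps_comp f (res i) = 0 -> f = X i * dv i f.
Proof.
pose P g := X i * dv i g = g; have PX g : P (X i * g) by rewrite /P dvX.
have hv := @res_vanish i; have hc : kclosed P.
  apply: (@kclosed_eq n A (fun g => X i * dv i g) id 1) => u w d h; rewrite ?addn1 in h.
    by rewrite -mulrBr -dvB; apply/ordgeMr/dv_ordge.
  exact: ordgeW h.
move=> e; apply/esym; rewrite -/(P f) -[f]subr0 -e -{1}[f]comp_id.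
apply: comp_mod_ideal => // [|g h <- <-|g h <-||j]; first by rewrite -(mulr0 (X i)); apply: PX.
- by rewrite -mulrDr; apply: PX.
- by rewrite -mulrA; apply: PX.
- exact: vanish_X.
rewrite /res; case: eqP => [->|_]; rewrite ?subr0 ?subrr.
  by rewrite -[X i]mulr1; apply: PX.
by rewrite -(mulr0 (X i)); apply: PX.
Qed.

Lemma mulX_res i f : fps_comp (X i * f) (res i) = 0.
Proof.
have hv := @res_vanish i.
by rewrite compM // compX // /res eqxx mul0r.
Qed.

Lemma int_dvd i f : exists q, fps_int i f = X i * q.
Proof.
exists (dv i (fps_int i f)); apply/funext => m; rewrite fps_mulXE /dv.
case: eqP => [e|/eqP e]; first by rewrite /fps_int e eqxx.
by rewrite mnm_subU // lt0n.
Qed.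

Lemma int_res i f : fps_comp (fps_int i f) (res i) = 0.
Proof. by have [q ->] := int_dvd i f; apply: mulX_res. Qed.

Lemma deriv0_coef i f m : fps_deriv i f = 0 -> (0 < m i)%N -> f m = 0.
Proof.
move=> e mi; have := congr1 (fun g : fps n A => g (m - U_(i))%MM) e.
rewrite /fps_deriv mnm_subU // -mulr_natl fps0 => /(congr1 (fun a => (m i)%:R^-1 * a)).
have -> : ((m - U_(i))%MM i).+1 = m i by rewrite mnmBE mnm1E eqxx; lia.
rewrite mulrA mulVr ?mul1r ?mulr0 //.
by move: mi; case: (m i) => // j _; apply: hQ.
Qed.

Lemma deriv0_comp i f (s t : 'I_n -> fps n A) : fps_deriv i f = 0 ->
  (forall j, j != i -> s j = t j) -> fps_comp f s = fps_comp f t.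
Proof.
move=> e st; apply/funext => m; rewrite /fps_comp; apply: eq_bigr => k _.
case: (posnP (k i)) => [ki|/(deriv0_coef e) ->]; last by rewrite !mul0r.
congr (_ * (_ : fps n A) m); apply: eq_bigr => j _.
by case: (eqVneq j i) => [->|/st ->] //; rewrite ki !expr0.
Qed.

Lemma deriv0_res i f : fps_deriv i f = 0 -> fps_comp f (res i) = f.
Proof.
move=> e; rewrite -[RHS]comp_id; apply: deriv0_comp e _ => j ji.
by rewrite /res (negbTE ji).
Qed.

Lemma int_deriv i f : fps_comp f (res i) = 0 -> fps_int i (fps_deriv i f) = f.
Proof.
move=> f0; apply/eqP; rewrite -subr_eq0; apply/eqP.
have e : fps_deriv i (fps_int i (fps_deriv i f) - f) = 0.
  by rewrite derivB deriv_int subrr.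
by rewrite -(deriv0_res e) compB ?int_res ?f0 ?subrr //; apply: res_vanish.
Qed.

End Restriction.

(** Pascal's rule in the form needed both for the Leibniz formula and for the recursion [Qk_S]. *)
Lemma pascal_sum (V : nmodType) (G : nat -> nat -> V) j :
  \sum_(i < j.+1) G i.+1 (j - i)%N *+ 'C(j, i) + \sum_(i < j.+1) G i (j.+1 - i)%N *+ 'C(j, i)
  = \sum_(i < j.+2) G i (j.+1 - i)%N *+ 'C(j.+1, i).
Proof.
rewrite -!(big_mkord xpredT (fun i => G i.+1 (j - i)%N *+ 'C(j, i))).
rewrite -!(big_mkord xpredT (fun i => G i (j.+1 - i)%N *+ 'C(_, i))).
rewrite [RHS]big_nat_recl // bin0.
under [X in _ = _ + X]eq_bigr do rewrite binS mulrnDr subSS.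
rewrite big_split /= [RHS]addrA [RHS]addrC; congr (_ + _).
rewrite [in RHS]big_nat_recr //= bin_small // mulr0n addr0.
by rewrite [LHS]big_nat_recl // bin0.
Qed.

(** * Power series in a derivation *)

Section OpSeries.
Variables (n : nat) (A : comUnitRingType).
Implicit Types (f g h : fps n A) (m k : 'X_{1..n}) (a b : A) (c : nat -> A).
Variables (V : 'I_n -> fps n A) (hV : forall i, ordge 2 (V i)).
Notation D := (vf_act V).

Lemma iter_ordge j d f : ordge d f -> ordge (d + j)%N (iter j D f).
Proof.
by move=> hf; elim: j => [|j IH]; rewrite ?addn0 // addnS iterS; apply: vf_ordge.
Qed.

Lemma iterB j f g : iter j D (f - g) = iter j D f - iter j D g.
Proof. by elim: j => // j IH; rewrite !iterS IH vfB. Qed.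
Lemma iterZ j a f : iter j D (a *: f) = a *: iter j D f.
Proof. by elim: j => // j IH; rewrite !iterS IH vfZ. Qed.
Lemma iter_sum j (I : Type) (r : seq I) (P : pred I) (F : I -> fps n A) :
  iter j D (\sum_(i <- r | P i) F i) = \sum_(i <- r | P i) iter j D (F i).
Proof. by elim: j => // j IH; rewrite iterS IH vf_sum. Qed.

(** The series of all c_j D^j f. As V has order at least 2, D raises the order by one, so the
    omitted terms have no monomial m. *)
Definition op c f : fps n A := fun m => \sum_(j < (mdeg m).+1) c j * iter j D f m.

Lemma op_ordge c f N : ordge N (op c f - \sum_(j < N) c j *: iter j D f).
Proof.
move=> m mN; rewrite fpsB fps_sum /op.
rewrite -!(big_mkord xpredT (fun j => c j * iter j D f m)).
rewrite (big_cat_nat (n := (mdeg m).+1) (p := N)) //= opprD addrA subrr add0r.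
apply/eqP; rewrite oppr_eq0; apply/eqP; rewrite big_nat big1 // => j /andP[mj _].
by have := @iter_ordge j 0 f (@ordge0 _ _ f); rewrite add0n => -> //; rewrite mulr0.
Qed.

Lemma opB c f g : op c (f - g) = op c f - op c g.
Proof.
apply/funext => m; rewrite fpsB /op -sumrB; apply: eq_bigr => j _.
by rewrite iterB fpsB mulrBr.
Qed.
Lemma op_ord c d f : ordge d f -> ordge d (op c f).
Proof.
move=> hf m md; rewrite /op big1 // => j _; have := @iter_ordge j d f hf m.
by move=> ->; rewrite ?mulr0 // (leq_trans md) // leq_addr.
Qed.

(** Square and triangular partial sums of a Cauchy product differ only by terms with i + j at least
    N. *)
Lemma square_triangle (F : nat -> nat -> fps n A) N :
  (forall i j, ordge (i + j)%N (F i j)) ->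
  ordge N (\sum_(i < N) \sum_(j < N) F i j - \sum_(j < N) \sum_(i < j.+1) F i (j - i)%N).
Proof.
move=> hF.
have -> : \sum_(j < N) \sum_(i < j.+1) F i (j - i)%N =
          \sum_(i < N) \sum_(j < N - i) F i j.
  elim: N => [|N IH]; first by rewrite !big_ord0.
  rewrite [LHS]big_ord_recr IH /= [X in _ + X]big_ord_recr /= subnn.
  rewrite [RHS]big_ord_recr /= subSnn big_ord_recl big_ord0 addr0 addrA; congr (_ + _).
  rewrite -big_split /=; apply: eq_bigr => i _.
  by rewrite subSn ?(ltnW (ltn_ord i)) // big_ord_recr.
rewrite -sumrB; apply: ordge_sum => i _.
rewrite -(big_mkord xpredT (fun j => F i j)) -(big_mkord xpredT (fun j => F i j)).
rewrite (big_cat_nat (n := (N - i)%N) (p := N)) ?leq_subr //= addrAC subrr add0r.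
rewrite big_nat; apply: ordge_sum => j /andP[ji _].
by apply: ordgeW (hF i j); rewrite -leq_subLR.
Qed.

Definition conv c c' : nat -> A := fun j => \sum_(i < j.+1) c i * c' (j - i)%N.

Lemma op_op c c' f : op c (op c' f) = op (conv c c') f.
Proof.
apply: ordge_eq => N; pose G := \sum_(j < N) c' j *: iter j D f.
pose F i j := (c i * c' j) *: iter (i + j) D f.
have hF i j : ordge (i + j)%N (F i j).
  have := @iter_ordge (i + j) 0 f (@ordge0 _ _ f); rewrite add0n => h.
  by rewrite /F scaleE; apply: ordgeMr.
have eG : \sum_(i < N) c i *: iter i D G = \sum_(i < N) \sum_(j < N) F i j.
  apply: eq_bigr => i _; rewrite iter_sum scaler_sumr; apply: eq_bigr => j _.
  by rewrite iterZ scalerA /F iterD.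
have eT : \sum_(j < N) conv c c' j *: iter j D f = \sum_(j < N) \sum_(i < j.+1) F i (j - i)%N.
  apply: eq_bigr => j _; rewrite scaler_suml; apply: eq_bigr => i _.
  by rewrite /F subnKC // -ltnS.
have -> : op c (op c' f) - op (conv c c') f =
  op c (op c' f - G) + (op c G - \sum_(i < N) c i *: iter i D G)
  + (\sum_(i < N) \sum_(j < N) F i j - \sum_(j < N) \sum_(i < j.+1) F i (j - i)%N)
  - (op (conv c c') f - \sum_(j < N) conv c c' j *: iter j D f).
  by rewrite opB eG eT; ring.
apply: ordgeB; last exact: op_ordge.
apply: ordgeD; last exact: square_triangle.
by apply: ordgeD; [apply/op_ord/op_ordge|apply: op_ordge].
Qed.

Lemma iterSr_D j f : D (iter j D f) = iter j D (D f).
Proof. by rewrite -iterS iterSr. Qed.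

Lemma op_D c f : op c (D f) = D (op c f).
Proof.
apply: ordge_eq => N.
have -> : op c (D f) - D (op c f) = (op c (D f) - \sum_(j < N) c j *: iter j D (D f))
   - D (op c f - \sum_(j < N) c j *: iter j D f).
  rewrite vfB vf_sum; have -> : \sum_(j < N) D (c j *: iter j D f) =
     \sum_(j < N) c j *: iter j D (D f).
    by apply: eq_bigr => j _; rewrite vfZ iterSr_D.
  ring.
apply: ordgeB; first exact: op_ordge.
by apply: ordgeW (leqnSn N) _; apply/vf_ordge/op_ordge.
Qed.

Lemma op_S c f : op c f = c 0%N *: f + op (fun j => c j.+1) (D f).
Proof.
apply: ordge_eq => N.
have -> : op c f - (c 0%N *: f + op (fun j => c j.+1) (D f)) =
  (op c f - \sum_(j < N.+1) c j *: iter j D f)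
  - (op (fun j => c j.+1) (D f) - \sum_(j < N) c j.+1 *: iter j D (D f)).
  rewrite big_ord_recl /=; have -> : \sum_(i < N) c (bump 0 i) *: iter (bump 0 i) D f =
     \sum_(j < N) c j.+1 *: iter j D (D f).
    by apply: eq_bigr => j _; rewrite /bump /= add1n iterSr_D.
  ring.
apply: ordgeB; last exact: op_ordge.
by apply: ordgeW (leqnSn N) _; apply: op_ordge.
Qed.

Lemma op_ext c c' f : c =1 c' -> op c f = op c' f.
Proof. by move=> h; apply/funext => m; apply: eq_bigr => j _; rewrite h. Qed.

Lemma op_delta f : op (fun j => (j == 0%N)%:R) f = f.
Proof.
apply/funext => m; rewrite /op big_ord_recl /= mul1r big1 ?addr0 // => j _.
by rewrite mul0r.
Qed.

Definition expv := op (fun j => j`!%:R^-1).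

Lemma expv_split2g f :
  expv f = f + (D f + op (fun j => j.+2`!%:R^-1) (iter 2 D f)).
Proof.
rewrite /expv op_S // fact0 invr1 scale1r; congr (_ + _).
by rewrite op_S // (_ : 1`! = 1%N) // invr1 scale1r.
Qed.

Hypothesis hQ : forall j, (j.+1%:R : A) \is a GRing.unit.

Lemma fact_unit j : (j`!%:R : A) \is a GRing.unit.
Proof.
elim: j => [|j IH]; first by rewrite fact0 unitr1.
by rewrite factS natrM unitrM hQ.
Qed.

Lemma leibniz j f g : iter j D (f * g) =
  \sum_(i < j.+1) (iter i D f * iter (j - i) D g) *+ 'C(j, i).
Proof.
elim: j => [|j IH]; first by rewrite big_ord_recl big_ord0 /= addr0.
rewrite iterS IH vf_sum.
have e (i : 'I_j.+1) : D ((iter i D f * iter (j - i) D g) *+ 'C(j, i)) =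
  (iter i.+1 D f * iter (j - i) D g) *+ 'C(j, i) + (iter i D f * iter (j.+1 - i) D g) *+ 'C(j, i).
  rewrite -!scaler_nat vfZ vfM -iterS -iterS scalerDr subSn //; exact: (ltn_ord i).
rewrite (eq_bigr _ (fun i _ => e i)) big_split /=.
exact: (pascal_sum (fun p q => iter p D f * iter q D g)).
Qed.

Lemma expvM f g : expv (f * g) = expv f * expv g.
Proof.
apply: ordge_eq => N.
pose a j := (j`!%:R^-1 : A) *: iter j D f; pose b j := (j`!%:R^-1 : A) *: iter j D g.
have ho h j : ordge j ((j`!%:R^-1 : A) *: iter j D h).
  have := @iter_ordge j 0 h (@ordge0 _ _ h); rewrite add0n => hh.
  by rewrite scaleE; apply: ordgeMr.
have eT : \sum_(j < N) (j`!%:R^-1 : A) *: iter j D (f * g) =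
   \sum_(j < N) \sum_(i < j.+1) a i * b (j - i)%N.
  apply: eq_bigr => j _; rewrite leibniz scaler_sumr; apply: eq_bigr => i _.
  rewrite /a /b -scaler_nat !scaleE.
  have ij : (i <= j)%N by rewrite -ltnS.
  have := bin_fact ij => /(congr1 (fun x : nat => x%:R : A)); rewrite !natrM => ef.
  have -> : (j`!%:R^-1 : A) = ('C(j, i)%:R)^-1 * (i`!%:R^-1 * (j - i)`!%:R^-1).
    apply: (mulrI (fact_unit j)); rewrite mulrV ?fact_unit // -ef.
    have uC : ('C(j, i)%:R : A) \is a GRing.unit.
      by have := fact_unit j; rewrite -ef unitrM => /andP[].
    transitivity (('C(j, i)%:R / 'C(j, i)%:R) * ((i`!%:R / i`!%:R) *
       ((j - i)`!%:R / (j - i)`!%:R)) : A); first by rewrite !mulrV ?fact_unit // !mulr1.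
    ring.
  have uC : ('C(j, i)%:R : A) \is a GRing.unit.
    by have := fact_unit j; rewrite -ef unitrM => /andP[].
  have eC : cst (('C(j, i)%:R)^-1) * cst 'C(j, i)%:R = 1 :> fps n A.
    by rewrite -rmorphM mulVr // rmorph1.
  rewrite !rmorphM /=; transitivity ((cst (('C(j, i)%:R)^-1) * cst 'C(j, i)%:R) *
    ((cst i`!%:R^-1 * iter i D f) * (cst (j - i)`!%:R^-1 * iter (j - i) D g)) : fps n A); first ring.
  by rewrite eC mul1r.
have -> : expv (f * g) - expv f * expv g =
  (expv (f * g) - \sum_(j < N) (j`!%:R^-1 : A) *: iter j D (f * g))
  - ((expv f - \sum_(j < N) a j) * expv g + (\sum_(j < N) a j) * (expv g - \sum_(j < N) b j))
  - (\sum_(i < N) \sum_(j < N) a i * b j - \sum_(j < N) \sum_(i < j.+1) a i * b (j - i)%N).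
  rewrite eT; have -> : \sum_(i < N) \sum_(j < N) a i * b j = (\sum_(j < N) a j) * (\sum_(j < N) b j).
    by rewrite mulr_suml; apply: eq_bigr => i _; rewrite mulr_sumr.
  ring.
apply: ordgeB; last by apply: (@square_triangle (fun i j => a i * b j)) => i j; apply: ordgeM; apply: ho.
apply: ordgeB; first exact: op_ordge.
by apply: ordgeD; [apply: ordgeMl|apply: ordgeMr]; apply: op_ordge.
Qed.

Lemma expvB f g : expv (f - g) = expv f - expv g. Proof. exact: opB. Qed.
Lemma expv0 : expv 0 = 0. Proof. by have := expvB 0 0; rewrite !subrr. Qed.
Lemma expvD f g : expv (f + g) = expv f + expv g.
Proof.
have e : expv (- g) = - expv g by rewrite -[- g]sub0r expvB expv0 sub0r.
by have := expvB f (- g); rewrite opprK e opprK.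
Qed.
Lemma expvC a : expv (cst a) = cst a.
Proof.
apply/funext => m; rewrite /expv /op big_ord_recl /= fact0 invr1 mul1r big1 ?addr0 // => j _.
rewrite /bump /= add1n iterSr_D vfC.
have -> : iter j D 0 = 0 by elim: (nat_of_ord j) => // e IH; rewrite iterS IH vf0.
by rewrite mulr0.
Qed.

(** A continuous algebra endomorphism is a substitution. This links the operator exponential with
    the diffeomorphism whose components are the [expv] of the coordinates. *)
Lemma expv_comp f : expv f = fps_comp f (fun i => expv (fps_X A i)).
Proof.
have hv : vanish_at0 (fun i => expv (fps_X A i)).
  by move=> i; apply: (op_ord _ (@ordge_X _ _ i)); rewrite mdeg0.
pose P f := expv f = fps_comp f (fun i => expv (fps_X A i)).
apply: (@fps_dense _ _ P) => [a|i|u w hu hw|u w hu hw|]; rewrite /P.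
- by rewrite compC // expvC.
- by rewrite compX.
- by rewrite compD // expvD hu hw.
- by rewrite compM // expvM hu hw.
apply: (@kclosed_eq _ _ _ _ 0) => u w d; rewrite addn0 => h.
  by rewrite -expvB; apply: op_ord.
by rewrite -compB //; apply: fps_comp_ordge.
Qed.

End OpSeries.

(** * The family of unipotent diffeomorphisms *)

Section Family.
Variables (n : nat) (A : comUnitRingType).
Hypothesis hQ : forall j, (j.+1%:R : A) \is a GRing.unit.
Variables (ix iy : 'I_n) (hxy : ix != iy).
Implicit Types (f g h : fps n A) (m k : 'X_{1..n}) (a b : A) (i : 'I_n).

Notation X i := (fps_X A i : fps n A).
Notation x := (X ix).
Notation y := (X iy).
Notation tup := ('I_n -> fps n A).

Let hyx : (iy == ix) = false. Proof. by rewrite eq_sym (negbTE hxy). Qed.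

Definition crossf : fps n A := y * (x + y *+ 2).
Definition crossX : tup := fun j => if j == iy then crossf else 0.
Definition shm : tup := fun j => if j == ix then x - y *+ 2 else X j.
Definition shp : tup := fun j => if j == ix then x + y *+ 2 else X j.
(** The line x + 2 y = 0, parametrized by y. *)
Definition branch2 : tup := fun j => if j == ix then - (y *+ 2) else X j.
(** Restriction to the plane of the two active coordinates; the diffeomorphism leaves all other
    coordinates fixed. *)
Definition kap : tup := fun j => if (j == ix) || (j == iy) then X j else 0.
(* division by crossf: the shears send the line x + 2 y = 0 to x = 0 and back *)
Definition divf f : fps n A := fps_comp (dv ix (fps_comp (dv iy f) shm)) shp.

Lemma ordge_2y : ordge 1 (y *+ 2 : fps n A).
Proof. by rewrite mulr2n; apply: ordgeD; apply: ordge_X. Qed.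

Lemma shm1 j : ordge 1 (shm j).
Proof.
rewrite /shm; case: eqP => _; last exact: ordge_X.
by apply: ordgeB; [apply: ordge_X|apply: ordge_2y].
Qed.
Lemma shp1 j : ordge 1 (shp j).
Proof.
rewrite /shp; case: eqP => _; last exact: ordge_X.
by apply: ordgeD; [apply: ordge_X|apply: ordge_2y].
Qed.
Lemma io21 j : ordge 1 (branch2 j).
Proof.
rewrite /branch2; case: eqP => _; last exact: ordge_X.
by apply/ordgeN/ordge_2y.
Qed.
Lemma kap1 j : ordge 1 (kap j).
Proof. by rewrite /kap; case: (_ || _) => //; apply: ordge_X. Qed.

Lemma ordge_vanish (s : tup) : (forall j, ordge 1 (s j)) -> vanish_at0 s.
Proof. by move=> h j; apply: h; rewrite mdeg0. Qed.

Let vm := ordge_vanish shm1.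
Let vp := ordge_vanish shp1.
Let v2 := ordge_vanish io21.
Let vk := ordge_vanish kap1.
Let v1 := @res_vanish n A iy.

Lemma shmp f : fps_comp (fps_comp f shm) shp = f.
Proof.
rewrite comp_comp // -[RHS]comp_id; apply: comp_eq => j.
rewrite /shm; case: eqP => [->|/eqP jx]; last by rewrite compX // /shp (negbTE jx).
by rewrite compB // compMn // !compX // /shp eqxx hyx addrK.
Qed.

Lemma divf_ffM f : divf (crossf * f) = f.
Proof.
rewrite /divf /crossf -mulrA dvX compM // compD // compMn // !compX // /shm eqxx hyx.
by rewrite subrK dvX shmp.
Qed.

Lemma ff_inj f g : crossf * f = crossf * g -> f = g.
Proof. by move=> e; rewrite -(divf_ffM f) e divf_ffM. Qed.

Lemma ff_eq0 f : crossf * f = 0 -> f = 0.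
Proof. by move=> e; apply: ff_inj; rewrite e mulr0. Qed.

(** Divide by y first. On x + 2 y = 0 the factor y can be cancelled, so the quotient vanishes there,
    and a shear turns this line into x = 0. *)
Lemma ff_dvd f : fps_comp f (res A iy) = 0 -> fps_comp f branch2 = 0 -> f = crossf * divf f.
Proof.
move=> h1 h2; pose g := dv iy f.
have e1 : f = y * g by apply: res_dvd.
have e2 : fps_comp g branch2 = 0.
  apply: (@mulX_inj _ _ iy); rewrite mulr0 -h2 [in RHS]e1 compM // compX //.
  by rewrite /branch2 hyx.
have e3 : fps_comp (fps_comp g shm) (res A ix) = 0.
  have vr := @res_vanish n A ix.
  rewrite comp_comp // -e2; apply: comp_eq => j; rewrite /shm /branch2.
  case: eqP => [_|/eqP jx]; last by rewrite compX // /res (negbTE jx).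
  by rewrite compB // compMn // !compX // /res eqxx hyx sub0r.
have e4 := res_dvd e3.
rewrite /divf -/g [LHS]e1 /crossf -mulrA; congr (_ * _).
rewrite -[LHS]shmp e4 compM // compX // /shp eqxx; congr (_ * _).
by rewrite dvX.
Qed.

Lemma divfB f g : divf (f - g) = divf f - divf g.
Proof. by rewrite /divf dvB compB // dvB compB. Qed.

Lemma vf_Xb f : vf_act crossX f = crossf * fps_deriv iy f.
Proof.
rewrite /vf_act (bigD1 iy) //= /crossX eqxx big1 ?addr0 // => j jy.
by rewrite (negbTE jy) mul0r.
Qed.

Lemma ff2 : ordge 2 crossf.
Proof.
rewrite -[2%N]/(1 + 1)%N; apply: ordgeM; first exact: ordge_X.
by apply: ordgeD; [apply: ordge_X|apply: ordge_2y].
Qed.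

Lemma Xb2 i : ordge 2 (crossX i).
Proof. by rewrite /crossX; case: eqP => _ //; apply: ff2. Qed.

Notation e := (expv crossX).

Lemma expv_split f : e f = f + crossf * fps_deriv iy (op crossX (fun j => j.+1`!%:R^-1) f).
Proof. by rewrite /expv op_S ?fact0 ?invr1 ?scale1r ?op_D ?vf_Xb //; apply: Xb2. Qed.

Lemma expv_split2 f : e f - f - crossf * fps_deriv iy f =
  op crossX (fun j => j.+2`!%:R^-1) (vf_act crossX (vf_act crossX f)).
Proof. by rewrite (expv_split2g Xb2) -vf_Xb; ring. Qed.

Variable l : A.
Definition theta : tup := fun j =>
  if j == ix then x + l ^+ 2 *: crossf ^+ 2 else if j == iy then y + l *: crossf ^+ 2 else X j.

Lemma ff4 : ordge 4 (crossf ^+ 2).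
Proof. by have := @ordgeX _ _ 2 crossf 2 ff2. Qed.

Lemma theta_diff j : exists q, theta j - X j = crossf ^+ 2 * q.
Proof.
rewrite /theta; case: eqP => [->|_].
  by exists (cst (l ^+ 2)); rewrite scaleE; ring.
case: eqP => [->|_]; first by exists (cst l); rewrite scaleE; ring.
by exists 0; rewrite subrr mulr0.
Qed.

Lemma theta_ord j : ordge 4 (theta j - X j).
Proof. by have [q ->] := theta_diff j; apply/ordgeMl/ff4. Qed.

Lemma theta1 j : ordge 1 (theta j).
Proof.
rewrite -(subrK (X j) (theta j)); apply: ordgeD; last exact: ordge_X.
exact: ordgeW (theta_ord j).
Qed.
Let vt := ordge_vanish theta1.

Definition pert_exp : tup := fun j => fps_comp (e (X j)) theta.

Let ve : vanish_at0 (fun j => e (X j)).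
Proof.
apply: ordge_vanish => j; have hx := Xb2; apply: op_ord => //; exact: ordge_X.
Qed.

Lemma phi_vanish : vanish_at0 pert_exp.
Proof. by move=> j; rewrite /pert_exp comp_at0 // ve. Qed.

Lemma comp_phi f : fps_comp f pert_exp = fps_comp (e f) theta.
Proof. by rewrite (expv_comp Xb2 hQ f) comp_comp. Qed.

Lemma theta_ff_comp (s : tup) f : vanish_at0 s -> fps_comp crossf s = 0 ->
  fps_comp (fps_comp f theta) s = fps_comp f s.
Proof.
move=> vs h; rewrite comp_comp //; apply: comp_eq => j.
have [q eq] := theta_diff j; rewrite -(subrK (X j) (theta j)) eq.
by rewrite compD // compM // compXn // h expr2 mul0r mul0r add0r compX.
Qed.

Lemma phi_ff_comp (s : tup) f : vanish_at0 s -> fps_comp crossf s = 0 ->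
  fps_comp (fps_comp f pert_exp) s = fps_comp f s.
Proof.
move=> vs h; rewrite comp_phi theta_ff_comp // expv_split compD // compM // h.
by rewrite mul0r addr0.
Qed.

Lemma ff_res : fps_comp crossf (res A iy) = 0.
Proof. by rewrite compM // compX // /res eqxx mul0r. Qed.

Lemma ff_io2 : fps_comp crossf branch2 = 0.
Proof.
by rewrite compM // compD // compMn // !compX // /branch2 eqxx hyx addNr mulr0.
Qed.

(** The part of f o phi - f beyond its leading term. The cohomological equation for G becomes
    [crossf] dG/dy = [crossf]^2 - [Nop] G, where [Nop] gains two orders. *)
Definition Nop f := fps_comp f pert_exp - f - crossf * fps_deriv iy f.

Lemma NopB f g : Nop (f - g) = Nop f - Nop g.
Proof. by have vph := phi_vanish; rewrite /Nop compB // derivB; ring. Qed.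

(** [pert_exp] fixes both lines pointwise, so the remainder vanishes on them. *)
Lemma Nop_dvd f : Nop f = crossf * divf (Nop f).
Proof.
apply: ff_dvd; rewrite /Nop !compB //.
  by rewrite phi_ff_comp ?ff_res // subrr compM // ff_res mul0r subr0.
by rewrite phi_ff_comp ?ff_io2 // subrr compM // ff_io2 mul0r subr0.
Qed.

Section Solve.
Variables (T : nat -> A -> Prop) (hT : coef_filt T).
Hypothesis (hl : T 2 l) (hl2 : T 2 (l ^+ 2)).
Notation fil := (fil T).

Lemma fil_2y : fil 1 (y *+ 2).
Proof. by apply: (filMn hT); apply: fil_X. Qed.

Lemma fil_ff : fil 2 crossf.
Proof.
rewrite -[2%N]/(1 + 1)%N; apply: (filM hT); first exact: (fil_X hT).
by apply: (filD hT); [apply: (fil_X hT)|apply: fil_2y].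
Qed.

Lemma fil_ff2 : fil 4 (crossf ^+ 2).
Proof. by have := @filXn _ _ _ hT 2 crossf 2 fil_ff. Qed.

Lemma filZ1 d j a f : T d.+1 a -> fil (j + d)%N f -> fil j (a *: f).
Proof.
move=> ha hf m; rewrite fpsZ; have := hf m.
have [mj|mj] := leqP (mdeg m).+1 (j + d).
  by move: (mj); rewrite -subn_eq0 => /eqP -> /(cf00 hT) ->; rewrite mulr0; apply: (cf0 hT).
rewrite (subSn (mj : (j + d <= mdeg m)%N)) => h.
have -> : ((mdeg m).+1 - j = (d + (mdeg m - (j + d))).+1)%N by lia.
exact: (cfM hT).
Qed.

(** [crossf]^2 has filtration 4, and a factor l or l^2 from [T 2] costs one. *)
Lemma fil_theta_diff j : fil 3 (theta j - X j).
Proof.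
rewrite /theta; case: eqP => [->|_].
  by rewrite addrAC subrr add0r; apply: (@filZ1 1) => //; apply: fil_ff2.
case: eqP => [->|_]; last by rewrite subrr; apply: (fil0 hT).
by rewrite addrAC subrr add0r; apply: (@filZ1 1) => //; apply: fil_ff2.
Qed.

Lemma fil_theta j : fil 1 (theta j).
Proof.
rewrite -(subrK (X j) (theta j)); apply: (filD hT); last exact: (fil_X hT).
by apply: (filW hT _ (fil_theta_diff j)).
Qed.

Lemma fil_vf d f : fil d.+1 f -> fil d.+2 (vf_act crossX f).
Proof.
move=> h; rewrite vf_Xb -[d.+2]/(2 + d)%N; apply: (filM hT); first exact: fil_ff.
exact: (fil_deriv hT).
Qed.

Lemma fil_op d f c : (forall j, T 1 (c j)) -> fil d.+1 f -> fil d.+1 (op crossX c f).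
Proof.
move=> hc hf m; rewrite /op; apply: big_ind => [||j _]; first exact: (cf0 hT).
  by move=> a b; apply: (cfD hT).
apply: (cfMl hT) => //.
have : fil (d + j).+1 (iter j (vf_act crossX) f).
  elim: (nat_of_ord j) => [|k IH]; first by rewrite addn0.
  by rewrite iterS addnS; apply: fil_vf.
by move=> /(@filW _ _ _ hT d.+1) h; apply: h; rewrite ltnS leq_addr.
Qed.

Lemma T_fact j : T 1 (j`!%:R^-1).
Proof.
elim: j => [|j IH]; first by rewrite fact0 invr1; apply: (cf1 hT).
rewrite factS natrM invrM ?(fact_unit hQ) //.
by apply: (cfMl hT) => //; apply: (cfV hT).
Qed.

Lemma fil_Nop d f : fil d.+1 f -> fil d.+3 (Nop f).
Proof.
move=> hf; rewrite /Nop comp_phi.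
have -> : fps_comp (e f) theta - f - crossf * fps_deriv iy f =
  (fps_comp (e f) theta - fps_comp (e f) (fps_X A)) + (e f - f - crossf * fps_deriv iy f).
  by rewrite comp_id; ring.
apply: (filD hT).
  rewrite -addn2; apply: (fil_comp_diff hT).
  - exact: fil_theta.
  - exact: (fil_X hT).
  - exact: fil_theta_diff.
  - by apply: fil_op => // j; apply: T_fact.
rewrite expv_split2; apply: fil_op => [j|]; first exact: T_fact.
by do 2 apply: fil_vf.
Qed.

Lemma fil_divf d f : fil d.+2 f -> fil d (divf f).
Proof.
move=> h; apply: (fil_comp hT) => [j|].
  rewrite /shp; case: eqP => _; last exact: (fil_X hT).
  by apply: (filD hT); [apply: (fil_X hT)|apply: fil_2y].
apply: fil_dv; apply: (fil_comp hT) => [j|]; last exact: fil_dv.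
rewrite /shm; case: eqP => _; last exact: (fil_X hT).
by apply: (filB hT); [apply: (fil_X hT)|apply: fil_2y].
Qed.

(** Balance of filtrations: [Nop] gains two, division by [crossf] loses two, integration gains one.
    The map is therefore a contraction, and its values vanish on y = 0. *)
Definition solPhi g := fps_int iy (divf (crossf ^+ 2 - Nop g)).

Lemma fil_solPhi g : fil 1 g -> fil 1 (solPhi g).
Proof.
move=> h; apply: (fil_int hT); apply: fil_divf; apply: (filB hT).
  by apply: (filW hT _ fil_ff2).
by apply: (filW hT _ (fil_Nop h)).
Qed.

End Solve.

Lemma ordge_Nop d f : ordge d.+1 f -> ordge d.+3 (Nop f).
Proof.
by move=> h; apply/fil_ordT/(fil_Nop (ordT_filt A)) => //; apply/fil_ordT.
Qed.

Lemma ordge_divf d f : ordge d.+2 f -> ordge d (divf f).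
Proof. by move=> h; apply/fil_ordT/(fil_divf (ordT_filt A))/fil_ordT. Qed.

Lemma solPhi_contr g h d : ordge d.+1 (g - h) -> ordge d.+2 (solPhi g - solPhi h).
Proof.
move=> gh; rewrite /solPhi -intB -divfB.
have -> : crossf ^+ 2 - Nop g - (crossf ^+ 2 - Nop h) = - Nop (g - h) by rewrite NopB; ring.
by apply/int_ordge/ordge_divf/ordgeN/ordge_Nop.
Qed.

Lemma kap_kap j : fps_comp (kap j) kap = kap j.
Proof.
rewrite /kap; case h : (_ || _); last by rewrite comp0.
by rewrite compX // /kap h.
Qed.

Lemma ff_kap : fps_comp crossf kap = crossf.
Proof.
by rewrite /crossf compM // compD // compMn // !compX // /kap !eqxx orbT /=.
Qed.

Lemma deriv_kap f : fps_deriv iy (fps_comp f kap) = fps_comp (fps_deriv iy f) kap.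
Proof.
rewrite chain_rule // (bigD1 iy) //= big1 ?addr0 => [|j jy].
  by rewrite /kap eqxx orbT derivX eqxx mulr1.
rewrite /kap (negbTE jy) orbF; case: eqP => _; last by rewrite deriv0 mulr0.
by rewrite derivX eq_sym (negbTE jy) mulr0.
Qed.

Lemma op_kap c f : fps_comp (op crossX c f) kap = op crossX c (fps_comp f kap).
Proof.
have hx := Xb2; apply: ordge_eq => N.
have it j : fps_comp (iter j (vf_act crossX) f) kap = iter j (vf_act crossX) (fps_comp f kap).
  by elim: j => // j IH; rewrite !iterS -IH !vf_Xb compM // ff_kap deriv_kap.
have -> : fps_comp (op crossX c f) kap - op crossX c (fps_comp f kap) =
  fps_comp (op crossX c f - \sum_(j < N) c j *: iter j (vf_act crossX) f) kap
  - (op crossX c (fps_comp f kap) - \sum_(j < N) c j *: iter j (vf_act crossX) (fps_comp f kap)).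
  rewrite compB // comp_sum //.
  have -> : \sum_(j < N) fps_comp (c j *: iter j (vf_act crossX) f) kap =
     \sum_(j < N) c j *: iter j (vf_act crossX) (fps_comp f kap).
    by apply: eq_bigr => j _; rewrite compZ // it.
  ring.
apply: ordgeB; last exact: op_ordge.
by apply: fps_comp_ordge => //; apply: op_ordge.
Qed.

Lemma theta_kap j : fps_comp (theta j) kap = fps_comp (kap j) theta.
Proof.
have hf : fps_comp (crossf ^+ 2) kap = crossf ^+ 2 by rewrite compXn // ff_kap.
rewrite [theta j]/theta [kap j]/kap; case: eqP => [->|/eqP jx].
  by rewrite compD // compZ // hf !compX // /kap /theta !eqxx.
case: eqP => [->|/eqP jy]; last by rewrite compX // comp0 // /kap (negbTE jx) (negbTE jy).
by rewrite compD // compZ // hf !compX // /kap /theta eqxx hyx orbT.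
Qed.

Lemma comp_theta_kap f : fps_comp (fps_comp f theta) kap = fps_comp (fps_comp f kap) theta.
Proof. by rewrite !comp_comp //; apply: comp_eq => j; apply: theta_kap. Qed.

Lemma comp_phi_kap f : fps_comp (fps_comp f pert_exp) kap = fps_comp (fps_comp f kap) pert_exp.
Proof. by rewrite !comp_phi comp_theta_kap /expv op_kap. Qed.

Lemma res_kap j : fps_comp (res A iy j) kap = fps_comp (kap j) (res A iy).
Proof.
rewrite /res /kap; case: eqP => [->|/eqP jy].
  by rewrite orbT comp0 // compX // /res eqxx.
rewrite orbF compX // /kap (negbTE jy) orbF; case: eqP => [->|_]; last by rewrite comp0.
by rewrite compX // /res (negbTE hxy).
Qed.

(** The fixed point of [solPhi] solves the equation. Composing it with [kap], which commutes with
    [pert_exp], makes it a series in x and y alone. *)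
Lemma solve_cohom (T : nat -> A -> Prop) : coef_filt T -> T 2 l -> T 2 (l ^+ 2) ->
  exists G, [/\ fil T 1 G, fps_comp G pert_exp - G = crossf ^+ 2,
    fps_comp G (res A iy) = 0 & fps_comp G kap = G].
Proof.
move=> hT hl hl2.
pose Pr (u : unit -> fps n A) := forall q, fil T 1 (u q).
have [||u v d hu hv uv q||u hu eu] :=
  @krull_fix n A unit Pr (fun u _ => solPhi (u tt)) (fun _ => 0).
- by move=> q; apply: (fil0 hT).
- by move=> u hu q; apply: fil_solPhi.
(* [solPhi_contr] starts at order 1; order 0 reduces to it because members of [Pr] have no constant
   term. *)
- case: d uv => [|d] uv; last exact: solPhi_contr.
  apply: ordgeW (leqnSn 1) _; apply: solPhi_contr.
  by apply: ordgeB; apply/ordge1E; apply: (fil_vanish hT); [exact: hu|exact: hv].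
- by apply: (@tclosed_all n A unit (fun _ => fil T 1)) => q; apply: fil_closed.
pose G := u tt.
have eG : solPhi G = G by rewrite {2}/G -eu.
have Gr : fps_comp G (res A iy) = 0 by rewrite -eG /solPhi int_res.
have Gs : fps_comp G pert_exp - G = crossf ^+ 2.
  have d1 : crossf ^+ 2 - Nop G = crossf * divf (crossf ^+ 2 - Nop G).
    by rewrite divfB mulrBr -Nop_dvd [in RHS]expr2 divf_ffM -expr2.
  have : crossf * fps_deriv iy G = crossf ^+ 2 - Nop G.
    by rewrite -{1}eG /solPhi deriv_int.
  rewrite /Nop => h; apply/eqP; rewrite -subr_eq0; apply/eqP.
  have -> : fps_comp G pert_exp - G - crossf ^+ 2 =
    crossf * fps_deriv iy G - (crossf ^+ 2 - (fps_comp G pert_exp - G - crossf * fps_deriv iy G)) by ring.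
  by rewrite -h subrr.
have vph := phi_vanish.
exists (fps_comp G kap); split.
- apply: (fil_comp hT); last exact: hu.
  by move=> j; rewrite /kap; case: (_ || _); [apply: (fil_X hT)|apply: (fil0 hT)].
- by rewrite -comp_phi_kap -compB // Gs compXn // ff_kap.
- have -> : fps_comp (fps_comp G kap) (res A iy) = fps_comp (fps_comp G (res A iy)) kap.
    by rewrite !comp_comp //; apply: comp_eq => j; rewrite res_kap.
  by rewrite Gr comp0.
by rewrite comp_comp //; apply: comp_eq => j; apply: kap_kap.
Qed.

End Family.

(** * Integrals along the leaves *)

Section Moments.
Variables (n : nat) (A : comUnitRingType).
Hypothesis hQ : forall j, (j.+1%:R : A) \is a GRing.unit.
Variables (ix iy : 'I_n) (hxy : ix != iy).
Implicit Types (f g h : fps n A) (m k : 'X_{1..n}) (a b : A) (i : 'I_n).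

Notation X i := (fps_X A i : fps n A).
Notation x := (X ix).
Notation y := (X iy).
Notation ff := (crossf A ix iy).
Notation Xb := (crossX A ix iy).
Notation D := (vf_act Xb).
Notation io2 := (branch2 A ix iy).

Let hyx : (iy == ix) = false. Proof. by rewrite eq_sym (negbTE hxy). Qed.
Let v2 : vanish_at0 io2. Proof. exact: ordge_vanish (io21 A ix iy). Qed.
Let v1 : vanish_at0 (res A iy). Proof. exact: res_vanish. Qed.

(* leafint g is the integral of g along the leaf x = const, from the curve y = 0 to
   the curve x + 2y = 0, as a series in the y-coordinate of the endpoint. *)
Definition leafint f : fps n A := fps_comp (fps_int iy f) io2.

Lemma leafintB f g : leafint (f - g) = leafint f - leafint g.
Proof. by rewrite /leafint intB compB. Qed.
Lemma leafint0 : leafint 0 = 0.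
Proof. by have := leafintB 0 0; rewrite !subrr. Qed.
Lemma leafintN f : leafint (- f) = - leafint f.
Proof. by rewrite -[- f]sub0r leafintB leafint0 sub0r. Qed.
Lemma leafintD f g : leafint (f + g) = leafint f + leafint g.
Proof. by rewrite -[g in LHS]opprK leafintB leafintN opprK. Qed.
Lemma leafintZ a f : leafint (a *: f) = a *: leafint f.
Proof. by rewrite /leafint intZ compZ. Qed.
Lemma leafintMn f (j : nat) : leafint (f *+ j) = leafint f *+ j.
Proof. by rewrite -scaler_nat leafintZ scaler_nat. Qed.
Lemma leafint_sum (I : Type) (r : seq I) (P : pred I) (F : I -> fps n A) :
  leafint (\sum_(i <- r | P i) F i) = \sum_(i <- r | P i) leafint (F i).
Proof. exact: (big_morph _ leafintD leafint0). Qed.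
Lemma leafint_ordge d f : ordge d f -> ordge d.+1 (leafint f).
Proof. by move=> h; apply: fps_comp_ordge => //; apply: int_ordge. Qed.

Lemma leafint_deriv f : fps_comp f (res A iy) = 0 -> leafint (fps_deriv iy f) = fps_comp f io2.
Proof. by move=> h; rewrite /leafint int_deriv. Qed.

(** x is constant along a leaf and equals - 2 y at the endpoint on the second line. *)
Lemma leafint_mulx f : leafint (x * f) = - (y *+ 2) * leafint f.
Proof.
rewrite /leafint; have -> : fps_int iy (x * f) = x * fps_int iy f.
  have e : fps_deriv iy (x * fps_int iy f) = x * f.
    by rewrite derivM derivX eq_sym (negbTE hxy) mul0r add0r deriv_int.
  by rewrite -e int_deriv // compM // int_res mulr0.
by rewrite compM // compX // /branch2 eqxx.
Qed.

Lemma S_mulxn (j : nat) f : leafint (x ^+ j * f) = (- (y *+ 2)) ^+ j * leafint f.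
Proof.
elim: j => [|j IH]; first by rewrite !expr0 !mul1r.
by rewrite !exprS -mulrA leafint_mulx IH mulrA.
Qed.

Lemma S1 : leafint 1 = y.
Proof.
have <- : fps_deriv iy y = 1 by rewrite derivX eqxx.
rewrite leafint_deriv; first by rewrite compX // /branch2 hyx.
by rewrite compX // /res eqxx.
Qed.

Notation gk := (fun j : nat => iter j D y).

Lemma Dx : D x = 0.
Proof. by rewrite vf_Xb derivX eq_sym (negbTE hxy) mulr0. Qed.
Lemma Dxn (j : nat) : D (x ^+ j) = 0.
Proof.
elim: j => [|j IH]; first by have := vfC Xb 1; rewrite rmorph1.
by rewrite exprS vfM Dx IH mul0r mulr0 addr0.
Qed.
Lemma DMn f (j : nat) : D (f *+ j) = D f *+ j.
Proof. by rewrite -scaler_nat vfZ scaler_nat. Qed.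
Lemma Dy : D y = ff.
Proof. by rewrite vf_Xb derivX eqxx mulr1. Qed.

Lemma gk_res j : fps_comp (gk j) (res A iy) = 0.
Proof.
case: j => [|j] /=; first by rewrite compX // /res eqxx.
by rewrite vf_Xb compM // ff_res mul0r.
Qed.

(** Up to the factor j!, the coefficient of z^j in exp(z D)(y) exp(z x). *)
Definition Qk (j : nat) : fps n A :=
  \sum_(i < j.+1) (gk i * x ^+ (j - i)) *+ 'C(j, i).

Lemma Qk_S j : Qk j.+1 = x * Qk j + D (Qk j).
Proof.
rewrite /Qk -(pascal_sum (fun p q => gk p * x ^+ q)) addrC; congr (_ + _).
  rewrite [RHS]mulr_sumr; apply: eq_bigr => i _.
  have ij : (i <= j)%N by rewrite -ltnS.
  by rewrite (subSn ij) exprS mulrnAr mulrCA.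
rewrite vf_sum; apply: eq_bigr => i _.
by rewrite -!scaler_nat vfZ vfM Dxn mulr0 addr0.
Qed.

(* With s = - 2 y / x, X becomes x s (1 - s) d/ds; this identity is the
   coefficient of z^j in the equation e^(zX)(s) (1 - s + s e^z) = s e^z,
   where X = crossX. *)
Lemma gk_Qk j : (x + y *+ 2) * gk j - y *+ 2 * Qk j = x ^+ j.+1 * y.
Proof.
elim: j => [|j IH].
  by rewrite /Qk big_ord_recl big_ord0 /= subnn expr0 mulr1n addr0 expr1; ring.
have := congr1 D IH; rewrite vfB !vfM Dxn mul0r add0r vfD Dx add0r Dy.
have -> : D (y *+ 2) = ff *+ 2 by rewrite DMn Dy.
rewrite Qk_S /= => h.
have -> : (x + y *+ 2) * D (gk j) - y *+ 2 * (x * Qk j + D (Qk j)) =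
  (ff *+ 2 * gk j + (x + y *+ 2) * D (gk j) - (ff *+ 2 * Qk j + y *+ 2 * D (Qk j)))
  - y *+ 2 * ((x + y *+ 2) * gk j - y *+ 2 * Qk j) by rewrite /crossf; ring.
by rewrite h IH !exprS /crossf; ring.
Qed.

(** In [gk_Qk] at rank j + 1 the top term of [Qk] turns the coefficient x + 2 y of D^(j+1) y into x;
    the common factor y is then cancelled, using D = y (x + 2 y) d/dy. *)
Lemma gk_rec j : x * ((x + y *+ 2) * fps_deriv iy (gk j))
   - (\sum_(i < j.+1) (gk i * x ^+ (j.+1 - i)) *+ 'C(j.+1, i)) *+ 2 = x ^+ j.+2.
Proof.
apply: (@mulX_inj _ _ iy); have := gk_Qk j.+1.
rewrite /Qk big_ord_recr /= subnn expr0 mulr1 binn mulr1n vf_Xb => h.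
by rewrite [RHS]mulrC -h /crossf; ring.
Qed.

(** Integration by parts of (x + 2 y) d/dy(D^j y). Both boundary terms vanish: D^j y is zero on the
    first line and x + 2 y on the second. *)
Lemma leafint_gk_rec j : (y * leafint (gk j)) *+ 4
   - (\sum_(i < j.+1) ((- (y *+ 2)) ^+ (j.+1 - i) * leafint (gk i)) *+ 'C(j.+1, i)) *+ 2 =
   (- (y *+ 2)) ^+ j.+2 * y.
Proof.
have := congr1 leafint (gk_rec j); rewrite leafintB leafintMn leafint_sum.
have -> : x ^+ j.+2 = x ^+ j.+2 * 1 by rewrite mulr1.
rewrite S_mulxn S1 => <-; congr (_ - _ *+ 2); last first.
  by apply: eq_bigr => i _; rewrite leafintMn -S_mulxn mulrC.
rewrite leafint_mulx.
have -> : (x + y *+ 2) * fps_deriv iy (gk j) = fps_deriv iy ((x + y *+ 2) * gk j) - gk j *+ 2.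
  have d2 : fps_deriv iy (x + y *+ 2) = 2%:R.
    by rewrite mulr2n !derivD !derivX eqxx hyx /= add0r.
  by rewrite derivM d2; ring.
rewrite leafintB leafint_deriv; last by rewrite compM // gk_res mulr0.
rewrite compM // compD // compMn // !compX // /branch2 eqxx hyx addNr mul0r leafintMn.
ring.
Qed.

(** The recursion below forces [is_ j] to be the Bernoulli number B_(j+1), with the convention B_1 =
    1/2. *)
Variable is_ : nat -> A.
Hypothesis his : forall j, is_ j + \sum_(i < j.+1) is_ i *+ 'C(j.+1, i) = 1.

(** By homogeneity the integral is a multiple of y^(j+2); [leafint_gk_rec] becomes the recursion of
    [is_] for its normalized coefficient. *)
Lemma leafint_gk j : leafint (gk j) = is_ j *: ((- (y *+ 2)) ^+ j * y ^+ 2).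
Proof.
elim/ltn_ind: j => j IH; have := leafint_gk_rec j.
rewrite big_ord_recr /= subSnn expr1 binSn.
have -> : \sum_(i < j) ((- (y *+ 2)) ^+ (j.+1 - i) * leafint (gk i)) *+ 'C(j.+1, i) =
  (\sum_(i < j) is_ i *+ 'C(j.+1, i)) *: ((- (y *+ 2)) ^+ j.+1 * y ^+ 2).
  rewrite scaler_suml; apply: eq_bigr => i _; rewrite IH //.
  have e1 : (- (y *+ 2)) ^+ j.+1 = (- (y *+ 2)) ^+ (j.+1 - i) * (- (y *+ 2)) ^+ i :> fps n A.
    by rewrite -exprD subnK // ltnW // ltnS ltnW.
  by rewrite e1 -scalerMnl !scaleE; congr (_ *+ _); ring.
have := his j; rewrite big_ord_recr /= binSn; set B := \sum_(i < j) _ => hB.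
have eB : B = 1 - is_ j - is_ j *+ j.+1 by rewrite -hB; ring.
rewrite eB => h; apply: (@mulX_inj _ _ iy).
have u4 : (4%:R * j.+2%:R : A) \is a GRing.unit by rewrite unitrM !hQ.
have h2 : (4%:R * j.+2%:R : A) *: (y * leafint (gk j)) =
  (4%:R * j.+2%:R : A) *: (y * (is_ j *: ((- (y *+ 2)) ^+ j * y ^+ 2))).
  have e4 f : (4%:R * j.+2%:R : A) *: f = f *+ 4 + f *+ 4 *+ j.+1.
    by rewrite -natrM scaler_nat mulnS mulrnDr mulrnA.
  rewrite !e4; apply/eqP; rewrite -subr_eq0; apply/eqP.
  transitivity ((y * leafint (gk j)) *+ 4 - ((1 - is_ j - is_ j *+ j.+1) *:
    ((- (y *+ 2)) ^+ j.+1 * y ^+ 2) + (- (y *+ 2) * leafint (gk j)) *+ j.+1) *+ 2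
    - (- (y *+ 2)) ^+ j.+2 * y); last by rewrite h subrr.
  by rewrite !exprS !scalerBl scale1r -scalerMnl !scaleE; ring.
have := congr1 (fun f => (4%:R * j.+2%:R : A)^-1 *: f) h2.
by rewrite !scalerA mulVr // !scale1r.
Qed.

(** Places [crossf]^2 in the span of the iterates D^j y over series in x, so that [leafint_gk]
    computes its moments. The factor 12 persists up to the final estimate. *)
Lemma ff2_gk : ff ^+ 2 *+ 12 = gk 3 - x ^+ 2 * gk 1.
Proof.
rewrite /= Dy; have e1 : D ff = ff * (x + y *+ 4).
  by rewrite {1}/crossf vfM vfD Dx DMn Dy /crossf; ring.
have e2 : D (x + y *+ 4) = ff *+ 4 by rewrite vfD Dx DMn Dy add0r.
rewrite e1 vfM e1 e2 /crossf; ring.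
Qed.

Lemma leafint_iter_ff2 j : leafint (iter j D (ff ^+ 2)) *+ 12 =
  (is_ j.+3 - is_ j.+1) *: ((- (y *+ 2)) ^+ j.+3 * y ^+ 2).
Proof.
have hx2 f : iter j D (x ^+ 2 * f) = x ^+ 2 * iter j D f.
  by elim: j => // j IH; rewrite !iterS IH vfM Dxn mul0r add0r.
have -> : leafint (iter j D (ff ^+ 2)) *+ 12 = leafint (iter j D (ff ^+ 2 *+ 12)).
  by rewrite -leafintMn -!scaler_nat iterZ.
rewrite ff2_gk iterB hx2 -!iterD !addn3 !addn1 leafintB S_mulxn.
have e3 := leafint_gk j.+3; have e1 := leafint_gk j.+1; rewrite e3 e1.
by rewrite scalerBl !scaleE !exprS; ring.
Qed.

Lemma yn_coef (j l : nat) : (y ^+ j : fps n A) (U_(iy) *+ l)%MM = (j == l)%:R.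
Proof.
have -> : y ^+ j = pf ('X_iy ^+ j) by rewrite rmorphXn /= pfX.
rewrite /pf mcoeffXn; congr (_%:R : A); congr nat_of_bool; apply/eqP/eqP => [/mnmP /(_ iy)|->//].
by rewrite !mulmnE mnm1E eqxx !mul1n.
Qed.

(** The coefficients of z / (e^z - 1): [gam j] is B_j / j!, now with B_1 = - 1/2. *)
Variable gam : nat -> A.
Hypothesis hgam : conv gam (fun j => j.+1`!%:R^-1) =1 (fun j => (j == 0%N)%:R).

(** * First variation in the parameter *)

Section Variation.
(** These stand for the coefficients of l^0 and l^1 in G; [hG0] and [hK1] are the cohomological
    equation modulo l^2. *)
Variables G0 K1 : fps n A.
Hypothesis hG0 : expv Xb G0 - G0 = ff ^+ 2.
Hypothesis hK1 : expv Xb K1 + ff ^+ 2 * fps_deriv iy (expv Xb G0) = K1.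
Hypothesis K1r : fps_comp K1 (res A iy) = 0.

Notation u := (fun j : nat => j.+1`!%:R^-1 : A).

Let hx := Xb2 A ix iy.

Lemma expv_op f : expv Xb f - f = D (op Xb u f).
Proof. by rewrite expv_split vf_Xb addrC addKr. Qed.

Lemma op_u f : exists q, op Xb u f = f + ff * q.
Proof.
rewrite op_S // (_ : 1`! = 1%N) // invr1 scale1r op_D // vf_Xb; eexists; reflexivity.
Qed.

(** With u(z) = (e^z - 1) / z one has exp(D) - 1 = D u(D), so the first equation gives D G0 = gam(D)
    applied to [crossf]^2. In the second a factor [crossf] cancels, leaving d/dy(u(D) K1) = - D G0 -
    D([crossf]^2). Integrating along the leaves gives K1, because u(D) K1 and K1 agree on both
    lines. *)
Lemma K1_leafint : fps_comp K1 io2 = - leafint (op Xb gam (ff ^+ 2)) - leafint (D (ff ^+ 2)).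
Proof.
have eG : D G0 = op Xb gam (ff ^+ 2).
  rewrite -hG0 expv_op -op_D // op_op // (op_ext _ _ hgam) op_delta //.
have eK : fps_deriv iy (op Xb u K1) = - (D G0 + D (ff ^+ 2)).
  apply: (ff_inj hxy); rewrite -[LHS]vf_Xb -expv_op.
  have -> : expv Xb K1 - K1 = - (ff ^+ 2 * fps_deriv iy (expv Xb G0)).
    by move: (expv Xb K1) hK1 => E <-; ring.
  have -> : expv Xb G0 = G0 + ff ^+ 2 by rewrite -hG0; ring.
  by rewrite derivD !vf_Xb; ring.
have [q eq] := op_u K1.
have <- : fps_comp (op Xb u K1) io2 = fps_comp K1 io2.
  by rewrite eq compD // compM // ff_io2 // mul0r addr0.
rewrite -leafint_deriv; first by rewrite eK leafintN leafintD eG opprD.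
by rewrite eq compD // K1r compM // ff_res mul0r addr0.
Qed.

(** The integral of D^j ([crossf]^2) is homogeneous of degree j + 5, so a single j contributes. For
    N = 1 the second term of [K1_leafint] would interfere. *)
Lemma K1_coef (N : nat) : N != 1%N ->
  (fps_comp K1 io2) (U_(iy) *+ (N + 5))%MM *+ 12 =
  - (gam N * (is_ N.+3 - is_ N.+1) * (- 2%:R) ^+ N.+3).
Proof.
move=> N1; pose M := (U_(iy) *+ (N + 5))%MM.
have dM : mdeg M = (N + 5)%N by rewrite /M mdegMn mdeg1 mul1n.
have cj j : (leafint (iter j D (ff ^+ 2)) *+ 12 : fps n A) M =
   ((j == N)%:R * ((is_ N.+3 - is_ N.+1) * (- 2%:R) ^+ N.+3) : A).
  rewrite leafint_iter_ff2 fpsZ.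
  have -> : (- (y *+ 2)) ^+ j.+3 * y ^+ 2 = ((- 2%:R) ^+ j.+3 : A) *: y ^+ (j + 5).
    have -> : - (y *+ 2) = cst (- 2%:R) * y by rewrite -scaleE scaleNr scaler_nat.
    rewrite exprMn -rmorphXn /= -mulrA -exprD scaleE; congr (_ * _ ^+ _); lia.
  rewrite fpsZ yn_coef eqn_add2r; case: eqP => [->|_]; last by rewrite !(mulr0, mul0r).
  by rewrite mulr1 mul1r.
rewrite K1_leafint -fpsMn.
have -> : (- leafint (op Xb gam (ff ^+ 2)) - leafint (D (ff ^+ 2))) *+ 12 =
  - (leafint (op Xb gam (ff ^+ 2)) *+ 12) - leafint (iter 1 D (ff ^+ 2)) *+ 12 by rewrite /=; ring.
rewrite fpsB fpsN cj eq_sym (negbTE N1) mul0r subr0 -mulrA; congr (- _).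
pose R := op Xb gam (ff ^+ 2) - \sum_(j < N.+1 + 5) gam j *: iter j D (ff ^+ 2).
have hR : ordge (N.+1 + 5)%N R by apply: op_ordge.
have -> : op Xb gam (ff ^+ 2) = R + \sum_(j < N.+1 + 5) gam j *: iter j D (ff ^+ 2).
  by rewrite subrK.
rewrite leafintD leafint_sum mulrnDl fpsD fpsMn (leafint_ordge hR) ?mul0rn ?add0r; last by rewrite dM; lia.
have hN : (N < N.+1 + 5)%N by lia.
rewrite -sumrMnl fps_sum (bigD1 (Ordinal hN)) //=.
rewrite leafintZ scalerMnr fpsZ cj eqxx mul1r big1 ?addr0 // => j jN.
rewrite leafintZ scalerMnr fpsZ cj; case: eqP => [e|_]; last by rewrite mul0r mulr0.
by move: jN; rewrite -val_eqE /= e eqxx.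
Qed.

End Variation.
End Moments.

(** * Bernoulli numbers *)

Section Bernoulli.
Variable F : realFieldType.
Notation ser := (fps 1 F).
Implicit Types (f g : ser).

Definition cf f (j : nat) : F := f (U_(ord0) *+ j)%MM.

Notation z := (fps_X F ord0 : ser).

Lemma mnm_1var (m : 'X_{1..1}) : (U_(ord0) *+ mdeg m)%MM = m.
Proof.
apply/mnmP => i; rewrite mulmnE mnm1E (ord1 i) eqxx mul1n mdegE big_ord_recl big_ord0.
by rewrite addn0.
Qed.

Lemma mdeg_Un (j : nat) : mdeg (U_(ord0 : 'I_1) *+ j)%MM = j.
Proof. by rewrite mdegMn mdeg1 mul1n. Qed.

Lemma cf_eq f g : cf f =1 cf g -> f = g.
Proof. by move=> h; apply/funext => m; rewrite -(mnm_1var m); apply: h. Qed.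

Definition mk (c : nat -> F) : ser := fun m => c (mdeg m).

Lemma cf_mk c j : cf (mk c) j = c j.
Proof. by rewrite /cf /mk mdeg_Un. Qed.

Lemma cfDs f g j : cf (f + g) j = cf f j + cf g j. Proof. by []. Qed.
Lemma cfBs f g j : cf (f - g) j = cf f j - cf g j. Proof. by []. Qed.

Lemma cf_zX j l : cf (z ^+ j) l = (j == l)%:R.
Proof.
rewrite /cf; have -> : z ^+ j = pf ('X_ord0 ^+ j) by rewrite rmorphXn /= pfX.
rewrite /pf mcoeffXn; congr (_%:R : F); congr nat_of_bool; apply/eqP/eqP => [/(congr1 mdeg)|->//].
by rewrite !mdeg_Un.
Qed.

Lemma cf_1 j : cf 1 j = (j == 0%N)%:R.
Proof. by have := cf_zX 0 j; rewrite expr0 eq_sym. Qed.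

Lemma ser_trunc f N : ordge N (f - \sum_(i < N) cf f i *: z ^+ i).
Proof.
move=> m mN; rewrite fpsB fps_sum (bigD1 (Ordinal mN)) //= fpsZ.
have e i : (z ^+ i) m = (i == mdeg m)%:R by have := cf_zX i (mdeg m); rewrite /cf mnm_1var.
rewrite e eqxx mulr1 big1 => [|i im]; last first.
  rewrite fpsZ e; case: eqP => [h|_]; last by rewrite mulr0.
  by move: im; rewrite -val_eqE /= h eqxx.
by rewrite addr0 /cf mnm_1var subrr.
Qed.

Lemma cfMs f g j : cf (f * g) j = \sum_(i < j.+1) cf f i * cf g (j - i)%N.
Proof.
pose N := j.+1; pose P i k : ser := (cf f i * cf g k) *: z ^+ (i + k).
have hz i : ordge i (z ^+ i).
  by have := @ordgeX _ _ 1 z i (@ordge_X _ _ _); rewrite mul1n.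
have hP i k : ordge (i + k)%N (P i k) by rewrite /P scaleE; apply: ordgeMr.
pose pf_ := \sum_(i < N) cf f i *: z ^+ i; pose pg := \sum_(i < N) cf g i *: z ^+ i.
have e1 : pf_ * pg = \sum_(i < N) \sum_(k < N) P i k.
  rewrite mulr_suml; apply: eq_bigr => i _; rewrite mulr_sumr; apply: eq_bigr => k _.
  by rewrite /P exprD !scaleE rmorphM /=; ring.
have h : ordge N (f * g - \sum_(k < N) \sum_(i < k.+1) P i (k - i)%N).
  have -> : f * g - \sum_(k < N) \sum_(i < k.+1) P i (k - i)%N =
    (f - pf_) * g + pf_ * (g - pg) +
    (\sum_(i < N) \sum_(k < N) P i k - \sum_(k < N) \sum_(i < k.+1) P i (k - i)%N).
    by rewrite -e1; ring.
  apply: ordgeD; last exact: square_triangle.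
  by apply: ordgeD; [apply: ordgeMl|apply: ordgeMr]; apply: ser_trunc.
have := h (U_(ord0) *+ j)%MM; rewrite mdeg_Un => /(_ (ltnSn j)); rewrite fpsB => /eqP.
rewrite subr_eq0 => /eqP e2; rewrite [LHS]/cf e2 fps_sum (bigD1 ord_max) //= [X in _ + X]big1 ?addr0.
  rewrite fps_sum; apply: eq_bigr => i _; have ij : (i <= j)%N by rewrite -ltnS.
  rewrite /P fpsZ (subnKC ij).
  by rewrite -/(cf (z ^+ j) j) cf_zX eqxx mulr1.
move=> k kj; rewrite fps_sum big1 // => i _; have ik : (i <= k)%N by rewrite -ltnS.
rewrite /P fpsZ (subnKC ik).
rewrite -/(cf (z ^+ k) j) cf_zX; move: kj; rewrite -val_eqE /= => /negbTE ->.
by rewrite mulr0.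
Qed.

Lemma cf_zM f j : cf (z * f) j = if j is k.+1 then cf f k else 0.
Proof.
rewrite /cf fps_mulXE mulmnE mnm1E eqxx mul1n; case: j => [|k] //=.
by congr (f _); rewrite mulmS addmC addmK.
Qed.

Lemma cf_deriv f j : cf (fps_deriv ord0 f) j = cf f j.+1 *+ j.+1.
Proof.
rewrite /cf /fps_deriv mulmnE mnm1E eqxx mul1n; congr (f _ *+ _).
by rewrite mulmS addmC.
Qed.

Lemma fact_1 : 1`! = 1%N. Proof. by []. Qed.

Lemma bernoulli_series : exists G g w : ser,
  [/\ conv (cf G) (fun j => j.+1`!%:R^-1) =1 (fun j => (j == 0%N)%:R),
      g = G + 2%:R^-1 *: z,
      z * fps_deriv ord0 g = g - g * g + 4%:R^-1 *: (z * z),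
      forall j, cf w j = cf G j.+1 + (j == 0%N)%:R
    & w + (1 + fps_deriv ord0 G) * mk (fun j => j.+1`!%:R^-1) = mk (fun j => j.+1`!%:R^-1)].
Proof.
pose U := mk (fun j => j.+1`!%:R^-1).
have U0 : U 0%MM = 1 by rewrite /U /mk mdeg0 fact_1 invr1.
have [G UG] : exists G, U * G = 1 by apply: fps_inv; rewrite U0 unitr1.
(* Here z U = e^z - 1, which is determined by its derivative being 1 + z U. *)
have eU : U + z * fps_deriv ord0 U = 1 + z * U.
  apply: cf_eq => j; rewrite !cfDs !cf_zM cf_1; case: j => [|j].
    by rewrite addr0 addr0 cf_mk fact_1 invr1.
  rewrite cf_deriv !cf_mk add0r -mulrS [(j.+2)`!]factS natrM invfM.
  by rewrite -mulrnAl -[_^-1 *+ _]mulr_natr mulVf ?mul1r ?pnatr_eq0.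
have dG : fps_deriv ord0 U * G + U * fps_deriv ord0 G = 0.
  by rewrite -derivM UG deriv1.
have zG : z * fps_deriv ord0 G = G - G * G - z * G.
  have -> : z * fps_deriv ord0 G = - ((U + z * fps_deriv ord0 U - U) * G * G)
     + z * G * (fps_deriv ord0 U * G + U * fps_deriv ord0 G)
     + z * fps_deriv ord0 G * (1 - U * G) by ring.
  rewrite dG eU UG.
  have -> : - ((1 + z * U - U) * G * G) + z * G * 0 + z * fps_deriv ord0 G * (1 - 1)
    = - G * G - z * G * (U * G) + G * (U * G) by ring.
  rewrite UG; ring.
have G0 : cf G 0 = 1.
  have := congr1 (fun f => cf f 0) UG; rewrite cfMs big_ord_recl big_ord0 addr0 subnn.
  by rewrite cf_mk fact_1 invr1 mul1r cf_1.
exists G, (G + 2%:R^-1 *: z), (mk (fun j => cf G j.+1 + (j == 0%N)%:R)); split=> //.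
- move=> j; have := congr1 (fun f => cf f j) UG; rewrite mulrC cfMs cf_1 => <-.
  by apply: eq_bigr => i _; rewrite cf_mk.
- have h2 : cst 2%:R^-1 * cst 2%:R^-1 = cst 4%:R^-1 :> ser.
    by rewrite -rmorphM; congr cst; rewrite -invfM -natrM.
  have h1 : cst 2%:R^-1 *+ 2 = 1 :> ser.
    by rewrite -rmorphMn /= -mulr_natr mulVf ?pnatr_eq0 // rmorph1.
  rewrite derivD !scaleE derivM derivC derivX eqxx mul0r add0r mulr1 mulrDr zG -h2.
  set a := cst 2%:R^-1 in h1 *.
  have -> : G - G * G - z * G + z * a = G - G * G - z * G * 1 + z * a by ring.
  by rewrite -h1; ring.
- by move=> j; rewrite cf_mk.
set w := mk _; apply: (@mulX_inj _ _ ord0); rewrite mulrDr.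
have -> : z * w = z + G - 1.
  apply: cf_eq => -[|j]; rewrite cfBs cfDs -[in cf z _](expr1 z) !cf_zX cf_zM cf_1.
    by rewrite G0 add0r subrr.
  by rewrite cf_mk eqSS subr0 addrC [0%N == j]eq_sym.
have -> : z + G - 1 + z * ((1 + fps_deriv ord0 G) * U) =
  z + G - 1 + z * U + (z * fps_deriv ord0 G) * U by ring.
rewrite zG.
have -> : z + G - 1 + z * U + (G - G * G - z * G) * U =
   z + G - 1 + z * U + (1 - G - z) * (U * G) by ring.
by rewrite UG -/U; ring.
Qed.

(** Both sequences are read off the series G, [is_ j] as j! times a coefficient of 1 + G'. Upper
    bounds would not do: the point is that no cancellation makes the products small. *)
Lemma bernoulli_bound : exists gam is_ : nat -> F,
  [/\ conv gam (fun j => j.+1`!%:R^-1) =1 (fun j => (j == 0%N)%:R),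
      forall j, is_ j + \sum_(i < j.+1) is_ i *+ 'C(j.+1, i) = 1
    & forall m, (0 < m)%N ->
       ((2 * m)`!%:R / 60%:R ^+ (2 * m + 1) <= `|gam (2 * m)%N * (is_ (2 * m).+3 - is_ (2 * m).+1)|)].
Proof.
have [G [g [w [hG eg hg hw hw2]]]] := bernoulli_series.
have fne j : (j`!%:R : F) != 0 by rewrite pnatr_eq0 -lt0n fact_gt0.
pose v := 1 + fps_deriv ord0 G; pose is_ j := j`!%:R * cf v j.
have ev j : cf v j = cf G j.+1 *+ j.+1 + (j == 0%N)%:R.
  by rewrite /v cfDs cf_1 cf_deriv addrC.
have eg' j : cf g j = cf G j + 2%:R^-1 * (j == 1%N)%:R.
  by rewrite eg cfDs; congr (_ + _ * _); have := cf_zX 1 j; rewrite expr1 eq_sym.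
exists (cf G), is_; split=> // [j|].
  have := congr1 (fun f => cf f j) hw2; rewrite cfDs hw -/v cfMs cf_mk => h.
  have -> : 1 = (j.+1)`!%:R * (j.+1)`!%:R^-1 :> F by rewrite divff.
  rewrite -h mulrDr; congr (_ + _).
    rewrite /is_ ev; case: j {h} => [|j]; first by rewrite mulr1n.
    by rewrite /= !addr0 [in RHS]factS natrM -[_ *+ _]mulr_natr; ring.
  rewrite mulr_sumr; apply: eq_bigr => i _; rewrite cf_mk /is_.
  have ij : (i <= j.+1)%N by rewrite ltnW.
  have ij' : (i <= j)%N by rewrite -ltnS.
  rewrite -(bin_fact ij) (subSn ij') natrM natrM -[_ *+ _]mulr_natr.
  transitivity (i`!%:R * cf v i * 'C(j.+1, i)%:R * ((j - i).+1`!%:R / (j - i).+1`!%:R)).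
    by rewrite divff // mulr1.
  ring.
have rec k : cf g k *+ k = cf g k - \sum_(i < k.+1) cf g i * cf g (k - i)%N + 4%:R^-1 * (k == 2%N)%:R.
  have := congr1 (fun f => cf f k) hg; rewrite cfDs cfBs => h; rewrite -cfMs.
  have -> : 4%:R^-1 * (k == 2%N)%:R = cf (4%:R^-1 *: (z * z)) k.
    by rewrite -expr2; congr (_ * _); have := cf_zX 2 k; rewrite eq_sym.
  rewrite -h; case: (k) => [|j]; rewrite cf_zM ?mulr0n //.
  by rewrite cf_deriv.
have g0 : cf g 0 = 1.
  rewrite eg' mulr0 addr0; have := hG 0%N; rewrite /conv big_ord_recl big_ord0 addr0 subnn.
  by rewrite fact_1 invr1 mulr1.
have rec2 k : (0 < k)%N -> cf g k *+ k.+1 = - (\sum_(1 <= i < k) cf g i * cf g (k - i)%N) + 4%:R^-1 * (k == 2%N)%:R.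
  case: k => // k _; have := rec k.+1.
  rewrite -(big_mkord xpredT (fun i => cf g i * cf g (k.+1 - i)%N)) big_nat_recl // subn0 g0 mul1r.
  rewrite big_nat_recr //= subnn g0 mulr1 big_add1 /= => h.
  by rewrite mulrSr h; ring.
have odd0 k : odd k -> cf g k = 0.
  elim/ltn_ind: k => k IH ok; have k0 : (0 < k)%N by case: k ok {IH}.
  have := rec2 k k0; rewrite big_nat big1 => [|i /andP[i1 ik]]; last first.
    have [oi|ei] := boolP (odd i); first by rewrite IH // mul0r.
    by rewrite (IH (k - i)%N) ?mulr0 ?oddB ?(negbTE ei) ?ok ?(ltnW ik) //; lia.
  case: eqP => [e|_]; first by move: ok; rewrite e.
  rewrite oppr0 mulr0 addr0 -mulr_natr => /eqP; rewrite mulf_eq0 pnatr_eq0 orbF.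
  by move/eqP.
(* |B_(2m)| / (2m)!: with the alternating sign removed, the Riccati recursion has only positive
   terms. *)
pose c m := (-1) ^+ m.-1 * cf g (2 * m)%N.
have sgn2 m : (-1) ^+ m * (-1) ^+ m = 1 :> F by rewrite -expr2 sqrr_sign.
have crec m : (1 < m)%N -> c m *+ (2 * m).+1 = \sum_(1 <= i < m) c i * c (m - i)%N.
  move=> m1; rewrite /c -mulrnAr rec2; last lia.
  rewrite (_ : (2 * m == 2)%N = false); last lia.
  rewrite mulr0 addr0 mulrN.
  have -> : \sum_(1 <= i < 2 * m) cf g i * cf g (2 * m - i)%N =
            \sum_(1 <= i < m) cf g (2 * i)%N * cf g (2 * (m - i))%N.
    pose H i := cf g i * cf g (2 * m - i)%N.
    have hs p : \sum_(1 <= i < 2 * p) H i = \sum_(1 <= i < p) H (2 * i)%N.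
      elim: p => [|[|p] IH]; first by rewrite muln0 !big_geq.
        by rewrite big_nat1 big_geq // /H odd0 // mul0r.
      have -> : (2 * p.+2 = (2 * p.+1).+2)%N by lia.
      have p1 : (1 <= 2 * p.+1)%N by lia.
      rewrite big_nat_recr; last exact: ltnW.
      rewrite big_nat_recr // IH [RHS]big_nat_recr //=.
      rewrite [X in _ + X = _](_ : _ = 0) ?addr0 // /H odd0 ?mul0r //.
      by rewrite oddS oddM.
    rewrite (hs m); apply: eq_bigr => i _; rewrite /H; congr (_ * cf g _).
    by rewrite mulnBr.
  rewrite -mulrN -sumrN mulr_sumr big_nat [RHS]big_nat; apply: eq_bigr => i /andP[i1 im].
  have -> : (m.-1 = (i.-1 + (m - i).-1).+1)%N by lia.
  rewrite exprS exprD; ring.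
(* The constants fit c_1 = 1/12 = 5/60 and 25 (m - 1) >= 5 (2 m + 1) for m >= 2, which is the
   induction step. *)
have clow m : (0 < m)%N -> 5%:R / 60%:R ^+ m <= c m.
  elim/ltn_ind: m => m IH m0; have [m1|m1] := leqP m 1.
    have -> : m = 1%N by lia.
    rewrite /c expr0 mul1r muln1.
    have := rec2 2%N isT; rewrite big_nat1 (odd0 1%N) // mul0r oppr0 add0r mulr1 => h.
    have : cf g 2 * 3%:R = 4%:R^-1 by rewrite mulr_natr.
    move=> h3; lra.
  have := crec m m1 => h.
  have s1 : (5%:R / 60%:R ^+ m) *+ (2 * m).+1 <= \sum_(1 <= i < m) c i * c (m - i)%N.
    apply: (@le_trans _ _ (\sum_(1 <= i < m) 25%:R / 60%:R ^+ m)).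
      rewrite sumr_const_nat -mulrnAl -[X in _ <= X]mulrnAl ler_pM2r; last first.
        by rewrite invr_gt0 exprn_gt0 // ltr0n.
      by rewrite -!mulrnA ler_nat; lia.
    rewrite big_nat [X in _ <= X]big_nat; apply: ler_sum => i /andP[i1 im].
    have -> : 25%:R / 60%:R ^+ m = (5%:R / 60%:R ^+ i) * (5%:R / 60%:R ^+ (m - i)) :> F.
      have -> : m = (i + (m - i))%N by rewrite subnKC // ltnW.
      rewrite addKn exprD invfM mulrACA -natrM; ring.
    have p5 e : 0 <= 5%:R / 60%:R ^+ e :> F by rewrite divr_ge0 // exprn_ge0.
    apply: ler_pM => //; apply: IH => //; lia.
  by rewrite -h -subr_ge0 -mulrnBl pmulrn_lge0 // subr_ge0 in s1.
move=> m m0.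
have iodd p : is_ (2 * p).+1 = (2 * p).+2`!%:R * ((-1) ^+ p * c p.+1).
  rewrite /is_ ev addr0 /c [p.+1.-1]/= [(-1) ^+ p * (_ * _)]mulrA sgn2 mul1r eg'.
  have -> : (2 * p.+1 = (2 * p).+2)%N by lia.
  rewrite mulr0 addr0 [in RHS]factS natrM -[_ *+ _]mulr_natr; ring.
have -> : ((2 * m).+3 = (2 * m.+1).+1)%N by lia.
rewrite !iodd.
have -> : cf G (2 * m) = (-1) ^+ m.-1 * c m.
  rewrite /c mulrA sgn2 mul1r eg'; case: eqP => [e|_]; first lia.
  by rewrite mulr0 addr0.
(* The two moments have opposite signs, so their difference is a sum of terms of one sign. *)
have -> : (-1) ^+ m.-1 * c m * ((2 * m.+1).+2`!%:R * ((-1) ^+ m.+1 * c m.+2) -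
   (2 * m).+2`!%:R * ((-1) ^+ m * c m.+1)) =
   c m * ((2 * m.+1).+2`!%:R * c m.+2 + (2 * m).+2`!%:R * c m.+1).
  have -> : (-1) ^+ m.+1 = (-1) ^+ m.-1 :> F by case: (m) m0 => // k _; rewrite !exprS /=; ring.
  have -> : (-1) ^+ m = - (-1) ^+ m.-1 :> F by case: (m) m0 => // k _; rewrite !exprS /=; ring.
  transitivity (((-1) ^+ m.-1 * (-1) ^+ m.-1) * (c m * ((2 * m.+1).+2`!%:R * c m.+2 + (2 * m).+2`!%:R * c m.+1))); first ring.
  by rewrite sgn2 mul1r.
have p5 e : 0 < 5%:R / 60%:R ^+ e :> F by rewrite divr_gt0 // exprn_gt0.
have c0 e : (0 < e)%N -> 0 < c e by move=> e0; apply: lt_le_trans (clow _ e0).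
rewrite ger0_norm; last first.
  apply: mulr_ge0; first exact: ltW (c0 _ m0).
  by apply: addr_ge0; apply: mulr_ge0 => //; apply/ltW/c0.
apply: (@le_trans _ _ (c m * ((2 * m).+2`!%:R * c m.+1))); last first.
  apply: ler_wpM2l; first exact: ltW (c0 _ m0).
  by rewrite lerDr; apply: mulr_ge0 => //; apply/ltW/c0.
apply: (@le_trans _ _ (5%:R / 60%:R ^+ m * ((2 * m)`!%:R * (5%:R / 60%:R ^+ m.+1)))).
  have -> : (2 * m + 1 = m + m.+1)%N by lia.
  rewrite exprD invfM.
  have -> : 5%:R / 60%:R ^+ m * ((2 * m)`!%:R * (5%:R / 60%:R ^+ m.+1)) =
    25%:R * ((2 * m)`!%:R * (60%:R ^- m * 60%:R ^- m.+1)) :> F by ring.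
  rewrite ler_peMl //; last by rewrite ler1n.
  by rewrite !mulr_ge0 // invr_ge0 exprn_ge0.
apply: ler_pM; [exact: ltW|apply: mulr_ge0 => //; exact: ltW|exact: clow|].
apply: ler_pM => //; [exact: ltW| |exact: clow].
by rewrite ler_nat !factS; nia.
Qed.

End Bernoulli.

(** * Weighted norms *)

(** The properties of the complex modulus used by the estimates, with values in a real field instead
    of the complex numbers. [nuV] ensures that integration does not increase coefficients. *)
Record abs_val (K : comUnitRingType) (R : realFieldType) (nu : K -> R) : Prop := AbsVal {
  nu_ge0 : forall a, 0 <= nu a;
  nu0 : nu 0 = 0;
  nu1 : nu 1 = 1;
  nuD : forall a b, nu (a + b) <= nu a + nu b;
  nuM : forall a b, nu (a * b) = nu a * nu b;
  nuN : forall a, nu (- a) = nu a;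
  nuMn : forall a j, nu (a *+ j) = nu a *+ j;
  nuV : forall j, nu (j.+1%:R^-1) <= 1 }.

Lemma uniq_sum_le (R : realFieldType) (T : choiceType) (s t : seq T) (F : T -> R) :
  uniq s -> {subset s <= t} -> (forall k, 0 <= F k) ->
  \sum_(k <- s) F k <= \sum_(k <- t) F k.
Proof.
move=> us st F0; apply: (@le_trans _ _ (\sum_(k <- undup t) F k)).
  have : perm_eq (undup t) (s ++ [seq k <- undup t | k \notin s]).
    apply: uniq_perm; first exact: undup_uniq.
      rewrite cat_uniq us filter_uniq ?undup_uniq // andbT /=.
      by apply/hasPn => k; rewrite mem_filter => /andP[].
    move=> k; rewrite mem_cat mem_filter mem_undup; case: (boolP (k \in s)) => //= ks.
    exact: st.
  move=> /(perm_big _) ->; rewrite big_cat lerDl; exact: sumr_ge0.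
elim: t {st} => [|a t IH] //=; case: ifP => _; rewrite !big_cons.
  by apply: le_trans IH _; rewrite lerDr.
by rewrite lerD2l.
Qed.

Section Norm.
Variables (n : nat) (K : comUnitRingType) (R : realFieldType) (nu : K -> R).
Hypothesis hnu : abs_val nu.
Hypothesis hQ : forall j, (j.+1%:R : K) \is a GRing.unit.
Implicit Types (f g h : fps n K) (m k : 'X_{1..n}) (r B : R) (s : seq 'X_{1..n}).

Let nge0 := nu_ge0 hnu.

Lemma nu_sum (I : Type) (q : seq I) (P : pred I) (F : I -> K) :
  nu (\sum_(i <- q | P i) F i) <= \sum_(i <- q | P i) nu (F i).
Proof.
apply: (big_rec2 (fun a b => nu a <= b)); first by rewrite (nu0 hnu).
by move=> i a b _ ab; apply: le_trans (nuD hnu _ _) _; rewrite lerD2l.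
Qed.

(** The weighted l^1 norm of radius r is at most B. Ranging over duplicate-free finite lists of
    monomials avoids infinite sums and lets monomials be relabelled by injections. *)
Definition nb r B f := forall s, uniq s -> \sum_(k <- s) nu (f k) * r ^+ mdeg k <= B.

Lemma nb_bm r B f (d : nat) : nb r B f ->
  \sum_(k : 'X_{1..n < d}) nu (f k) * r ^+ mdeg k <= B.
Proof.
move=> h; rewrite -(big_map (@bmnm n d) xpredT (fun k => nu (f k) * r ^+ mdeg k)).
by apply: h; rewrite map_inj_uniq ?index_enum_uniq //; exact: val_inj.
Qed.

Lemma deg_bound s : exists d, forall k, k \in s -> (mdeg k < d)%N.
Proof.
elim: s => [|a s [d hd]]; first by exists 0%N.
exists (maxn (mdeg a).+1 d) => k; rewrite inE => /orP[/eqP ->|/hd kd].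
  by rewrite leq_maxl.
by apply: leq_trans kd _; apply: leq_maxr.
Qed.

Lemma nb_of_bm r B f : 0 <= r ->
  (forall d, \sum_(k : 'X_{1..n < d}) nu (f k) * r ^+ mdeg k <= B) -> nb r B f.
Proof.
move=> r0 h s us; have [d hd] := deg_bound s; apply: le_trans (h d).
rewrite -(big_map (@bmnm n d) xpredT (fun k => nu (f k) * r ^+ mdeg k)).
apply: uniq_sum_le => // [k ks|k]; last by rewrite mulr_ge0 // exprn_ge0.
by apply/mapP; exists (BMultinom (hd _ ks)) => //; rewrite mem_index_enum.
Qed.

Lemma nb_ge0 r B f : nb r B f -> 0 <= B.
Proof. by move=> /(_ [::] isT); rewrite big_nil. Qed.

Lemma nb_coef r B f k : nb r B f -> nu (f k) * r ^+ mdeg k <= B.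
Proof. by move=> /(_ [:: k] isT); rewrite big_seq1. Qed.

Lemma nb_le r B r' B' f : 0 <= r' -> r' <= r -> B <= B' -> nb r B f -> nb r' B' f.
Proof.
move=> r0 rr BB h s us; apply: le_trans BB; apply: le_trans (h s us).
by apply: ler_sum => k _; apply: ler_wpM2l => //; apply: lerXn2r; rewrite ?nnegrE // (le_trans r0).
Qed.

Lemma nbD r B C f g : 0 <= r -> nb r B f -> nb r C g -> nb r (B + C) (f + g).
Proof.
move=> r0 hf hg s us.
apply: (@le_trans _ _ (\sum_(k <- s) (nu (f k) * r ^+ mdeg k + nu (g k) * r ^+ mdeg k))).
  apply: ler_sum => k _; rewrite -mulrDl; apply: ler_wpM2r; first exact: exprn_ge0.
  exact: (nuD hnu).
by rewrite big_split /=; apply: lerD; [apply: hf|apply: hg].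
Qed.

Lemma nbN r B f : nb r B f -> nb r B (- f).
Proof.
move=> h s us; apply: le_trans (h s us).
by apply: ler_sum => k _; rewrite fpsN (nuN hnu).
Qed.

Lemma nbB r B C f g : 0 <= r -> nb r B f -> nb r C g -> nb r (B + C) (f - g).
Proof. by move=> r0 hf hg; apply: nbD => //; apply: nbN. Qed.

Lemma nbZ r B a f : nb r B f -> nb r (nu a * B) (a *: f).
Proof.
move=> h s us; apply: le_trans (ler_wpM2l (nge0 a) (h s us)).
by rewrite mulr_sumr; apply: ler_sum => k _; rewrite fpsZ (nuM hnu) mulrA.
Qed.

Lemma nbMn r B f (j : nat) : nb r B f -> nb r (B *+ j) (f *+ j).
Proof.
move=> h s us; apply: le_trans (ler_wMn2r j (h s us)); rewrite -sumrMnl.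
by apply: ler_sum => k _; rewrite fpsMn (nuMn hnu) mulrnAl.
Qed.

Lemma nb0 r : nb r 0 0.
Proof. by move=> s _; rewrite big1 // => k _; rewrite fps0 (nu0 hnu) mul0r. Qed.

Lemma nb_supp1 r f k0 B : 0 <= B -> nu (f k0) * r ^+ mdeg k0 <= B ->
  (forall k, k != k0 -> f k = 0) -> nb r B f.
Proof.
move=> B0 h0 h s us; have [ks|ks] := boolP (k0 \in s); last first.
  rewrite big_seq big1 // => k ks'; rewrite h ?(nu0 hnu) ?mul0r //.
  by apply: contraNneq ks => <-.
rewrite (big_rem k0) //= big_seq big1 ?addr0 // => k.
by rewrite mem_rem_uniq // inE => /andP[kk _]; rewrite h // (nu0 hnu) mul0r.
Qed.

Lemma nb_cst r a : nb r (nu a) (cst a).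
Proof.
apply: (@nb_supp1 _ _ 0%MM) => //; first by rewrite cstE eqxx mulr1 mdeg0 expr0 mulr1.
by move=> k /negbTE k0; rewrite cstE k0 mulr0.
Qed.

Lemma nb1 r : nb r 1 1.
Proof. by have := @nb_cst r 1; rewrite rmorph1 (nu1 hnu). Qed.

Lemma nb_X r i : 0 <= r -> nb r r (fps_X K i).
Proof.
move=> r0; apply: (@nb_supp1 _ _ U_(i)%MM) => //.
  by rewrite /fps_X eqxx mdeg1 expr1 (nu1 hnu) mul1r.
by move=> k /negbTE ki; rewrite /fps_X ki.
Qed.

Lemma fps_mul_big f g m d : (mdeg m < d)%N ->
  (f * g) m = \sum_(k : 'X_{1..n < d}) \sum_(l : 'X_{1..n < d})
     (if (k + l)%MM == m then f k * g l else 0).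
Proof.
move=> md; rewrite (fps_mulE _ _ md) /fps_trunc mulr_suml raddf_sum /=.
apply: eq_bigr => k _; rewrite mulr_sumr raddf_sum /=; apply: eq_bigr => l _.
rewrite -scalerAl -scalerAr -mpolyXD !mcoeffZ mcoeffX.
by case: eqP => _; rewrite ?mulr1 ?mulr0.
Qed.

Lemma sum_indic s m (c : R) : uniq s -> 0 <= c ->
  \sum_(k <- s) (if m == k then c else 0) <= c.
Proof.
move=> us c0; have [ms|ms] := boolP (m \in s).
  rewrite (big_rem m) //= eqxx big_seq big1 ?addr0 // => k.
  by rewrite mem_rem_uniq // inE eq_sym => /andP[/negbTE ->].
rewrite big_seq big1 // => k ks; case: eqP => // e; by rewrite e ks in ms.
Qed.

Lemma nbM r B C f g : 0 <= r -> nb r B f -> nb r C g -> nb r (B * C) (f * g).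
Proof.
move=> r0 hf hg s us; have [d hd] := deg_bound s.
pose a k := nu (f k) * r ^+ mdeg k; pose b k := nu (g k) * r ^+ mdeg k.
have a0 k : 0 <= a k by rewrite mulr_ge0 // exprn_ge0.
have b0 k : 0 <= b k by rewrite mulr_ge0 // exprn_ge0.
apply: (@le_trans _ _ (\sum_(m <- s) \sum_(k : 'X_{1..n < d}) \sum_(l : 'X_{1..n < d})
   (if (k + l)%MM == m then a k * b l else 0))).
  rewrite big_seq [X in _ <= X]big_seq; apply: ler_sum => m /hd md.
  rewrite (fps_mul_big _ _ md).
  apply: le_trans (ler_wpM2r (exprn_ge0 _ r0) (nu_sum _ _ _)) _.
  rewrite mulr_suml; apply: ler_sum => k _.
  apply: le_trans (ler_wpM2r (exprn_ge0 _ r0) (nu_sum _ _ _)) _.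
  rewrite mulr_suml; apply: ler_sum => l _; case: eqP => [<-|_].
    by rewrite (nuM hnu) mdegD exprD /a /b mulrACA.
  by rewrite (nu0 hnu) mul0r.
rewrite exchange_big /=.
apply: (@le_trans _ _ (\sum_(k : 'X_{1..n < d}) \sum_(l : 'X_{1..n < d}) a k * b l)).
  apply: ler_sum => k _; rewrite exchange_big /=; apply: ler_sum => l _.
  by apply: sum_indic => //; apply: mulr_ge0.
have -> : \sum_(k : 'X_{1..n < d}) \sum_(l : 'X_{1..n < d}) a k * b l =
  (\sum_(k : 'X_{1..n < d}) a k) * (\sum_(l : 'X_{1..n < d}) b l).
  by rewrite mulr_suml; apply: eq_bigr => k _; rewrite mulr_sumr.
by apply: ler_pM; rewrite ?sumr_ge0 //; apply: nb_bm.
Qed.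

Lemma nbXn r B f (j : nat) : 0 <= r -> nb r B f -> nb r (B ^+ j) (f ^+ j).
Proof.
move=> r0 h; elim: j => [|j IH]; first by rewrite !expr0; apply: nb1.
by rewrite !exprS; apply: nbM.
Qed.

Lemma nb_monc r B (t : 'I_n -> fps n K) k : 0 <= r -> (forall i, nb r B (t i)) ->
  nb r (B ^+ mdeg k) (monc t k).
Proof.
move=> r0 h; rewrite mdegE /monc.
apply: (big_rec2 (fun (e : nat) u => nb r (B ^+ e) u)); first by rewrite expr0; apply: nb1.
by move=> i e u _ hu; rewrite exprD; apply: nbM => //; apply: nbXn.
Qed.

Lemma fps_comp_big f (t : 'I_n -> fps n K) m d : vanish_at0 t -> (mdeg m < d)%N ->
  fps_comp f t m = \sum_(k : 'X_{1..n < d}) f k * monc t k m.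
Proof.
move=> vt md; have := fps_comp_ev vt f md; rewrite fpsB => /eqP.
rewrite subr_eq0 => /eqP ->; rewrite ev_truncE fps_sum; apply: eq_bigr => k _.
by rewrite fps_mulC_E.
Qed.

Lemma nb_comp r B q f (t : 'I_n -> fps n K) : 0 <= r -> vanish_at0 t ->
  nb q B f -> (forall i, nb r q (t i)) -> nb r B (fps_comp f t).
Proof.
move=> r0 vt hf ht s us; have [d hd] := deg_bound s.
apply: (@le_trans _ _ (\sum_(m <- s) \sum_(k : 'X_{1..n < d})
    nu (f k) * (nu (monc t k m) * r ^+ mdeg m))).
  rewrite big_seq [X in _ <= X]big_seq; apply: ler_sum => m /hd md.
  rewrite (fps_comp_big _ vt md).
  apply: le_trans (ler_wpM2r (exprn_ge0 _ r0) (nu_sum _ _ _)) _.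
  by rewrite mulr_suml; apply: ler_sum => k _; rewrite (nuM hnu) mulrA.
rewrite exchange_big /=; apply: le_trans (nb_bm d hf).
apply: ler_sum => k _; rewrite -mulr_sumr; apply: ler_wpM2l => //.
exact: (nb_monc k r0 ht).
Qed.

(** Shrinking the radius by t makes a series of order j smaller by t^j. All smallness conditions
    below are obtained this way. *)
Lemma nb_ord r B (j : nat) f t : 0 <= r -> 0 <= t -> t <= 1 -> ordge j f ->
  nb r B f -> nb (t * r) (t ^+ j * B) f.
Proof.
move=> r0 t0 t1 hf h s us; apply: le_trans (ler_wpM2l (exprn_ge0 j t0) (h s us)).
rewrite mulr_sumr; apply: ler_sum => k _.
have [kj|kj] := ltnP (mdeg k) j; first by rewrite hf // (nu0 hnu) !mul0r mulr0.
rewrite exprMn mulrCA; apply: ler_wpM2r; first by rewrite mulr_ge0 // exprn_ge0.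
exact: ler_wiXn2l.
Qed.

Lemma nb_int r B i f : 0 <= r -> nb r B f -> nb r (r * B) (fps_int i f).
Proof.
move=> r0 h s us; pose s' := [seq k : 'X_{1..n} <- s | k i != 0%N].
have -> : \sum_(k <- s) nu (fps_int i f k) * r ^+ mdeg k =
   \sum_(k <- s') nu (fps_int i f k) * r ^+ mdeg k.
  rewrite /s' big_filter [RHS]big_mkcond /=; apply: eq_bigr => k _.
  by rewrite /fps_int; case: eqP => //= _; rewrite (nu0 hnu) mul0r.
pose p (k : 'X_{1..n}) := (k - U_(i))%MM.
have ip : {in s' &, injective p}.
  move=> k l; rewrite !mem_filter => /andP[ki _] /andP[li _] e.
  by rewrite -(@mnm_subU _ k i) ?lt0n // -(@mnm_subU _ l i) ?lt0n // -/(p k) e.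
have us' : uniq (map p s') by rewrite map_inj_in_uniq // filter_uniq.
apply: le_trans (ler_wpM2l r0 (h _ us')); rewrite big_map mulr_sumr.
rewrite big_seq [X in _ <= X]big_seq; apply: ler_sum => k; rewrite mem_filter => /andP[ki _].
rewrite /fps_int (negbTE ki) (nuM hnu) -(mdeg_subU ki) exprS -/(p k).
have -> : r * (nu (f (p k)) * r ^+ mdeg (p k)) = nu (f (p k)) * (r * r ^+ mdeg (p k)) by ring.
apply: ler_wpM2r; first by rewrite mulr_ge0 // exprn_ge0.
rewrite -[X in _ <= X]mul1r; apply: ler_wpM2r => //.
by move: ki; case: (k i) => // j _; apply: (nuV hnu).
Qed.

Lemma nb_dv r B i f : 0 < r -> nb r B f -> nb r (B / r) (dv i f).
Proof.
move=> r0 h s us; rewrite ler_pdivlMr // mulr_suml.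
have us' : uniq (map (fun k => k + U_(i))%MM s).
  by rewrite map_inj_uniq //; exact: addIm.
apply: le_trans (h _ us'); rewrite big_map; apply: ler_sum => k _.
by rewrite /dv mdegD mdeg1 addn1 exprSr mulrA.
Qed.

(** Halving the radius absorbs the factor k_i + 1, which is at most 2^|k|. *)
Lemma nb_deriv r B i f : 0 < r -> nb r B f -> nb (r / 2%:R) (B / r) (fps_deriv i f).
Proof.
move=> r0 h s us; apply: le_trans (nb_dv i r0 h us); apply: ler_sum => k _.
rewrite /fps_deriv (nuMn hnu) mulrnAl -mulrnAr; apply: ler_wpM2l => //.
rewrite expr_div_n -mulrnAr -[X in _ <= X]mulr1.
apply: ler_wpM2l; first by rewrite exprn_ge0 // ltW.
have -> : (2%:R ^+ mdeg k)^-1 *+ (k i).+1 = (k i).+1%:R / 2%:R ^+ mdeg k :> R by rewrite mulr_natl.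
rewrite ler_pdivrMr ?exprn_gt0 // mul1r -natrX ler_nat.
apply: (@leq_trans (mdeg k).+1); last exact: ltn_expl.
by rewrite ltnS mdegE (bigD1 i) //= leq_addr.
Qed.

(** The bound inspects finitely many coefficients at a time, hence survives Krull limits; this is
    how [krull_fix] delivers convergent solutions. *)
Lemma nb_closed r B : kclosed (nb r B).
Proof.
move=> f h s us; have [d hd] := deg_bound s; have [g hg fg] := h d.
apply: le_trans (hg s us); rewrite big_seq [X in _ <= X]big_seq.
apply: ler_sum => k /hd kd; have := fg k kd; rewrite fpsB => /eqP.
by rewrite subr_eq0 => /eqP ->.
Qed.

(* Convergence near the origin, over any ring with an absolute value. *)
Definition gb f := exists r B, 0 < r /\ nb r B f.

Lemma gb_tuple (I : finType) (F : I -> fps n K) : (forall i, gb (F i)) ->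
  exists r B, 0 < r /\ forall i, nb r B (F i).
Proof.
move=> h; suff [r [B [r0 hr]]] : exists r B, 0 < r /\ forall i, i \in enum I -> nb r B (F i).
  by exists r, B; split=> // i; apply: hr; rewrite mem_enum.
elim: (enum I) => [|a q [r [B [r0 hr]]]]; first by exists 1, 0; split.
have [r' [B' [r'0 hr']]] := h a.
exists (Num.min r r'), (Num.max B B'); split; first by rewrite lt_min r0 r'0.
have m0 : 0 <= Num.min r r' by rewrite le_min !ltW.
move=> i; rewrite inE => /orP[/eqP ->|iq].
  by apply: nb_le hr'; rewrite ?ge_min ?le_max ?lexx ?orbT.
by apply: nb_le (hr i iq); rewrite ?ge_min ?le_max ?lexx ?orbT.
Qed.

Lemma gb2 f g : gb f -> gb g -> exists r B, [/\ 0 < r, nb r B f & nb r B g].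
Proof.
move=> hf hg; have [|r [B [r0 h]]] := @gb_tuple bool (fun b => if b then f else g).
  by case.
by exists r, B; split=> //; [apply: (h true)|apply: (h false)].
Qed.

Lemma gbD f g : gb f -> gb g -> gb (f + g).
Proof.
move=> hf hg; have [r [B [r0 h1 h2]]] := gb2 hf hg; exists r, (B + B); split=> //.
by apply: nbD => //; apply: ltW.
Qed.
Lemma gbN f : gb f -> gb (- f).
Proof. by move=> [r [B [r0 h]]]; exists r, B; split=> //; apply: nbN. Qed.
Lemma gbB f g : gb f -> gb g -> gb (f - g).
Proof. by move=> hf hg; apply: gbD => //; apply: gbN. Qed.
Lemma gbM f g : gb f -> gb g -> gb (f * g).
Proof.
move=> hf hg; have [r [B [r0 h1 h2]]] := gb2 hf hg; exists r, (B * B); split=> //.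
by apply: nbM => //; apply: ltW.
Qed.
Lemma gb_cst a : gb (cst a).
Proof. by exists 1, (nu a); split=> //; apply: nb_cst. Qed.
Lemma gb0 : gb 0.
Proof. by exists 1, 0; split=> //; apply: nb0. Qed.
Lemma gbX i : gb (fps_X K i).
Proof. by exists 1, 1; split=> //; apply: nb_X. Qed.
Lemma gbZ a f : gb f -> gb (a *: f).
Proof. by move=> h; rewrite scaleE; apply: gbM => //; apply: gb_cst. Qed.
Lemma gbMn f (j : nat) : gb f -> gb (f *+ j).
Proof. by move=> h; rewrite -scaler_nat; apply: gbZ. Qed.
Lemma gbXn f (j : nat) : gb f -> gb (f ^+ j).
Proof.
move=> h; elim: j => [|j IH]; first by have := gb_cst 1; rewrite rmorph1.
by rewrite exprS; apply: gbM.
Qed.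
Lemma gb_sum (I : Type) (q : seq I) (P : pred I) (F : I -> fps n K) :
  (forall i, P i -> gb (F i)) -> gb (\sum_(i <- q | P i) F i).
Proof. by move=> h; apply: big_ind => //; [exact: gb0|exact: gbD]. Qed.
Lemma gb_deriv i f : gb f -> gb (fps_deriv i f).
Proof.
move=> [r [B [r0 h]]]; exists (r / 2%:R), (B / r); split; first by rewrite divr_gt0.
exact: nb_deriv.
Qed.

Lemma small_radius (B q : R) : 0 <= B -> 0 < q -> exists t, [/\ 0 < t, t <= 1 & t * B <= q].
Proof.
move=> B0 q0; have p : 0 < B + q by rewrite ltr_wpDl.
exists (q / (B + q)); split; first exact: divr_gt0.
  by rewrite ler_pdivrMr // mul1r lerDr.
by rewrite mulrAC ler_pdivrMr // ler_pM2l // lerDl ltW.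
Qed.

Lemma gb_comp f (t : 'I_n -> fps n K) : vanish_at0 t -> gb f -> (forall i, gb (t i)) ->
  gb (fps_comp f t).
Proof.
move=> vt [q [C [q0 hf]]] /gb_tuple[r [B [r0 ht]]].
pose B' := Num.max B 0; have B0 : 0 <= B' by rewrite le_max lexx orbT.
have ht' i : nb r B' (t i) by apply: nb_le (ht i); [exact: ltW|exact: lexx|rewrite le_max lexx].
have [e [e0 e1 eB]] := small_radius B0 q0.
have er0 : 0 < e * r by exact: mulr_gt0.
exists (e * r), C; split=> //; apply: (nb_comp (ltW er0) vt hf) => i.
apply: (@nb_le (e * r) (e ^+ 1 * B')); [exact: ltW|exact: lexx|by rewrite expr1|].
by apply: nb_ord => //; [exact: ltW|exact: ltW|apply/ordge1E; apply: vt].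
Qed.

End Norm.

(** * Convergent solutions of functional equations *)

Section Majorants.
Variables (n : nat) (K : comUnitRingType) (R : realFieldType) (nu : K -> R).
Hypothesis hnu : abs_val nu.
Hypothesis hQ : forall j, (j.+1%:R : K) \is a GRing.unit.
Variables (ix iy : 'I_n) (hxy : ix != iy).
Implicit Types (f g h : fps n K) (m k : 'X_{1..n}) (r B : R).

Notation XX i := (fps_X K i : fps n K).
Notation x := (XX ix).
Notation y := (XX iy).
Notation nb := (nb nu).
Notation gb := (gb nu).

Lemma pf_truncE d f m : pf (fps_trunc d f) m = if (mdeg m < d)%N then f m else 0.
Proof.
case: ltnP => md; first exact: pf_trunc.
rewrite /pf /fps_trunc raddf_sum /= big1 // => k _; rewrite mcoeffZ mcoeffX.
case: eqP => [e|_]; last by rewrite mulr0.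
by move: (bmdeg k); rewrite e ltnNge md.
Qed.

Lemma nb_trunc d r f : 0 <= r ->
  nb r (\sum_(k : 'X_{1..n < d}) nu (f k) * r ^+ mdeg k) (pf (fps_trunc d f)).
Proof.
move=> r0 s us; rewrite -(big_map (@bmnm n d) xpredT (fun k => nu (f k) * r ^+ mdeg k)).
apply: (@le_trans _ _ (\sum_(k <- [seq k : 'X_{1..n} <- s | (mdeg k < d)%N]) nu (f k) * r ^+ mdeg k)).
  rewrite big_filter [X in _ <= X]big_mkcond /=; apply: ler_sum => k _.
  by rewrite pf_truncE; case: ltnP => //; rewrite (nu0 hnu) mul0r.
apply: uniq_sum_le; first exact: filter_uniq.
  move=> k; rewrite mem_filter => /andP[kd _].
  by apply/mapP; exists (BMultinom kd) => //; rewrite mem_index_enum.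
by move=> k; rewrite mulr_ge0 ?exprn_ge0 // (nu_ge0 hnu).
Qed.

Lemma gb_max_radius f g : gb f -> gb g ->
  exists r B, [/\ 0 < r, 0 <= B, nb r B f & nb r B g].
Proof.
move=> hf hg; have [r [B [r0 h1 h2]]] := gb2 hnu hf hg; exists r, B; split=> //.
exact: nb_ge0 h1.
Qed.

Lemma nb_zero r B : 0 <= B -> nb r B (0 : fps n K).
Proof. by move=> B0 s us; apply: le_trans B0; apply: (nb0 hnu r us). Qed.

Lemma ordgeZ d (a : K) f : ordge d f -> ordge d (a *: f).
Proof. by move=> h; rewrite scaleE; apply: ordgeMr. Qed.

(** The term 2 y^2 dominates. W is not yet known to have a finite norm, so let S be the norm of its
    truncation at a small radius q. Solving the equation for 2 y^2 W and dividing by y^2 gives 2 S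
    <= B / q^2 + (3/2) S, a bound independent of the truncation. *)
Lemma gb_div (A3 C W : fps n K) : gb A3 -> gb C -> ordge 3 A3 ->
  (y ^+ 2 *+ 2 + x * y + A3) * W = C -> gb W.
Proof.
move=> hA hC oA eW; have [r [B [r0 B0 nA nC]]] := gb_max_radius hA hC.
have [t [t0 t1 tB]] := @small_radius R B (r ^+ 2 / 2%:R) B0 (divr_gt0 (exprn_gt0 _ r0) (ltr0Sn _ _)).
pose q := t * r; have q0 : 0 < q by exact: mulr_gt0.
have q0' := ltW q0.
have nA' : nb q (q ^+ 2 / 2%:R) A3.
  apply: (nb_le hnu) (nb_ord hnu (ltW r0) (ltW t0) t1 oA nA) => //.
  have -> : t ^+ 3 * B = t ^+ 2 * (t * B) by ring.
  have -> : q ^+ 2 / 2%:R = t ^+ 2 * (r ^+ 2 / 2%:R) by rewrite /q; field.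
  by apply: ler_wpM2l => //; rewrite exprn_ge0 // ltW.
have nC' : nb q B C.
  by apply: (nb_le hnu _ _ _ nC) => //; rewrite /q -[X in _ <= X]mul1r ler_wpM2r // ltW.
exists q, (2%:R * B / q ^+ 2); split=> //; apply: (nb_of_bm hnu) => // d.
set S := \sum_(k : _) _; pose Wd := pf (fps_trunc d W).
have nW : nb q S Wd by apply: nb_trunc.
pose P := C - x * y * Wd - A3 * Wd.
have nP : nb q (B + q * q * S + q ^+ 2 / 2%:R * S) P.
  apply: (nbB hnu) => //; first apply: (nbB hnu) => //.
    by do ! apply: (nbM hnu) => //; apply: (nb_X hnu).
  exact: (nbM hnu).
have eP k : (mdeg k < d)%N -> dv iy (dv iy P) k = W k *+ 2.
  move=> kd; have o : ordge (2 + d)%N (P - y ^+ 2 *+ 2 * Wd).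
    have -> : P - y ^+ 2 *+ 2 * Wd = (y ^+ 2 *+ 2 + x * y + A3) * (W - Wd).
      by rewrite mulrBr eW /P; ring.
    apply: ordgeM; last exact: ordge_trunc.
    apply: ordgeD; last exact: ordgeW oA.
    have ox := @ordge_X n K ix; have oy := @ordge_X n K iy.
    apply: ordgeD; last exact: (ordgeM ox oy).
    by rewrite mulr2n; apply: ordgeD; rewrite expr2; apply: (ordgeM oy oy).
  have := o (k + U_(iy) + U_(iy))%MM; rewrite !mdegD mdeg1 fpsB => h.
  have /eqP : P (k + U_(iy) + U_(iy))%MM - (y ^+ 2 *+ 2 * Wd) (k + U_(iy) + U_(iy))%MM = 0.
    by apply: h; lia.
  rewrite subr_eq0 => /eqP; rewrite /dv => ->.
  have -> : y ^+ 2 *+ 2 * Wd = y * (y * (Wd *+ 2)) by ring.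
  by rewrite !fps_mulX_U fpsMn /Wd pf_truncE kd.
have nP2 := nb_dv iy q0 (nb_dv iy q0 nP).
have := nb_bm d nP2.
have -> : \sum_(k : 'X_{1..n < d}) nu (dv iy (dv iy P) k) * q ^+ mdeg k = S *+ 2.
  rewrite -sumrMnl; apply: eq_bigr => k _; rewrite eP ?bmdeg //.
  by rewrite (nuMn hnu) mulrnAl.
have q2 : 0 < q ^+ 2 by exact: exprn_gt0.
rewrite !ler_pdivlMr // => h; lra.
Qed.

(** Picard iteration for dP/dy = W(P), starting from the identity on the hyperplane y = 0. *)
Lemma gb_flow (W : 'I_n -> fps n K) : (forall i, gb (W i)) ->
  exists P : 'I_n -> fps n K,
  [/\ forall j, P j = (if j == iy then 0 else XX j) + fps_int iy (fps_comp (W j) P),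
      forall j, ordge 1 (P j) & forall j, gb (P j)].
Proof.
move=> /(gb_tuple hnu)[r [B [r0 nW]]].
have [B' [B0 {}nW]] : exists B', 0 <= B' /\ forall i, nb r B' (W i).
  exists (Num.max B 0); split; first by rewrite le_max lexx orbT.
  by move=> i; apply: (nb_le hnu) (nW i); [exact: ltW|exact: lexx|rewrite le_max lexx].
have p1 : 0 < 1 + B' by lra.
(* Chosen so that q + q B' = r: at radius q, initial value and integral together stay within the
   radius r of W. *)
pose q := r / (1 + B'); have q0 : 0 < q by exact: divr_gt0.
have eq : q + q * B' = r by rewrite -{1}[q]mulr1 -mulrDr /q divfK // gt_eqF.
pose Pr (u : 'I_n -> fps n K) := forall i, ordge 1 (u i) /\ nb q r (u i).
have Pv u : Pr u -> vanish_at0 u by move=> h i; apply: (h i).1; rewrite mdeg0.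
have [||u v d hu hv uv i||P hP eP] := @krull_fix n K _ Pr
  (fun u j => (if j == iy then 0 else XX j) + fps_int iy (fps_comp (W j) u)) (fun _ => 0).
- by move=> i; split=> //; apply: nb_zero; rewrite ltW.
- move=> u hu i; split.
    by apply: ordgeD; [case: eqP => // _; apply: ordge_X|apply: int_ordge].
  rewrite -eq; apply: (nbD hnu); first exact: ltW.
    case: eqP => _; last exact: (nb_X hnu _ (ltW q0)).
    by apply: nb_zero; rewrite ltW.
  apply: (nb_int hnu) => //; first exact: ltW.
  by apply: (nb_comp hnu (ltW q0) (Pv _ hu) (nW i)) => j; have [] := hu j.
- rewrite opprD addrACA subrr add0r -intB; apply: int_ordge.
  case: d uv => [|d] uv //.
  have [f0 [c [-> of0]]] : exists f0 c, W i = f0 + cst c /\ ordge 1 f0.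
    exists (W i - cst (W i 0%MM)), (W i 0%MM); split; first by rewrite subrK.
    by apply/ordge1E; rewrite fpsB cstE eqxx mulr1 subrr.
  have vu := Pv _ hu; have vv := Pv _ hv.
  rewrite !compD // !compC // opprD addrACA subrr addr0 -[d.+1]add1n.
  by apply: comp_ordge_diff => // j; [exact: (hu j).1|exact: (hv j).1].
- apply: (@tclosed_all n K _ (fun _ f => ordge 1 f /\ nb q r f)) => i.
  by apply: kclosed_and; [exact: kclosed_ordge|exact: nb_closed].
exists P; split=> j.
- by rewrite -{1}eP.
- exact: (hP j).1.
by exists q, r; split=> //; exact: (hP j).2.
Qed.

(* The point of first coordinate - 2 x on the branch y = 0 (e = false) or
   x + 2 y = 0 (e = true), displaced by v in the direction of y. *)
Definition rootp (e : bool) (v : fps n K) : 'I_n -> fps n K := fun j =>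
  if j == ix then - (x *+ 2) else if j == iy then (if e then x else 0) + v else 0.

Lemma rootp1 e v j : ordge 1 v -> ordge 1 (rootp e v j).
Proof.
move=> hv; rewrite /rootp; case: eqP => _.
  by apply/ordgeN; rewrite mulr2n; apply: ordgeD; apply: ordge_X.
case: eqP => _ //; apply: ordgeD => //.
by case: e => //; apply: ordge_X.
Qed.

(** Invariance under this substitution expresses that a series involves x alone. *)
Definition onlyx : 'I_n -> fps n K := fun j => if j == ix then x else 0.

Lemma onlyx1 j : ordge 1 (onlyx j).
Proof. by rewrite /onlyx; case: eqP => // _; apply: ordge_X. Qed.

Lemma comp_zero f : f 0%MM = 0 -> fps_comp f (fun _ => 0) = 0.
Proof.
move=> f0; apply/funext => m; rewrite /fps_comp big1 // => k _.
have [->|/eqP k0] := eqVneq (bmnm k) 0%MM; first by rewrite f0 mul0r.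
have [i ki] : exists i, k i != 0%N.
  apply: contrapT => h; apply: k0; apply/mnmP => i; rewrite mnm0E.
  by apply/eqP; apply: contrapT => /negP ki; apply: h; exists i.
rewrite (bigD1 i) //= expr0n (negbTE ki) mul0r mulr0 //.
Qed.

(** The equation says that [crossf] + E3 vanishes at [rootp e v]. Its leading term in v is x v, so
    the implicit function theorem does not apply directly and the iteration divides by x. The
    division is exact because all iterates are series in x alone, without constant term. *)
Lemma gb_root (e : bool) (E3 : fps n K) : gb E3 -> ordge 3 E3 ->
  exists v, [/\ ordge 2 v, gb v &
    (x * v) *+ 2 = (-1) ^+ e *: (v ^+ 2 *+ 2 + fps_comp E3 (rootp e v))].
Proof.
move=> [r [B [r0 nE]]] oE; have B0 := nb_ge0 nE.
have u2 : (2%:R : K) \is a GRing.unit by exact: hQ.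
pose hf : K := 2%:R^-1; have hf1 : nu hf <= 1 by apply: (nuV hnu).
have [t [t0 t1 tB]] := @small_radius R B (r ^+ 2 / 16%:R) B0 (divr_gt0 (exprn_gt0 _ r0) (ltr0Sn _ _)).
pose q := t * r / 2%:R; have q0 : 0 < q by rewrite divr_gt0 // mulr_gt0.
have q0' := ltW q0.
(* [rootp] sends radius q into radius 2 q. With this bound, v^2 and the term of E3 together have
   norm at most q^2 / 2, and division by x restores the bound q / 2 on v. *)
have nE' : nb (q + q) (q ^+ 2 / 4%:R) E3.
  have -> : q + q = t * r by rewrite /q; field.
  apply: (nb_le hnu) (nb_ord hnu (ltW r0) (ltW t0) t1 oE nE) => //; first by rewrite mulr_ge0 // ltW.
  have -> : q ^+ 2 / 4%:R = t ^+ 2 * (r ^+ 2 / 16%:R).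
    by rewrite /q; field.
  have -> : t ^+ 3 * B = t ^+ 2 * (t * B) by ring.
  by apply: ler_wpM2l => //; rewrite exprn_ge0 // ltW.
pose Pr (u : unit -> fps n K) := forall i,
  ordge 2 (u i) /\ (nb q (q / 2%:R) (u i) /\ fps_comp (u i) onlyx = u i).
have vo : vanish_at0 onlyx by move=> j; apply: onlyx1; rewrite mdeg0.
have vp u : Pr u -> vanish_at0 (rootp e (u tt)).
  by move=> hu j; apply: rootp1; rewrite ?mdeg0 //; apply: ordgeW (hu tt).1.
pose H (v : fps n K) := (-1) ^+ e *: (v ^+ 2 + hf *: fps_comp E3 (rootp e v)).
have Hx u : Pr u -> fps_comp (H (u tt)) onlyx = H (u tt).
  move=> hu; have [_ [_ ux]] := hu tt.
  rewrite /H compZ // compD // compXn // ux compZ // comp_comp //; last exact: vp.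
  congr (_ *: (_ + _ *: _)); apply: comp_eq => j; rewrite /rootp.
  case: eqP => _; first by rewrite compN // compMn // compX // /onlyx eqxx.
  case: eqP => _; last by rewrite comp0.
  rewrite compD // ux; case: e {vp H} => //; last by rewrite comp0.
  by rewrite compX // /onlyx eqxx.
have Ho u : Pr u -> ordge 3 (H (u tt)).
  move=> hu; have [ou _] := hu tt; rewrite /H; apply: ordgeZ; apply: ordgeD.
    by apply: (@ordgeW _ _ 4) => //; rewrite expr2; apply: (ordgeM ou ou).
  by apply: ordgeZ; apply: fps_comp_ordge => //; apply: vp.
have Hd u : Pr u -> H (u tt) = x * dv ix (H (u tt)).
  move=> hu; apply: res_dvd; rewrite -(Hx u hu) comp_comp //; last exact: res_vanish.
  rewrite -[RHS](@comp_zero (H (u tt))); last by apply: (Ho u hu); rewrite mdeg0.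
  apply: comp_eq => j; rewrite /onlyx; have vr := @res_vanish n K ix.
  by case: eqP => _; rewrite ?comp0 // compX // /res eqxx.
have [||u v d hu hv uv i||u hu eu] := @krull_fix n K unit Pr (fun u _ => dv ix (H (u tt))) (fun _ => 0).
- move=> i; split=> //; split; last by rewrite comp0.
  by apply: nb_zero; rewrite divr_ge0.
- move=> u hu i; have [ou [nu_ ux]] := hu tt; split; first exact/dv_ordge/Ho.
  split; last first.
    apply: (@mulX_inj _ _ ix); rewrite -(Hd u hu) -{2}(Hx u hu) [in RHS](Hd u hu).
    by rewrite compM // compX // /onlyx eqxx.
  have -> : q / 2%:R = (q ^+ 2 / 2%:R) / q.
    by field; rewrite gt_eqF.
  apply: nb_dv => //; rewrite /H.
  have -> : q ^+ 2 / 2%:R = nu ((-1) ^+ e) * ((q / 2%:R) ^+ 2 + 1 * (q ^+ 2 / 4%:R)).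
    have -> : nu ((-1) ^+ e) = 1.
      by case: (e); rewrite ?expr1 ?expr0 ?(nuN hnu) (nu1 hnu).
    by field.
  apply: (nbZ hnu); apply: (nbD hnu) => //; first exact: (nbXn hnu).
  have hc : nb q (q ^+ 2 / 4%:R) (fps_comp E3 (rootp e (u tt))).
    apply: (nb_comp hnu q0' (vp u hu) nE') => j; rewrite /rootp.
    case: eqP => _; first by apply: (nbN hnu); rewrite mulr2n; apply: (nbD hnu) => //; apply: (nb_X hnu).
    case: eqP => _; last by apply: nb_zero; rewrite addr_ge0.
    apply: (@nb_le _ _ _ _ hnu q (q + q / 2%:R)) => //; first by rewrite lerD2l ler_pdivrMr // ler_peMr // ler1n.
    apply: (nbD hnu) => //; case: (e); first exact: (nb_X hnu).
    exact: nb_zero.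
  apply: (@nb_le _ _ _ _ hnu q (nu hf * (q ^+ 2 / 4%:R))) => //; last exact: (nbZ hnu).
  by apply: ler_wpM2r => //; rewrite divr_ge0 // exprn_ge0.
- have [ou [_ _]] := hu tt; have [ov [_ _]] := hv tt.
  have key c : ordge c.+1 (u tt - v tt) -> ordge c.+2 (dv ix (H (u tt)) - dv ix (H (v tt))).
    move=> huv; rewrite -dvB; apply: dv_ordge; rewrite /H -scalerBr; apply: ordgeZ.
    have -> : u tt ^+ 2 + hf *: fps_comp E3 (rootp e (u tt)) -
       (v tt ^+ 2 + hf *: fps_comp E3 (rootp e (v tt))) =
       (u tt - v tt) * (u tt + v tt) +
       hf *: (fps_comp E3 (rootp e (u tt)) - fps_comp E3 (rootp e (v tt))).
      by rewrite scalerBr; ring.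
    apply: ordgeD.
      by rewrite -[c.+3]/(1 + 2 + c)%N addnAC add1n; apply: ordgeM => //; apply: ordgeD.
    apply: ordgeZ; apply: (@comp_ordge_diff _ _ c 3) => // j.
    + by apply: rootp1; apply: ordgeW ou.
    + by apply: rootp1; apply: ordgeW ov.
    rewrite /rootp; case: eqP => _; first by rewrite subrr.
    case: eqP => _; last by rewrite subrr.
    by rewrite opprD addrACA subrr add0r.
  case: d uv => [|d] uv; last exact: key.
  by apply: (@ordgeW _ _ 2) => //; apply: key; apply: ordgeB; [apply: ordgeW ou|apply: ordgeW ov].
- apply: (@tclosed_all n K unit (fun _ f => ordge 2 f /\ (nb q (q / 2%:R) f /\ fps_comp f onlyx = f))) => i.
  apply: kclosed_and; first exact: kclosed_ordge.
  apply: kclosed_and; first exact: nb_closed.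
  apply: (@kclosed_eq n K (fun f => fps_comp f onlyx) id 0) => f g d; rewrite addn0 // => h.
  by rewrite -compB //; apply: fps_comp_ordge.
exists (u tt); split; first exact: (hu tt).1.
  by exists q, (q / 2%:R); split=> //; exact: (hu tt).2.1.
have e1 : dv ix (H (u tt)) = u tt by rewrite -{2}eu.
have := Hd u hu; rewrite e1 => <-; rewrite /H scalerMnr mulrnDl; congr (_ *: (_ + _)).
by rewrite -scaler_nat scalerA divrr // scale1r.
Qed.

(** Every coordinate is replaced by the same series g, which makes this a one-variable inversion g =
    y - (a - x)(g, ..., g), solved by contraction. *)
Lemma gb_inverse (a : fps n K) : gb a -> ordge 2 (a - x) ->
  exists g, [/\ ordge 1 g, gb g & fps_comp a (fun _ => g) = y].
Proof.
move=> ha oR; pose Rr := a - x.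
have [r [B [r0 nR]]] : gb Rr by apply: (gbB hnu) => //; apply: (gbX hnu).
have B0 := nb_ge0 nR.
have [t [t0 t1 tB]] := @small_radius R B (r / 2%:R) B0 (divr_gt0 r0 (ltr0Sn _ _)).
pose q := t * r / 2%:R; have q0 : 0 < q by rewrite divr_gt0 // mulr_gt0.
have q0' := ltW q0.
have nR' : nb (q + q) q Rr.
  have -> : q + q = t * r by rewrite /q; field.
  apply: (nb_le hnu) (nb_ord hnu (ltW r0) (ltW t0) t1 oR nR) => //; first by rewrite mulr_ge0 // ltW.
  have -> : t ^+ 2 * B = t * (t * B) by ring.
  by rewrite /q -mulrA; apply: ler_wpM2l => //; rewrite ltW.
pose Pr (u : unit -> fps n K) := forall i, ordge 1 (u i) /\ nb q (q + q) (u i).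
have vp u : Pr u -> vanish_at0 (fun _ : 'I_n => u tt).
  by move=> hu j; apply: (hu tt).1; rewrite mdeg0.
have [||u v d hu hv uv i||u hu eu] := @krull_fix n K unit Pr
   (fun u _ => y - fps_comp Rr (fun _ => u tt)) (fun _ => 0).
- by move=> i; split=> //; apply: nb_zero; rewrite addr_ge0.
- move=> u hu i; split.
    apply: ordgeB; first exact: ordge_X.
    by apply: fps_comp_ordge; [exact: vp|exact: ordgeW oR].
  apply: (nbB hnu) => //; first exact: (nb_X hnu).
  by apply: (nb_comp hnu q0' (vp u hu) nR') => j; exact: (hu tt).2.
- have key c : ordge c.+1 (u tt - v tt) -> ordge c.+2
      (y - fps_comp Rr (fun _ => u tt) - (y - fps_comp Rr (fun _ => v tt))).
    move=> huv.
    have -> : y - fps_comp Rr (fun _ => u tt) - (y - fps_comp Rr (fun _ => v tt)) =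
      - (fps_comp Rr (fun _ => u tt) - fps_comp Rr (fun _ => v tt)) by ring.
    apply: ordgeN; apply: (@comp_ordge_diff _ _ c 2) => // j.
    + exact: (hu tt).1.
    + exact: (hv tt).1.
  case: d uv => [|d] uv; last exact: key.
  apply: (@ordgeW _ _ 2) => //; apply: key.
  by apply: ordgeB; [exact: (hu tt).1|exact: (hv tt).1].
- apply: (@tclosed_all n K unit (fun _ f => ordge 1 f /\ nb q (q + q) f)) => i.
  by apply: kclosed_and; [exact: kclosed_ordge|exact: nb_closed].
exists (u tt); split; first exact: (hu tt).1.
  by exists q, (q + q); split=> //; exact: (hu tt).2.
have e1 : y - fps_comp Rr (fun _ => u tt) = u tt by rewrite -{2}eu.
have -> : a = x + Rr by rewrite /Rr addrC subrK.
have vu := vp u hu; rewrite compD // compX // -{1}e1; ring.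
Qed.

End Majorants.

(** * Infinitesimal generators *)

Section LogFix.
Variables (n : nat) (A : comUnitRingType).
Implicit Types (f g h : fps n A) (V W : 'I_n -> fps n A).

Lemma vfBl V W f : vf_act V f - vf_act W f = vf_act (fun i => V i - W i) f.
Proof. by rewrite /vf_act -sumrB; apply: eq_bigr => i _; rewrite mulrBl. Qed.

Lemma vf_ordge_gen d e V f : (forall i, ordge d (V i)) -> ordge e.+1 f ->
  ordge (d + e)%N (vf_act V f).
Proof. by move=> hV hf; apply: ordge_sum => i _; apply: ordgeM => //; apply: deriv_ordge. Qed.

Lemma iter_diff d j V W f : (forall i, ordge 2 (V i)) -> (forall i, ordge 2 (W i)) ->
  (forall i, ordge d (V i - W i)) -> ordge 1 f ->
  ordge (d + j)%N (iter j.+1 (vf_act V) f - iter j.+1 (vf_act W) f).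
Proof.
move=> hV hW hd hf; elim: j => [|j IH]; first by rewrite /= vfBl; apply: vf_ordge_gen.
rewrite !(iterS j.+1); set u := iter _ _ f; set v := iter _ _ f.
have -> : vf_act V u - vf_act W v = vf_act V (u - v) + (vf_act V v - vf_act W v).
  by rewrite vfB; ring.
apply: ordgeD; first by rewrite addnS; apply: vf_ordge.
by rewrite vfBl; apply: vf_ordge_gen => //; exact: (iter_ordge hW (j := j.+1) hf).
Qed.

(** Passes from iterates to series in a derivation; applied both to the order of vanishing and to
    congruence modulo [crossf]^2. *)
Lemma op_diff_closed (P : fps n A -> Prop) V W c f g :
  (forall i, ordge 2 (V i)) -> (forall i, ordge 2 (W i)) ->
  kclosed P -> P 0 -> (forall u v, P u -> P v -> P (u + v)) -> (forall a u, P u -> P (a *: u)) ->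
  (forall j, P (iter j (vf_act V) f - iter j (vf_act W) g)) -> P (op V c f - op W c g).
Proof.
move=> hV hW hc h0 hD hZ hP; apply: hc => d.
exists (\sum_(j < d) c j *: (iter j (vf_act V) f - iter j (vf_act W) g)).
  by apply: big_ind => // j _; apply: hZ.
have -> : op V c f - op W c g - \sum_(j < d) c j *: (iter j (vf_act V) f - iter j (vf_act W) g)
  = (op V c f - \sum_(j < d) c j *: iter j (vf_act V) f) -
    (op W c g - \sum_(j < d) c j *: iter j (vf_act W) g).
  have -> : \sum_(j < d) c j *: (iter j (vf_act V) f - iter j (vf_act W) g) =
    \sum_(j < d) c j *: iter j (vf_act V) f - \sum_(j < d) c j *: iter j (vf_act W) g.
    by rewrite -sumrB; apply: eq_bigr => j _; rewrite scalerBr.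
  ring.
by apply: ordgeB; apply: op_ordge.
Qed.

(** The equation exp(V) = phi solved for the linear term of the exponential; its fixed points are
    the generators of phi. *)
Definition logPhi (phi V : 'I_n -> fps n A) (i : 'I_n) : fps n A :=
  phi i - fps_X A i - op V (fun j => j.+2`!%:R^-1) (iter 2 (vf_act V) (fps_X A i)).

Lemma logPhi_contr phi d V W i : (forall i, ordge 2 (V i)) -> (forall i, ordge 2 (W i)) ->
  (forall i, ordge d (V i - W i)) -> ordge d.+1 (logPhi phi V i - logPhi phi W i).
Proof.
move=> hV hW hd; rewrite /logPhi opprB addrC addrA subrK -opprB; apply: ordgeN.
apply: op_diff_closed => //.
- exact: kclosed_ordge.
- by move=> u v; apply: ordgeD.
- by move=> a u hu; rewrite scaleE; apply: ordgeMr.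
move=> j; rewrite -!iterD addn2.
apply: (@ordgeW _ _ (d + j.+1)); first by rewrite addnS ltnS leq_addr.
exact: (iter_diff hV hW hd (@ordge_X _ _ i)).
Qed.

Lemma logPhi_ord phi V i : (forall i, ordge 2 (V i)) -> ordge 2 (phi i - fps_X A i) ->
  ordge 2 (logPhi phi V i).
Proof.
move=> hV hp; apply: ordgeB => //; apply: op_ord => //.
by apply: (@ordgeW _ _ 3) => //; apply: (iter_ordge hV (j := 2) (@ordge_X _ _ i)).
Qed.

Lemma logPhi_fix phi V i : (forall i, ordge 2 (V i)) ->
  logPhi phi V i = V i <-> expv V (fps_X A i) = phi i.
Proof.
move=> hV; rewrite expv_split2g // vfX /logPhi; split=> h.
  by rewrite -{1}h; ring.
by rewrite -h; ring.
Qed.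

Lemma expv_uniq phi V W : (forall i, ordge 2 (V i)) -> (forall i, ordge 2 (W i)) ->
  (forall i, expv V (fps_X A i) = phi i) -> (forall i, expv W (fps_X A i) = phi i) ->
  forall i, V i = W i.
Proof.
move=> hV hW eV eW; have key d : forall i, ordge d (V i - W i).
  elim: d => // d IH i.
  have /(_ i) <- := fun i => (logPhi_fix phi i hV).2 (eV i).
  have /(_ i) <- := fun i => (logPhi_fix phi i hW).2 (eW i).
  exact: logPhi_contr.
by move=> i; apply: ordge_eq => d.
Qed.

(** V f is minus the sum of the terms V^j f / j! with j >= 2, whose order exceeds any order already
    known for V f. *)
Lemma expv_fixed V f : (forall i, ordge 2 (V i)) -> expv V f = f -> vf_act V f = 0.
Proof.
move=> hV ef; apply: ordge_ind => d hd.
have e2 : vf_act V f + op V (fun j => j.+2`!%:R^-1) (iter 2 (vf_act V) f) = 0.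
  by apply: (@addrI _ f); rewrite addr0 -expv_split2g.
rewrite -[vf_act V f](addrK (op V (fun j => j.+2`!%:R^-1) (iter 2 (vf_act V) f))) e2 sub0r.
by apply/ordgeN/op_ord => //=; apply: vf_ordge.
Qed.

End LogFix.

(** * The generator of the family modulo the square of [crossf] *)

Section LogFamily.
Variables (n : nat) (A : comUnitRingType).
Hypothesis hQ : forall j, (j.+1%:R : A) \is a GRing.unit.
Variables (ix iy : 'I_n) (hxy : ix != iy) (l : A).
Notation ff := (crossf A ix iy).
Notation Xb := (crossX A ix iy).
Notation phi := (pert_exp ix iy l).
Notation theta := (theta ix iy l).
Implicit Types (f g : fps n A) (V : 'I_n -> fps n A).

Definition inF2 f := exists q, f = ff ^+ 2 * q.

(** Being a multiple of [crossf]^2 amounts to being fixed by the operator that divides twice by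
    [crossf] and multiplies back, which is Krull continuous. *)
Lemma inF2_closed : kclosed inF2.
Proof.
have h : kclosed (fun f => ff ^+ 2 * divf ix iy (divf ix iy f) = f).
  apply: (@kclosed_eq n A (fun f => ff ^+ 2 * divf ix iy (divf ix iy f)) id 0) => f g d;
    rewrite addn0 // => fg.
  case: d fg => [|[|[|[|d]]]] fg; rewrite -mulrBr; try by apply/ordgeMl/(ordgeW _ (@ff4 n A ix iy)).
  rewrite -[d.+4]/(4 + d)%N; apply: ordgeM; first exact: ff4.
  by rewrite -!divfB //; do 2 apply: ordge_divf => //.
move=> f hf; exists (divf ix iy (divf ix iy f)); apply/esym/h => d.
have [g [q ->] fg] := hf d; exists (ff ^+ 2 * q) => //.
by rewrite expr2 -(mulrA ff ff q) !(divf_ffM hxy) mulrA.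
Qed.

Lemma inF2D f g : inF2 f -> inF2 g -> inF2 (f + g).
Proof. by move=> [p ->] [q ->]; exists (p + q); rewrite mulrDr. Qed.
Lemma inF2M f g : inF2 f -> inF2 (f * g).
Proof. by move=> [p ->]; exists (p * g); rewrite mulrA. Qed.
Lemma inF20 : inF2 0. Proof. by exists 0; rewrite mulr0. Qed.
Lemma inF2N f : inF2 f -> inF2 (- f).
Proof. by move=> [p ->]; exists (- p); rewrite mulrN. Qed.
Lemma inF2Z a f : inF2 f -> inF2 (a *: f).
Proof. by move=> h; rewrite scaleE mulrC; apply: inF2M. Qed.

Lemma inF2_phi i : inF2 (phi i - expv Xb (fps_X A i)).
Proof.
have vt := ordge_vanish (@theta1 n A ix iy l).
rewrite /pert_exp -[X in _ - X]comp_id; apply: comp_mod_ideal => //.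
- exact: inF2_closed.
- exact: inF20.
- exact: inF2D.
- by move=> f g; apply: inF2M.
- exact: vanish_X.
by move=> j; have [q ->] := @theta_diff n A ix iy l j; exists q.
Qed.

Lemma inF2_vf V f : (forall i, inF2 (V i - Xb i)) -> inF2 f -> inF2 (vf_act V f).
Proof.
move=> hV [q ->]; rewrite vfM; apply: inF2D; last by exists (vf_act V q).
apply: inF2M; rewrite -(subrK (vf_act Xb (ff ^+ 2)) (vf_act V _)); apply: inF2D.
  rewrite vfBl; apply: big_ind => [|u v|i _]; [exact: inF20|exact: inF2D|].
  by apply: inF2M.
rewrite expr2 vfM vf_Xb; exists (fps_deriv iy ff *+ 2); ring.
Qed.

Lemma inF2_iter V f j : (forall i, inF2 (V i - Xb i)) ->
  inF2 (iter j (vf_act V) f - iter j (vf_act Xb) f).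
Proof.
move=> hV; elim: j => [|j IH]; first by rewrite subrr; apply: inF20.
rewrite !iterS; set u := iter _ _ f; set v := iter _ _ f.
have -> : vf_act V u - vf_act Xb v = vf_act V (u - v) + (vf_act V v - vf_act Xb v).
  by rewrite vfB; ring.
apply: inF2D; first exact: inF2_vf.
rewrite vfBl; apply: big_ind => [|p q|i _]; [exact: inF20|exact: inF2D|].
by apply: inF2M.
Qed.

Lemma phi_ord2 i : ordge 2 (phi i - fps_X A i).
Proof.
have [q eq] := inF2_phi i; have hx := @Xb2 n A ix iy.
rewrite -(subrK (expv Xb (fps_X A i)) (phi i)) eq -addrA; apply: ordgeD.
  by apply/ordgeMl/(@ordgeW _ _ 4) => //; apply: ff4.
by rewrite expv_split addrC addKr; apply/ordgeMl/ff2.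
Qed.

(** [logPhi] preserves congruence to [crossX] modulo [crossf]^2, since phi is congruent to
    exp([crossX]), for which [crossX] itself is the fixed point. *)
Lemma log_phi_exists : exists V, [/\ forall i, ordge 2 (V i),
  forall i, inF2 (V i - Xb i) & forall i, expv V (fps_X A i) = phi i].
Proof.
have hx := @Xb2 n A ix iy.
pose Pr V := forall i, ordge 2 (V i) /\ inF2 (V i - Xb i).
have [||u v d hu hv uv i||V hV eV] := @krull_fix n A _ Pr (logPhi phi) Xb.
- by move=> i; split=> //; rewrite subrr; apply: inF20.
- move=> V hV i; have h2 j := (hV j).1; split; first by apply: logPhi_ord => //; apply: phi_ord2.
  have e2 : Xb i = expv Xb (fps_X A i) - fps_X A i -
      op Xb (fun j => j.+2`!%:R^-1) (iter 2 (vf_act Xb) (fps_X A i)).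
    by rewrite expv_split2g // vfX; ring.
  have -> : logPhi phi V i - Xb i = (phi i - expv Xb (fps_X A i)) -
     (op V (fun j => j.+2`!%:R^-1) (iter 2 (vf_act V) (fps_X A i)) -
      op Xb (fun j => j.+2`!%:R^-1) (iter 2 (vf_act Xb) (fps_X A i))).
    by rewrite e2 /logPhi; ring.
  apply: inF2D; first exact: inF2_phi.
  apply: inF2N; apply: op_diff_closed => //.
  + exact: inF2_closed.
  + exact: inF20.
  + exact: inF2D.
  + exact: inF2Z.
  by move=> j; rewrite -!iterD; apply: inF2_iter => k; exact: (hV k).2.
- by apply: logPhi_contr => // j; [exact: (hu j).1|exact: (hv j).1].
- apply: (@tclosed_all n A _ (fun i f => ordge 2 f /\ inF2 (f - Xb i))) => i.
  apply: kclosed_and; first exact: kclosed_ordge.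
  move=> f hf; apply: inF2_closed => d; have [g hg fg] := hf d; exists (g - Xb i) => //.
  by rewrite opprB addrA subrK.
exists V; split=> i; first exact: (hV i).1.
  exact: (hV i).2.
apply/logPhi_fix; first by move=> j; exact: (hV j).1.
by rewrite -{2}eV.
Qed.

End LogFamily.

(** * Linear parts *)

Section LinearPart.
Variables (n : nat) (A : comUnitRingType).
Implicit Types (f g : fps n A) (V : 'I_n -> fps n A).

Lemma mul_at0 f g : (f * g) 0%MM = f 0%MM * g 0%MM.
Proof.
have -> : f * g = (f - cst (f 0%MM)) * g + cst (f 0%MM) * g by ring.
rewrite fpsD fps_mulC_E; have -> : ((f - cst (f 0%MM)) * g) 0%MM = 0; last by rewrite add0r.
apply: (@ordgeMl _ _ 1); last by rewrite mdeg0.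
by apply/ordge1E; rewrite fpsB cstE eqxx mulr1 subrr.
Qed.

Lemma deriv_at0 i f : fps_deriv i f 0%MM = f U_(i)%MM.
Proof. by rewrite /fps_deriv mnm0E add0m. Qed.

Lemma mul_lin i f g :
  (f * g) U_(i)%MM = f U_(i)%MM * g 0%MM + f 0%MM * g U_(i)%MM.
Proof. by rewrite -!deriv_at0 derivM fpsD !mul_at0. Qed.

Lemma vf_lin V f j : vanish_at0 V ->
  vf_act V f U_(j)%MM = \sum_i f U_(i)%MM * linear_part V i j.
Proof.
move=> hV; rewrite /vf_act fps_sum; apply: eq_bigr => i _.
by rewrite mul_lin hV mul0r addr0 deriv_at0 mxE mulrC.
Qed.

Lemma iter_lin V i j p : vanish_at0 V ->
  iter p (vf_act V) (fps_X A i) U_(j)%MM = (linear_part V ^+ p) i j.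
Proof.
move=> hV; elim: p j => [|p IH] j.
  by rewrite expr0 /= mxE /fps_X eq_mnm1 eq_sym.
rewrite iterS vf_lin // exprSr mxE; apply: eq_bigr => k _.
by rewrite IH.
Qed.

Lemma linear_part1 (s : 'I_n -> fps n A) :
  (forall i, ordge 2 (s i - fps_X A i)) -> vanish_at0 s /\ linear_part s = 1%:M.
Proof.
move=> hs; split=> [i|].
  have := hs i 0%MM; rewrite fpsB mdeg0 => /(_ isT) /eqP; rewrite subr_eq0 => /eqP ->.
  by apply: (@ordge_X _ _ i); rewrite mdeg0.
apply/matrixP => i j; rewrite !mxE; have := hs i U_(j)%MM.
rewrite fpsB mdeg1 => /(_ isT) /eqP; rewrite subr_eq0 => /eqP ->.
by rewrite /fps_X eq_mnm1 eq_sym.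
Qed.

End LinearPart.

(** * Identification of the logarithm *)

Section Log.
Variables (n : nat) (K : numClosedFieldType).
Implicit Types (f g : fps n K) (V phi : 'I_n -> fps n K).

Lemma nat_unit (j : nat) : (j.+1%:R : K) \is a GRing.unit.
Proof. by rewrite unitfE pnatr_eq0. Qed.
Let hQ := nat_unit.

Lemma unipotent_id phi : (0 < n)%N ->
  (forall i, ordge 2 (phi i - fps_X K i)) -> unipotent phi.
Proof.
move=> n0 /linear_part1[v0 e1]; split; first by split=> //; rewrite e1 unitmx1.
move=> a; rewrite e1 /=; apply/eigenvalueP/eqP => [[v]|->].
  rewrite mulmx1 => /eqP; rewrite -subr_eq0 -{1}[v]scale1r -scalerBl scaler_eq0 subr_eq0.
  by move=> /orP[/eqP -> //|/eqP ->]; rewrite eqxx.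
exists (const_mx 1); first by rewrite mulmx1 scale1r.
by apply/negP => /eqP/matrixP/(_ ord0 (Ordinal n0))/eqP; rewrite !mxE oner_eq0.
Qed.

Lemma is_exp_expv V phi : (0 < n)%N -> (forall i, ordge 2 (V i)) ->
  (forall i, expv V (fps_X K i) = phi i) -> is_exp V phi.
Proof.
move=> n0 hV eV; split=> [|g d].
  apply: unipotent_id => // i; rewrite -eV expv_split2g // addrC addKr vfX.
  apply: ordgeD => //; apply: op_ord => //.
  by apply: (@ordgeW _ _ 3) => //; apply: (iter_ordge hV (j := 2) (@ordge_X _ _ i)).
have -> : fps_comp g phi = expv V g.
  by rewrite (expv_comp hV hQ); apply: comp_eq => i; rewrite eV.
exists d => N dN m md.
have := op_ordge hV (fun j => j`!%:R^-1) g (ltnSn (mdeg m)).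
have /(_ m (leq_trans md dN)) := op_ordge hV (fun j => j`!%:R^-1 : K) g (N := N).
by rewrite fpsB => /eqP; rewrite subr_eq0 => /eqP.
Qed.

(** If k > 1 is the least exponent with N^k = 0, multiplying the relation N + c_2 N^2 + ... = 0 by
    N^(k-2) gives N^(k-1) = 0, a contradiction. *)
Lemma nilp_exp1 (N : 'M[K]_n) k M (c : nat -> K) : N ^+ k = 0 -> c 0%N = 1 -> c 1%N = 1 ->
  (1 < M)%N -> \sum_(j < M) c j *: N ^+ j = 1%:M -> N = 0.
Proof.
move=> Nk c0 c1 M1.
have [//|N0] := eqVneq N 0.
have : exists k, N ^+ k == 0 by exists k; rewrite Nk.
move=> /ex_minnP[{Nk}k /eqP Nk hk].
have k1 : (1 < k)%N.
  case: k {hk} Nk => [|[|//]]; last by rewrite expr1 => /eqP; rewrite (negbTE N0).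
  by rewrite expr0 => h; move/eqP: N0; rewrite -[N]mulr1 h mulr0.
have zero j : (k <= j)%N -> N ^+ j = 0 by move=> kj; rewrite -(subnKC kj) exprD Nk mul0r.
case: M M1 => [|[|M]] // _; rewrite !big_ord_recl /= expr0 c0 /bump /= c1 scale1r expr1 scale1r.
move=> h; have {}h : N + \sum_(i < M) c i.+2 *: N ^+ i.+2 = 0.
  apply: (@addrI _ 1%:M); rewrite addr0 -[RHS]h; congr (_ + (_ + _)).
have : N ^+ (k - 2) * (N + \sum_(i < M) c i.+2 *: N ^+ i.+2) = 0 by rewrite h mulr0.
rewrite mulrDr -exprSr mulr_sumr big1 ?addr0 => [e|i _].
  have := hk (k - 2).+1; rewrite e eqxx => /(_ isT); lia.
rewrite -[LHS]scalemxAr; have -> : N ^+ (k - 2) *m N ^+ i.+2 = N ^+ (k - 2) * N ^+ i.+2 by [].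
by rewrite -exprD zero ?scaler0 //; lia.
Qed.

(** The specification of [log] only yields a nilpotent linear part, whereas the series in V are
    handled for order at least 2. Comparing linear parts closes this gap. *)
Lemma nilpotent_log_ord V phi : (forall i, ordge 2 (phi i - fps_X K i)) ->
  vf_nilpotent V -> is_exp V phi -> forall i, ordge 2 (V i).
Proof.
move=> hphi [v0 [k Nk]] [_ hexp].
have /choice[N0 hN0] : forall i, exists N0 : nat, forall N, (N0 <= N)%N -> forall m,
    (mdeg m < 2)%N -> (\sum_(j < N) (j`!%:R^-1 : K) *: iter j (vf_act V) (fps_X K i)) m = phi i m.
  move=> i; have [N0 h] := hexp (fps_X K i) 2%N; exists N0 => N hN m md; rewrite h // compX //.
  by have [] := linear_part1 hphi.
pose M := ((\max_i N0 i) + 2)%N.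
have eL : linear_part V = 0.
  apply: (@nilp_exp1 _ k M (fun j => j`!%:R^-1)) => //.
  - by rewrite fact0 invr1.
  - by rewrite (_ : 1`! = 1%N) // invr1.
  - by rewrite /M addn2.
  have [_ <-] := linear_part1 hphi; apply/matrixP => i j; rewrite summxE mxE -(hN0 i M).
  - by rewrite fps_sum; apply: eq_bigr => p _; rewrite mxE fpsZ iter_lin.
  - by apply: leq_trans (leq_addr _ _); apply: leq_bigmax.
  by rewrite mdeg1.
move=> i m; rewrite ltnS leq_eqVlt mdeg_eq1 => /orP[/existsP[j /eqP ->]|].
  by move/matrixP/(_ i j): eL; rewrite !mxE.
by rewrite ltnS leqn0 mdeg_eq0 => /eqP ->; apply: v0.
Qed.

Lemma expv_of_is_exp V phi : vanish_at0 phi -> (forall i, ordge 2 (V i)) -> is_exp V phi ->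
  forall i, expv V (fps_X K i) = phi i.
Proof.
move=> v0 hV [_ h] i; apply: ordge_eq => d; have [N0 hN] := h (fps_X K i) d.
have := op_ordge hV (fun j => j`!%:R^-1 : K) (fps_X K i) (N := (N0 + d)%N).
move=> /(ordgeW (leq_addl _ _)) hd m md.
have := hN (N0 + d)%N (leq_addr _ _) m md; rewrite compX // fpsB => <-.
by have := hd m md; rewrite fpsB.
Qed.

Lemma log_expv V phi : (0 < n)%N -> (forall i, ordge 2 (phi i - fps_X K i)) ->
  (forall i, ordge 2 (V i)) -> (forall i, expv V (fps_X K i) = phi i) -> log phi = V.
Proof.
move=> n0 hphi hV eV; have [v0 _] := linear_part1 hphi.
have hl : vf_nilpotent V /\ is_exp V phi.
  split; last exact: is_exp_expv.
  split; first by move=> i; apply: hV; rewrite mdeg0.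
  exists 1%N; rewrite expr1; apply/matrixP => i j; rewrite !mxE; apply: hV.
  by rewrite mdeg1.
rewrite /log; case: xgetP => [W _ [nW eW]|/(_ V)[] //].
have hW := nilpotent_log_ord hphi nW eW; apply/funext.
exact: (expv_uniq hW hV (expv_of_is_exp v0 hW eW) eV).
Qed.

End Log.

(** * Convergence of the restricted first integral *)

Section Rigidity.
Variables (n : nat) (K : comUnitRingType) (R : realFieldType) (nu : K -> R).
Hypothesis hnu : abs_val nu.
Hypothesis hQ : forall j, (j.+1%:R : K) \is a GRing.unit.
Variables (ix iy : 'I_n) (hxy : ix != iy).
Implicit Types (f g h : fps n K) (s : 'I_n -> fps n K).

Notation XX i := (fps_X K i : fps n K).
Notation x := (XX ix).
Notation y := (XX iy).
Notation gb := (gb nu).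
Notation ff := (crossf K ix iy).
Notation tup := ('I_n -> fps n K).

Let hyx : (iy == ix) = false. Proof. by rewrite eq_sym (negbTE hxy). Qed.

Lemma gb_ff : gb ff.
Proof.
apply: (gbM hnu); first exact: (gbX hnu).
by apply: (gbD hnu); [apply: (gbX hnu)|apply: (gbMn hnu); apply: (gbX hnu)].
Qed.

Lemma near_id_ordge1 s : (forall i, ordge 2 (s i - XX i)) -> forall i, ordge 1 (s i).
Proof.
move=> hs i; rewrite -(subrK (XX i) (s i)); apply: ordgeD; last exact: ordge_X.
exact: ordgeW (hs i).
Qed.

Lemma ffu_near s u : (forall i, ordge 2 (s i - XX i)) -> u 0%MM = 1 ->
  ordge 3 (fps_comp (ff * u) s - ff).
Proof.
move=> hs u0; have s1 := near_id_ordge1 hs; have vs := ordge_vanish s1.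
have f2 := @ff2 n K ix iy; rewrite compM //.
have -> : fps_comp ff s * fps_comp u s - ff =
  (fps_comp ff s - fps_comp ff (fps_X K)) * fps_comp u s + ff * (fps_comp u s - 1).
  by rewrite comp_id; ring.
apply: ordgeD.
  apply: ordgeMl; rewrite -[3%N]/(2 + 1)%N; apply: comp_ordge_diff => //.
  by move=> i; apply: ordge_X.
rewrite -[3%N]/(2 + 1)%N; apply: ordgeM => //.
by apply/ordge1E; rewrite fpsB comp_at0 // u0 fps1E eqxx subrr.
Qed.

Lemma near_id_comp s t : (forall i, ordge 2 (s i - XX i)) -> (forall i, ordge 2 (t i - XX i)) ->
  forall i, ordge 2 (fps_comp (s i) t - XX i).
Proof.
move=> hs ht i; have vt := ordge_vanish (near_id_ordge1 ht).
have -> : fps_comp (s i) t - XX i = fps_comp (s i - XX i) t + (t i - XX i).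
  by rewrite compB // compX //; ring.
by apply: ordgeD => //; apply: fps_comp_ordge.
Qed.

Lemma near_id_inv s t : vanish_at0 t -> (forall i, ordge 2 (s i - XX i)) ->
  (forall i, fps_comp (s i) t = XX i) -> forall i, ordge 2 (t i - XX i).
Proof.
move=> vt hs st i; have -> : t i - XX i = - fps_comp (s i - XX i) t.
  by rewrite compB // compX // st; ring.
by apply/ordgeN/fps_comp_ordge.
Qed.

(** A series with leading term c x_i is not a zero divisor. It decides which factor of [crossf]
    vanishes along a given curve. *)
Lemma near_x_regular i (c : K) r g : c \is a GRing.unit -> ordge 2 (r - c *: XX i) ->
  r * g = 0 -> g = 0.
Proof.
move=> uc hr rg; apply: ordge_ind => d hd m md.
have h : ordge (2 + d)%N (c *: (XX i * g)).
  have -> : c *: (XX i * g) = r * g - (r - c *: XX i) * g.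
    by rewrite mulrBl !scaleE; ring.
  by rewrite rg sub0r; apply/ordgeN/ordgeM.
have := h (m + U_(i))%MM; rewrite fpsZ fps_mulX_U mdegD mdeg1 addn1 add2n ltnS => /(_ md).
by move=> e; apply: (mulrI uc); rewrite e mulr0.
Qed.

Lemma comp_kap_eq H s t : vanish_at0 s -> vanish_at0 t -> fps_comp H (kap K ix iy) = H ->
  s ix = t ix -> s iy = t iy -> fps_comp H s = fps_comp H t.
Proof.
move=> vs vt hH ex ey; rewrite -hH; have vk := ordge_vanish (@kap1 n K ix iy).
rewrite !comp_comp //; apply: comp_eq => j; rewrite /kap.
case: eqP => [->|_] /=; first by rewrite !compX.
by case: eqP => [->|_]; rewrite ?compX // !comp0.
Qed.

(** * The case of a conjugation tangent to the identity *)

Section Core.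
Variables (Z sig tau : tup) (H : fps n K).
Let X : tup := fun i => crossX K ix iy i + ff ^+ 2 * Z i.
Hypotheses (hsig : forall i, ordge 2 (sig i - XX i)) (vtau : vanish_at0 tau).
Hypotheses (sigK : forall i, fps_comp (sig i) tau = XX i).
Hypotheses (tauK : forall i, fps_comp (tau i) sig = XX i).
Hypothesis gbY : forall j, gb (fps_comp (vf_act X (sig j)) tau).
Hypotheses (XH : vf_act X H = 0) (Hkap : fps_comp H (kap K ix iy) = H).
Hypothesis Hres : fps_comp H (res K iy) = x.

Let vsig : vanish_at0 sig. Proof. exact: ordge_vanish (near_id_ordge1 hsig). Qed.
Let htau : forall i, ordge 2 (tau i - XX i). Proof. exact: near_id_inv sigK. Qed.

(** The field X divided by [crossf], which is regular: d/dy plus a multiple of [crossf]. *)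
Let X0 : tup := fun i => (i == iy)%:R + ff * Z i.

Lemma vf_X0 f : vf_act X f = ff * vf_act X0 f.
Proof.
rewrite /vf_act mulr_sumr; apply: eq_bigr => i _; rewrite /X /X0 /crossX.
by case: eqP => _; rewrite ?mulr1n ?mulr0n; ring.
Qed.

Lemma vf_X0E f : vf_act X0 f = fps_deriv iy f + ff * vf_act Z f.
Proof.
rewrite /vf_act mulr_sumr -{1}[fps_deriv iy f]mul1r.
rewrite [RHS](_ : _ = \sum_i (i == iy)%:R * fps_deriv i f + \sum_i ff * (Z i * fps_deriv i f)).
  by rewrite -big_split /=; apply: eq_bigr => i _; rewrite /X0; ring.
congr (_ + _); rewrite (bigD1 iy) //= eqxx big1 ?addr0 // => i /negbTE ->.
by rewrite mul0r.
Qed.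

Let u j := vf_act X0 (sig j).

Lemma u_at0 j : u j 0%MM = (j == iy)%:R.
Proof.
have f0 : (ff : fps n K) 0%MM = 0 by apply: (@ff2 n K ix iy); rewrite mdeg0.
rewrite /u vf_X0E fpsD mul_at0 f0 mul0r addr0 -(subrK (XX j) (sig j)) derivD derivX fpsD.
rewrite (deriv_ordge iy (hsig j)) ?mdeg0 // add0r eq_sym.
by case: eqP => _; rewrite ?mulr1n ?mulr0n ?fps1E ?eqxx.
Qed.

Lemma rigidity_near_id : gb (fps_comp H (branch2 K ix iy)).
Proof.
have hQ2 : (2%:R : K) \is a GRing.unit by apply: hQ.
have [ui hui] : exists g, u iy * g = 1 by apply: fps_inv; rewrite u_at0 eqxx unitr1.
have ht := htau; have vs := vsig.
(* The push-forward of X0, rescaled to have y-component 1. Then A is the y-component of Y, hence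
   convergent, and W follows by [gb_div]. *)
pose W j := fps_comp (u j * ui) tau.
pose E0 := ff * u iy.
pose A3 := fps_comp E0 tau - ff.
have eY j : fps_comp (vf_act X (sig j)) tau = fps_comp E0 tau * W j.
  rewrite vf_X0 -compM //; congr fps_comp.
  transitivity (ff * u j * (u iy * ui)); first by rewrite hui mulr1.
  by rewrite /E0; move: (crossf _ _ _) => F; ring.
have Wy : W iy = 1 by rewrite /W hui comp1.
have gA : gb (fps_comp E0 tau) by rewrite -[X in gb X]mulr1 -Wy -eY.
have oA3 : ordge 3 A3 by apply: ffu_near => //; rewrite u_at0 eqxx.
have gW j : gb (W j).
  apply: (gb_div hnu hxy (A3 := A3) _ (gbY j) oA3).
    by apply: (gbB hnu) => //; apply: gb_ff.
  rewrite eY; congr (_ * _).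
  have -> : y ^+ 2 *+ 2 + x * y = ff by rewrite /crossf; ring.
  by rewrite /A3 addrC subrK.
(* As W has y-component 1, its flow from y = 0 with y as time rectifies it. *)
have [P [eP P1 gP]] := gb_flow hnu iy gW.
have vP := ordge_vanish P1.
have P2 j : ordge 2 (P j - XX j).
  rewrite eP; case: eqP => [->|/eqP jy].
    rewrite Wy comp1 // add0r; have -> : fps_int iy 1 = y; last by rewrite subrr.
    rewrite -(int_deriv hQ (i := iy) (f := y)) ?derivX ?eqxx //.
    by rewrite compX ?/res ?eqxx //; apply: res_vanish.
  rewrite addrAC subrr add0r; apply: int_ordge; apply: fps_comp_ordge => //.
  by apply/ordge1E; rewrite /W comp_at0 // mul_at0 u_at0 (negbTE jy) mul0r.
have dP j : fps_deriv iy (P j) = fps_comp (W j) P.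
  rewrite [in LHS]eP derivD deriv_int //; case: eqP => [_|/eqP jy].
    by rewrite deriv0 add0r.
  by rewrite derivX eq_sym (negbTE jy) add0r.
pose q i := fps_comp (tau i) P.
have q2 : forall i, ordge 2 (q i - XX i) by apply: near_id_comp.
have q1 := near_id_ordge1 q2; have vq := ordge_vanish q1.
(* The map q leads from the rectified coordinates to the original ones, where d/dy corresponds to X0
   divided by u iy. It is only formal, but [E] below is convergent, being A in the rectified
   coordinates. *)
have dq g : fps_deriv iy (fps_comp g q) = fps_comp (ui * vf_act X0 g) q.
  have qE h : fps_comp h q = fps_comp (fps_comp h tau) P by rewrite comp_comp.
  have eg : fps_comp (fps_comp g tau) sig = g.
    by rewrite comp_comp // -[RHS]comp_id; apply: comp_eq => i; rewrite tauK.
  rewrite !qE chain_rule // -{2}eg vf_comp // mulr_sumr comp_sum // comp_sum //.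
  apply: eq_bigr => j _; rewrite dP -compM //; congr fps_comp.
  rewrite /W !compM // !comp_comp //.
  have -> : fps_comp (fps_deriv j (fps_comp g tau)) (fun i => fps_comp (sig i) tau) =
      fps_deriv j (fps_comp g tau).
    by rewrite -[RHS]comp_id; apply: comp_eq.
  by rewrite mulrA [LHS]mulrC.
pose E := fps_comp E0 q.
have gE : gb E.
  have -> : E = fps_comp (fps_comp E0 tau) P by rewrite comp_comp.
  exact: (gb_comp hnu).
pose E3 := E - ff.
have oE3 : ordge 3 E3 by apply: ffu_near => //; rewrite u_at0 eqxx.
have gE3 : gb E3 by apply: (gbB hnu) => //; apply: gb_ff.
have EE : E = ff + E3 by rewrite /E3 addrC subrK.
(* the curves E = 0 in the plane z = 0, parametrized by x *)
have root e : exists p : tup, [/\ ordge 2 (p iy - (if e then x else 0)), vanish_at0 p, forall j, gb (p j),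
    fps_comp E p = 0 & forall j, j != iy -> p j = (if j == ix then - (x *+ 2) else 0)].
  have [v [v2 gv ev]] := gb_root hnu hQ ix iy e gE3 oE3.
  have py : rootp ix iy e v iy = (if e then x else 0) + v by rewrite /rootp hyx eqxx.
  have px : rootp ix iy e v ix = - (x *+ 2) by rewrite /rootp eqxx.
  have vp : vanish_at0 (rootp ix iy e v).
    by apply: ordge_vanish => j; apply: rootp1; apply: ordgeW v2.
  exists (rootp ix iy e v); split=> //.
  - by rewrite py addrAC subrr add0r.
  - move=> j; rewrite /rootp; case: eqP => _.
      by apply: (gbN hnu); apply: (gbMn hnu); apply: (gbX hnu).
    case: eqP => _; last exact: (gb0 _ hnu).
    by apply: (gbD hnu) => //; case: (e); [apply: (gbX hnu)|apply: (gb0 _ hnu)].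
  - rewrite EE compD //.
    have -> : fps_comp ff (rootp ix iy e v) =
        rootp ix iy e v iy * (rootp ix iy e v ix + rootp ix iy e v iy *+ 2).
      by rewrite compM // compD // compMn // !compX.
    rewrite px py; case: (e) ev => /=.
      rewrite expr1 scaleN1r => ev.
      have -> : (x + v) * (- (x *+ 2) + (x + v) *+ 2) = (x * v) *+ 2 + v ^+ 2 *+ 2 by ring.
      by rewrite ev; ring.
    rewrite expr0 scale1r add0r => ev.
    have -> : v * (- (x *+ 2) + v *+ 2) = v ^+ 2 *+ 2 - (x * v) *+ 2 by ring.
    by rewrite ev; ring.
  by move=> j jy; rewrite /rootp (negbTE jy).
have [p0 [p0y vp0 gp0 Ep0 p0j]] := root false.
have [p1 [p1y vp1 gp1 Ep1 p1j]] := root true.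
have p0x : p0 ix = - (x *+ 2) by rewrite p0j ?eqxx.
have qpo s i : vanish_at0 s -> ordge 2 (fps_comp (q i) s - s i).
  move=> vs'; have -> : fps_comp (q i) s - s i = fps_comp (q i - XX i) s.
    by rewrite compB // compX.
  exact: fps_comp_ordge.
have f0 s : vanish_at0 s -> fps_comp E s = 0 ->
    fps_comp (q iy) s * (fps_comp (q ix) s + fps_comp (q iy) s *+ 2) = 0.
  move=> vs' es; have : fps_comp E s * fps_comp (fps_comp ui q) s = 0 by rewrite es mul0r.
  rewrite -compM // /E -compM // /E0 -mulrA hui mulr1.
  by rewrite compM // compD // compMn // !compX // compM // compD // compMn.
(* The product of the two factors of [crossf] vanishes along q o p0, and x + 2 y has leading term -
   2 x there; so the factor y is the one that vanishes. For p1 the roles are exchanged. *)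
have a0 : fps_comp (q iy) p0 = 0.
  apply: (@near_x_regular ix (- 2%:R) (fps_comp (q ix) p0 + fps_comp (q iy) p0 *+ 2)).
  - by rewrite unitrN.
  - rewrite scaleNr scaler_nat -p0x.
    have -> : fps_comp (q ix) p0 + fps_comp (q iy) p0 *+ 2 - p0 ix =
      (fps_comp (q ix) p0 - p0 ix) + (fps_comp (q iy) p0 - p0 iy) *+ 2 + (p0 iy - 0) *+ 2 by ring.
    have o2 f : ordge 2 f -> ordge 2 (f *+ 2) by move=> h; rewrite mulr2n; apply: ordgeD.
    by apply: ordgeD; [apply: ordgeD; [apply: qpo|apply/o2/qpo]|apply: o2].
  by rewrite mulrC; apply: f0.
have a1 : fps_comp (q ix) p1 = - (fps_comp (q iy) p1 *+ 2).
  apply/eqP; rewrite -addr_eq0; apply/eqP.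
  apply: (@near_x_regular ix 1 (fps_comp (q iy) p1)); rewrite ?unitr1 //; last exact: f0.
  rewrite scale1r; have -> : fps_comp (q iy) p1 - x =
    (fps_comp (q iy) p1 - p1 iy) + (p1 iy - x) by ring.
  by apply: ordgeD; [apply: qpo|].
pose a := fps_comp (q iy) p1; pose b := fps_comp (q ix) p0.
have oa : ordge 2 (a - x).
  have -> : a - x = (a - p1 iy) + (p1 iy - x) by ring.
  by apply: ordgeD; [apply: qpo|].
(* d/dy of [crossf] is x + 4 y, and the unit u cancels modulo [crossf]. The value is x on y = 0 and
   2 y on x + 2 y = 0, so the convergent series dE/dy gives access to b and a. *)
have dE : exists r, fps_deriv iy E = q ix + q iy *+ 4 + fps_comp ff q * r.
  exists (fps_comp (ui * (vf_act X0 (u iy)) + vf_act Z ff) q).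
  have -> : fps_deriv iy E = fps_comp (ui * vf_act X0 E0) q by apply: dq.
  have -> : ui * vf_act X0 E0 = x + y *+ 4 + ff * (ui * vf_act X0 (u iy) + vf_act Z ff).
    rewrite /E0 vfM vf_X0E.
    have -> : fps_deriv iy ff = x + y *+ 4.
      rewrite derivM derivD !mulr2n derivD !derivX eqxx eq_sym (negbTE hxy).
      by rewrite mulr1n mulr0n; ring.
    transitivity ((u iy * ui) * (x + y *+ 4 + ff * vf_act Z ff) + ff * (ui * vf_act X0 (u iy))).
      by move: (crossf _ _ _) (vf_act _ _) (vf_act _ _) => F D1 D2; ring.
    by rewrite hui mul1r mulrDr; ring.
  by rewrite compD // compD // compMn // !compX // compM.
have [r dEr] := dE.
have ffq s : vanish_at0 s -> fps_comp E s = 0 -> fps_comp (fps_comp ff q) s = 0.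
  move=> vs' es; rewrite -[RHS](f0 s vs' es).
  by rewrite compM // compD // compMn // !compX // compM // compD // compMn.
have gb_b : gb b.
  have -> : b = fps_comp (fps_deriv iy E) p0.
    rewrite dEr compD // compD // compMn // compM // ffq // mul0r addr0 a0 mul0rn addr0 //.
  by apply: (gb_comp hnu) => //; apply: (gb_deriv hnu).
have gb_a : gb a.
  have -> : a = (2%:R)^-1 *: fps_comp (fps_deriv iy E) p1.
    rewrite dEr compD // compD // compMn // compM // ffq // mul0r addr0 a1 -/a.
    have -> : - (a *+ 2) + a *+ 4 = a *+ 2 by ring.
    by rewrite -scaler_nat scalerA mulVr // scale1r.
  by apply: (gbZ hnu); apply: (gb_comp hnu) => //; apply: (gb_deriv hnu).
have X0H : vf_act X0 H = 0 by apply: (ff_eq0 hxy); rewrite -vf_X0.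
have dHq : fps_deriv iy (fps_comp H q) = 0 by rewrite dq X0H mulr0 comp0.
(* p0 and p1 differ in the y-coordinate only: they lie on the same leaf. *)
have Hq : fps_comp (fps_comp H q) p0 = fps_comp (fps_comp H q) p1.
  by apply: (deriv0_comp hQ dHq) => j jy; rewrite p0j // p1j.
have va : vanish_at0 (fun _ : 'I_n => a).
  by move=> j; rewrite /a comp_at0 // vq.
have vio := ordge_vanish (@io21 n K ix iy).
(* At (b, 0) the value of H is b by [Hres]; at (- 2 a, a) it is the restriction of H to the second
   line, evaluated at a. Inverting a then isolates this restriction. *)
have eb : b = fps_comp (fps_comp H (branch2 K ix iy)) (fun _ => a).
  transitivity (fps_comp H (fun i => fps_comp (q i) p1)).
    rewrite -comp_comp // -Hq comp_comp //.
    have vb : vanish_at0 (fun i => fps_comp (q i) p0) by apply: vanish_comp.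
    rewrite (comp_kap_eq (t := fun i => if i == iy then 0 else fps_comp (q i) p0)) //.
    - have -> : fps_comp H (fun i => if i == iy then 0 else fps_comp (q i) p0) =
         fps_comp (fps_comp H (res K iy)) (fun i => fps_comp (q i) p0).
        rewrite comp_comp //; last exact: res_vanish.
        by apply: comp_eq => i; rewrite /res; case: eqP => _; rewrite ?comp0 ?compX.
      by rewrite Hres compX.
    - by move=> i; case: eqP => _ //; apply: vb.
    - by rewrite (negbTE hxy).
    by rewrite eqxx a0.
  rewrite comp_comp //; apply: comp_kap_eq => //.
  - exact: vanish_comp.
  - exact: vanish_comp.
  - by rewrite a1 /branch2 eqxx compN // compMn // compX.
  by rewrite /branch2 hyx compX.
have [g [g1 gg eg]] := gb_inverse hnu iy gb_a oa.
have vg : vanish_at0 (fun _ : 'I_n => g) by move=> j; apply: g1; rewrite mdeg0.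
have -> : fps_comp H (branch2 K ix iy) = fps_comp b (fun _ => g).
  rewrite eb comp_comp //.
  have vy : vanish_at0 (fun _ : 'I_n => y) by move=> j; apply: (@ordge_X _ _ iy); rewrite mdeg0.
  transitivity (fps_comp (fps_comp H (branch2 K ix iy)) (fun _ => y)); last first.
    by apply: comp_eq => j; rewrite eg.
  rewrite comp_comp //; apply: comp_kap_eq => //.
  - exact: vanish_comp.
  - by rewrite /branch2 eqxx compN // compMn // compX.
  by rewrite /branch2 hyx compX.
by apply: (gb_comp hnu).
Qed.

End Core.

(** A linear change of coordinates in the target makes the conjugation tangent to the identity and
    keeps the image field convergent. *)
Lemma rigidity (Z sig tau : tup) (H : fps n K) (X : tup) :
  (forall i, X i = crossX K ix iy i + ff ^+ 2 * Z i) ->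
  vanish_at0 sig -> linear_part sig \in unitmx -> vanish_at0 tau ->
  (forall i, fps_comp (sig i) tau = XX i) -> (forall i, fps_comp (tau i) sig = XX i) ->
  (forall j, gb (fps_comp (vf_act X (sig j)) tau)) ->
  vf_act X H = 0 -> fps_comp H (kap K ix iy) = H -> fps_comp H (res K iy) = x ->
  gb (fps_comp H (branch2 K ix iy)).
Proof.
move=> /funext eX vs us vt sK tK gY XH Hk Hr.
pose S := linear_part sig; pose B := invmx S.
pose lin (M : 'M[K]_n) : tup := fun i => \sum_j M i j *: XX j.
have vlin M : vanish_at0 (lin M).
  apply: ordge_vanish => i; apply: ordge_sum => j _; rewrite scaleE; apply: ordgeMr.
  exact: ordge_X.
have lin_comp (M : 'M[K]_n) s i : vanish_at0 s -> fps_comp (lin M i) s = \sum_j M i j *: s j.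
  by move=> hs; rewrite comp_sum //; apply: eq_bigr => j _; rewrite compZ // compX.
have linM (M N : 'M[K]_n) i : \sum_j M i j *: lin N j = lin (M *m N) i.
  rewrite /lin; under eq_bigr do rewrite scaler_sumr.
  rewrite exchange_big /=; apply: eq_bigr => k _; rewrite mxE scaler_suml.
  by apply: eq_bigr => j _; rewrite scalerA.
have lin1 i : lin 1%:M i = XX i.
  rewrite /lin (bigD1 i) //= big1 ?addr0 => [|j ji]; first by rewrite mxE eqxx scale1r.
  by rewrite mxE eq_sym (negbTE ji) scale0r.
pose sig' i := \sum_j B i j *: sig j.
pose tau' i := fps_comp (tau i) (lin S).
have vs' : vanish_at0 sig'.
  move=> i; rewrite /sig' fps_sum big1 // => j _; by rewrite fpsZ vs mulr0.
have vt' : vanish_at0 tau' by apply: vanish_comp.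
apply: (@rigidity_near_id Z sig' tau' H) => //.
- move=> i m; rewrite ltnS leq_eqVlt mdeg_eq1 => /orP[/existsP[j /eqP ->]|].
    rewrite fpsB; have /matrixP/(_ i j) : B *m S = 1%:M by rewrite mulVmx.
    rewrite !mxE /sig' fps_sum => e; rewrite /fps_X eq_mnm1 eq_sym -e.
    apply/eqP; rewrite subr_eq0; apply/eqP; apply: eq_bigr => k _.
    by rewrite fpsZ mxE.
  rewrite ltnS leqn0 mdeg_eq0 => /eqP ->; rewrite fpsB vs' sub0r.
  by apply/eqP; rewrite oppr_eq0; apply/eqP; apply: (@ordge_X _ _ i); rewrite mdeg0.
- move=> i; rewrite /sig' comp_sum //.
  have e j : fps_comp (B i j *: sig j) tau' = B i j *: lin S j.
    by rewrite compZ // /tau' -comp_comp // sK compX.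
  by rewrite (eq_bigr _ (fun j _ => e j)) linM mulVmx // lin1.
- move=> i; rewrite /tau' comp_comp // -[RHS]tK; apply: comp_eq => j.
  rewrite lin_comp // /sig'.
  transitivity (fps_comp (\sum_k S j k *: lin B k) sig).
    rewrite comp_sum //; apply: eq_bigr => k _; rewrite compZ //; congr (_ *: _).
    by rewrite lin_comp.
  by rewrite linM mulmxV // lin1 compX.
- rewrite -eX => j; have -> : fps_comp (vf_act X (sig' j)) tau' =
      \sum_k B j k *: fps_comp (fps_comp (vf_act X (sig k)) tau) (lin S).
    rewrite /sig' vf_sum comp_sum //; apply: eq_bigr => k _.
    by rewrite vfZ compZ // comp_comp.
  apply: (gb_sum hnu) => k _; apply: (gbZ hnu); apply: (gb_comp hnu) => // i.
  by rewrite /lin; apply: (gb_sum hnu) => r _; apply: (gbZ hnu); apply: (gbX hnu).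
by rewrite -eX.
Qed.

End Rigidity.

(** * Convergence of the family *)

Section Exponential.
Variables (n : nat) (K : comUnitRingType) (R : realFieldType) (nu : K -> R).
Hypothesis hnu : abs_val nu.
Hypothesis hQ : forall j, (j.+1%:R : K) \is a GRing.unit.
Variables (ix iy : 'I_n) (hxy : ix != iy).
Implicit Types (f g h : fps n K) (m k : 'X_{1..n}) (r B : R).

Notation XX i := (fps_X K i : fps n K).
Notation x := (XX ix).
Notation y := (XX iy).
Notation nb := (nb nu).
Notation ff := (crossf K ix iy).
Notation Xb := (crossX K ix iy).

Definition hom d f := forall k, mdeg k != d -> f k = 0.

Lemma homM d e f g : hom d f -> hom e g -> hom (d + e) (f * g).
Proof.
move=> hf hg k hk; rewrite [LHS]big1 // => p /eqP ep.
have [pd|pd] := eqVneq (mdeg p.1) d; last by rewrite hf ?mul0r.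
rewrite hg ?mulr0 //; apply: contra hk => /eqP pe.
by rewrite ep mdegD pd pe.
Qed.

Lemma hom_X i : hom 1 (XX i).
Proof. by move=> k; rewrite /fps_X; case: (eqVneq k U_(i)%MM) => [->|_]; rewrite ?mdeg1. Qed.

Lemma homD d f g : hom d f -> hom d g -> hom d (f + g).
Proof. by move=> hf hg k hk; rewrite fpsD hf // hg // addr0. Qed.

Lemma hom_deriv d i f : hom d.+1 f -> hom d (fps_deriv i f).
Proof. by move=> hf k hk; rewrite /fps_deriv hf ?mul0rn // mdegD mdeg1 addn1. Qed.

Lemma hom_ff : hom 2 ff.
Proof.
apply: (@homM 1 1); first exact: hom_X.
by rewrite mulr2n; do 2 (apply: homD; first exact: hom_X); apply: hom_X.
Qed.

(** On homogeneous series differentiation costs at most the degree, with no loss of radius; the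
    halving in [nb_deriv] could not be iterated. *)
Lemma nb1_deriv d i f B : hom d.+1 f -> nb 1 B f -> nb 1 (d.+1%:R * B) (fps_deriv i f).
Proof.
move=> hf hB s us; apply: (@le_trans _ _ (d.+1%:R * \sum_(k <- s) nu (dv i f k) * 1 ^+ mdeg k)).
  rewrite mulr_sumr; apply: ler_sum => k _; rewrite expr1n !mulr1.
  have -> : fps_deriv i f k = dv i f k *+ (k i).+1 by [].
  rewrite (nuMn hnu) -[X in X <= _]mulr_natl.
  have [kd|kd] := eqVneq (mdeg k) d; last first.
    by rewrite /dv hf ?(nu0 hnu) ?mul0rn ?mulr0 // mdegD mdeg1 addn1.
  apply: ler_wpM2r; first exact: (nu_ge0 hnu).
  by rewrite ler_nat ltnS -kd mdegE (bigD1 i) //= leq_addr.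
apply: ler_wpM2l; first exact: ler0n.
have := nb_dv i ltr01 hB; rewrite divr1 => h; exact: h.
Qed.

Lemma nb1_ff : nb 1 3%:R ff.
Proof.
have -> : 3%:R = 1 * (1 + 1 *+ 2) :> R by ring.
apply: (nbM hnu) => //; first exact: (nb_X hnu).
by apply: (nbD hnu) => //; [|apply: (nbMn hnu)]; apply: (nb_X hnu).
Qed.

(** Each application of f d/dy multiplies the norm at radius 1 by at most the degree j + 1 and the
    norm 3 of f. *)
Lemma iter_Xb_bound j : hom j.+1 (iter j (vf_act Xb) y) /\
  nb 1 (3%:R ^+ j * j`!%:R) (iter j (vf_act Xb) y).
Proof.
elim: j => [|j [hh hb]]; first by split; [exact: hom_X|rewrite expr0 mul1r; exact: (nb_X hnu)].
rewrite iterS vf_Xb; split.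
  by rewrite -[j.+2]/(2 + j)%N; apply: homM; [exact: hom_ff|exact: hom_deriv].
have -> : 3%:R ^+ j.+1 * j.+1`!%:R = 3%:R * (j.+1%:R * (3%:R ^+ j * j`!%:R)) :> R.
  by rewrite exprS factS natrM; ring.
by apply: (nbM hnu) => //; [exact: nb1_ff|exact: nb1_deriv].
Qed.

Lemma nb_hom r d f B : 0 <= r -> hom d f -> nb 1 B f -> nb r (r ^+ d * B) f.
Proof.
move=> r0 hf hB s us; apply: le_trans (ler_wpM2l (exprn_ge0 d r0) (hB s us)).
rewrite mulr_sumr; apply: ler_sum => k _; rewrite expr1n mulr1.
have [<-|kd] := eqVneq (mdeg k) d; first by rewrite mulrC.
by rewrite hf // (nu0 hnu) mul0r mulr0.
Qed.

Lemma gb_expv_y : gb nu (expv Xb y).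
Proof.
(* The terms of the exponential are bounded by r (3 r)^j; 3 r = 1/2 makes them geometric. *)
have hx := @Xb2 n K ix iy; pose r : R := 6%:R^-1.
have r0 : 0 < r by rewrite invr_gt0 ltr0n.
exists r, 1; split=> //; apply: nb_closed => N.
exists (\sum_(j < N) (j`!%:R^-1 : K) *: iter j (vf_act Xb) y); last exact: op_ordge.
apply: (nb_le hnu (B := 1 - 2%:R^-1 ^+ N) (ltW r0) (lexx r)).
  by rewrite gerBl exprn_ge0 // invr_ge0 ler0n.
elim: N => [|N IH]; first by rewrite big_ord0 expr0 subrr; apply: (nb0 hnu).
rewrite big_ord_recr /=.
apply: (nb_le hnu (B := (1 - 2%:R^-1 ^+ N) + nu (N`!%:R^-1) *
   (r ^+ N.+1 * (3%:R ^+ N * N`!%:R))) (ltW r0) (lexx r)); last first.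
  apply: (nbD hnu) => //; first exact: ltW.
  by apply: (nbZ hnu); have [h1 h2] := iter_Xb_bound N; apply: nb_hom => //; exact: ltW.
have e1 : nu (N`!%:R^-1) * N`!%:R = 1.
  rewrite -[X in _ * X]mulr1 mulr_natl -(nu1 hnu) -(nuMn hnu).
  by rewrite -(nuM hnu) mulVr ?(nu1 hnu) // fact_unit.
have -> : nu (N`!%:R^-1) * (r ^+ N.+1 * (3%:R ^+ N * N`!%:R)) =
   (nu (N`!%:R^-1) * N`!%:R) * (r * (r * 3%:R) ^+ N) by rewrite exprS exprMn; ring.
rewrite e1 mul1r exprS.
have -> : r * 3%:R = 2%:R^-1 by rewrite /r; field.
have p0 : 0 <= (2%:R^-1 : R) ^+ N by rewrite exprn_ge0 // invr_ge0 ler0n.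
rewrite /r; move: (_ ^+ N) p0 => p p0; lra.
Qed.

Lemma expv_const (V : 'I_n -> fps n K) f : (forall i, ordge 2 (V i)) ->
  vf_act V f = 0 -> expv V f = f.
Proof.
move=> hV hf; rewrite expv_split2g //= hf vf0.
by have := opB V (fun j => j.+2`!%:R^-1) 0 0; rewrite !subrr => ->; rewrite !addr0.
Qed.

Lemma expv_X i : i != iy -> expv Xb (XX i) = XX i.
Proof.
by move=> h; apply: expv_const; [exact: Xb2|rewrite vfX /crossX (negbTE h)].
Qed.

Lemma gb_phi (l : K) i : gb nu (pert_exp ix iy l i).
Proof.
have gf : gb nu (ff ^+ 2) by apply: (gbXn hnu); apply: gb_ff.
apply: (gb_comp hnu).
- exact: ordge_vanish (@theta1 n K ix iy l).
- have [->|iy'] := eqVneq i iy; first exact: gb_expv_y.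
  by rewrite expv_X //; apply: (gbX hnu).
move=> j; rewrite /theta; case: eqP => _; last case: eqP => _; last exact: (gbX hnu).
  by apply: (gbD hnu); [apply: (gbX hnu)|apply: (gbZ hnu)].
by apply: (gbD hnu); [apply: (gbX hnu)|apply: (gbZ hnu)].
Qed.

End Exponential.

(** * Weighted norms and convergence over the complex numbers *)

Section ComplexNorm.
Variable R : rcfType.
Notation C := (complex R).
Notation normc := (@ComplexField.Normc.normc R).

Lemma normc_real (a : R) : normc a%:C%C = `|a|.
Proof. by rewrite /normc /= expr0n /= addr0 sqrtr_sqr. Qed.

Lemma norm_normc (z : C) : `|z| = (normc z)%:C%C.
Proof. by []. Qed.

Lemma normc_abs_val : abs_val normc.
Proof.
split.
- by move=> [a b]; rewrite /normc sqrtr_ge0.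
- exact: ComplexField.Normc.normc0.
- exact: ComplexField.Normc.normc1.
- exact: le_normcD.
- exact: ComplexField.Normc.normcM.
- exact: normcN.
- by move=> a j; exact: normcMn.
move=> j; rewrite ComplexField.Normc.normcV invf_le1.
  by rewrite -[1]ComplexField.Normc.normc1 normcMn ComplexField.Normc.normc1 ler1n.
by rewrite normcMn ComplexField.Normc.normc1 ltr0n.
Qed.

Variable n : nat.
Implicit Types f : fps n C.

Lemma convergent_gb f : convergent f -> gb normc f.
Proof.
move=> [r r0 h]; have [r1 er] : exists r1, r = r1%:C%C by apply/complex_realP/gtr0_real.
move: r0; rewrite er ltcR => r10; pose q := r1 / 2%:R.
have q0 : 0 < q by rewrite divr_gt0.
have qr : q < r1 by rewrite /q; lra.
(* At a diagonal point every monomial of degree d has modulus q^d, so absolute convergence there is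
   a bound of the weighted norm. *)
have [|M hM] := h (fun _ => q%:C%C).
  by move=> i; rewrite norm_normc normc_real er ltcR gtr0_norm.
have M0 : 0 <= M by apply: le_trans (hM 0%N); apply: sumr_ge0 => k _; apply: normr_ge0.
have [M1 eM] : exists M1, M = M1%:C%C by apply/complex_realP/ger0_real.
exists q, M1; split=> //; apply: (nb_of_bm normc_abs_val); first exact: ltW.
move=> d; have := hM d; rewrite eM; congr (is_true _).
rewrite -lecR rmorph_sum; congr (_ <= _); apply: eq_bigr => k _.
rewrite normrM !norm_normc -rmorphM /=; congr (_ * _)%:C%C.
rewrite (eq_bigr (fun i => (q ^+ k i)%:C%C)); last by move=> i _; rewrite rmorphXn.
rewrite -rmorph_prod; rewrite normc_real prodrXr -mdegE ger0_norm // exprn_ge0 //.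
exact: ltW.
Qed.

Lemma gb_convergent f : gb normc f -> convergent f.
Proof.
move=> [r [B [r0 h]]]; exists r%:C%C; first by rewrite ltcR.
move=> z hz; exists B%:C%C => d.
apply: le_trans (_ : (\sum_(k : 'X_{1..n < d}) normc (f k) * r ^+ mdeg k)%:C%C <= _); last first.
  by rewrite lecR; apply: nb_bm.
rewrite rmorph_sum; apply: ler_sum => k _; rewrite normrM rmorphM /= norm_normc.
apply: ler_wpM2l; first by rewrite lecR (nu_ge0 normc_abs_val).
rewrite normr_prod mdegE -prodrXr rmorph_prod; apply: ler_prod => i _.
rewrite normr_ge0 normrX rmorphXn /=; apply: lerXn2r; rewrite ?nnegrE ?normr_ge0 ?lecR //.
  exact: ltW.
by apply: ltW; rewrite -ltcR; exact: hz.
Qed.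

End ComplexNorm.

(** * Dependence on the parameter *)

Section MapRing.
Variables (n : nat) (A B : comUnitRingType) (rho : {rmorphism A -> B}).
Hypothesis hQ : forall j, (j.+1%:R : A) \is a GRing.unit.
Variables (ix iy : 'I_n).
Implicit Types (f g : fps n A) (V s : 'I_n -> fps n A).

Definition mapf f : fps n B := fun m => rho (f m).

Lemma mapfD f g : mapf (f + g) = mapf f + mapf g.
Proof. by apply/funext => m; rewrite /mapf !fpsD rmorphD. Qed.
Lemma mapfB f g : mapf (f - g) = mapf f - mapf g.
Proof. by apply/funext => m; rewrite /mapf !fpsB rmorphB. Qed.
Lemma mapf0 : mapf 0 = 0.
Proof. by apply/funext => m; rewrite /mapf rmorph0. Qed.
Lemma mapf1 : mapf 1 = 1.
Proof. by apply/funext => m; rewrite /mapf !fps1E rmorph_nat. Qed.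
Lemma mapfZ a f : mapf (a *: f) = rho a *: mapf f.
Proof. by apply/funext => m; rewrite /mapf !fpsZ rmorphM. Qed.
Lemma mapfMn f j : mapf (f *+ j) = mapf f *+ j.
Proof. by apply/funext => m; rewrite /mapf !fpsMn rmorphMn. Qed.
Lemma mapfM f g : mapf (f * g) = mapf f * mapf g.
Proof.
apply/funext => m; rewrite /mapf [LHS]rmorph_sum; apply: eq_bigr => k _.
by rewrite rmorphM.
Qed.
Lemma mapfXn f j : mapf (f ^+ j) = mapf f ^+ j.
Proof. by elim: j => [|j IH]; rewrite ?expr0 ?mapf1 // !exprS mapfM IH. Qed.
Lemma mapfX i : mapf (fps_X A i) = fps_X B i.
Proof. by apply/funext => m; rewrite /mapf /fps_X rmorph_nat. Qed.
Lemma mapf_deriv i f : mapf (fps_deriv i f) = fps_deriv i (mapf f).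
Proof. by apply/funext => m; rewrite /mapf /fps_deriv rmorphMn. Qed.
Lemma mapf_comp f s : mapf (fps_comp f s) = fps_comp (mapf f) (fun i => mapf (s i)).
Proof.
apply/funext => m; rewrite /mapf /fps_comp rmorph_sum; apply: eq_bigr => k _.
rewrite rmorphM; congr (_ * _).
have -> : rho ((\prod_i s i ^+ k i) m) = mapf (\prod_i s i ^+ k i) m by [].
congr ((_ : fps n B) m); rewrite (big_morph _ mapfM mapf1).
by apply: eq_bigr => i _; rewrite mapfXn.
Qed.
Lemma mapf_vf V f : mapf (vf_act V f) = vf_act (fun i => mapf (V i)) (mapf f).
Proof.
rewrite /vf_act (big_morph _ mapfD mapf0); apply: eq_bigr => i _.
by rewrite mapfM mapf_deriv.
Qed.
Lemma mapf_op V (c : nat -> A) f :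
  mapf (op V c f) = op (fun i => mapf (V i)) (rho \o c) (mapf f).
Proof.
have it j : mapf (iter j (vf_act V) f) = iter j (vf_act (fun i => mapf (V i))) (mapf f).
  by elim: j => // j IH; rewrite !iterS mapf_vf IH.
apply/funext => m; rewrite /mapf /op rmorph_sum; apply: eq_bigr => j _.
by rewrite rmorphM -it.
Qed.

Lemma mapf_ff : mapf (crossf A ix iy) = crossf B ix iy.
Proof. by rewrite /crossf mapfM mapfD mapfMn !mapfX. Qed.
Lemma mapf_Xb i : mapf (crossX A ix iy i) = crossX B ix iy i.
Proof. by rewrite /crossX; case: eqP; rewrite ?mapf_ff ?mapf0. Qed.
Lemma mapf_theta l i : mapf (theta ix iy l i) = theta ix iy (rho l) i.
Proof.
by rewrite /theta; case: (i == ix); last case: (i == iy); rewrite ?mapfD ?mapfZ ?mapfXn ?mapf_ff ?mapfX ?rmorphXn.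
Qed.
Lemma mapf_expv f : mapf (expv (crossX A ix iy) f) = expv (crossX B ix iy) (mapf f).
Proof.
rewrite /expv mapf_op; have -> : (fun i => mapf (crossX A ix iy i)) = crossX B ix iy.
  by apply/funext => i; apply: mapf_Xb.
by apply: op_ext => j /=; rewrite rmorphV ?fact_unit // rmorph_nat.
Qed.
Lemma mapf_phi l i : mapf (pert_exp ix iy l i) = pert_exp ix iy (rho l) i.
Proof.
rewrite /pert_exp mapf_comp mapf_expv mapfX; apply: comp_eq => j; exact: mapf_theta.
Qed.
Lemma mapf_io2 i : mapf (branch2 A ix iy i) = branch2 B ix iy i.
Proof.
rewrite /branch2; case: eqP => _; rewrite ?mapfX // -[X in mapf X]sub0r mapfB mapf0 sub0r.
by rewrite mapfMn mapfX.
Qed.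
Lemma mapf_kap i : mapf (kap A ix iy i) = kap B ix iy i.
Proof. by rewrite /kap; case: (_ || _); rewrite ?mapfX ?mapf0. Qed.
Lemma mapf_res i j : mapf (res A i j) = res B i j.
Proof. by rewrite /res; case: eqP; rewrite ?mapfX ?mapf0. Qed.

End MapRing.

(** * Extraction of a coefficient of the parameter *)

Section MapLinear.
Variables (n : nat) (A B : comUnitRingType) (io : {rmorphism B -> A}) (pr : {additive A -> B}).
Hypothesis hpr : forall b a, pr (io b * a) = b * pr a.
Implicit Types (f : fps n A) (g : fps n B) (V s : 'I_n -> fps n B).

Definition mapp f : fps n B := fun m => pr (f m).

Lemma mappD f h : mapp (f + h) = mapp f + mapp h.
Proof. by apply/funext => m; rewrite /mapp !fpsD raddfD. Qed.
Lemma mappB f h : mapp (f - h) = mapp f - mapp h.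
Proof. by apply/funext => m; rewrite /mapp !fpsB raddfB. Qed.
Lemma mapp0 : mapp 0 = 0.
Proof. by apply/funext => m; rewrite /mapp raddf0. Qed.
Lemma mapp_mul g f : mapp (mapf io g * f) = g * mapp f.
Proof.
apply/funext => m; rewrite /mapp [LHS]raddf_sum; apply: eq_bigr => k _.
by rewrite hpr.
Qed.
Lemma mapp_deriv i f : mapp (fps_deriv i f) = fps_deriv i (mapp f).
Proof. by apply/funext => m; rewrite /mapp /fps_deriv raddfMn. Qed.
Lemma mapp_vf V f : mapp (vf_act (fun i => mapf io (V i)) f) = vf_act V (mapp f).
Proof.
rewrite /vf_act (big_morph _ mappD mapp0); apply: eq_bigr => i _.
by rewrite mapp_mul mapp_deriv.
Qed.
Lemma mapp_op V (c : nat -> B) f :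
  mapp (op (fun i => mapf io (V i)) (io \o c) f) = op V c (mapp f).
Proof.
have it j : mapp (iter j (vf_act (fun i => mapf io (V i))) f) = iter j (vf_act V) (mapp f).
  by elim: j => // j IH; rewrite !iterS mapp_vf IH.
apply/funext => m; rewrite /mapp /op raddf_sum; apply: eq_bigr => j _.
by rewrite hpr -it.
Qed.
Lemma mapp_comp f s : mapp (fps_comp f (fun i => mapf io (s i))) = fps_comp (mapp f) s.
Proof.
apply/funext => m; rewrite /mapp /fps_comp raddf_sum; apply: eq_bigr => k _.
have -> : (\prod_i mapf io (s i) ^+ k i) m = io ((\prod_i s i ^+ k i) m).
  transitivity (mapf io (\prod_i s i ^+ k i) m) => //.
  rewrite (big_morph _ (mapfM io) (mapf1 n io)).
  by congr ((_ : fps n A) m); apply: eq_bigr => i _; rewrite mapfXn.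
by rewrite mulrC hpr mulrC.
Qed.

End MapLinear.

Section DegreeFiltration.
Variable F : realFieldType.
Notation Fp := {poly F}.

Lemma nat_unit_poly j : (j.+1%:R : Fp) \is a GRing.unit.
Proof.
by rewrite poly_unitE -polyC1 -polyCMn coefC eqxx size_polyC pnatr_eq0 /= unitfE pnatr_eq0.
Qed.
Lemma nat_unit_field j : (j.+1%:R : F) \is a GRing.unit.
Proof. by rewrite unitfE pnatr_eq0. Qed.

(** The slope 2 is dictated by constants in [T 1] and l^2 in [T 2]. *)
Definition degT (d : nat) (p : Fp) := (size p <= d.*2.-1)%N.

Lemma degT_filt : coef_filt degT.
Proof.
rewrite /degT; split=> [a|d|d a b ha hb|d a ha|d e a b ha hb|||j].
- by rewrite leqn0 size_poly_eq0 => /eqP.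
- by rewrite size_poly0.
- by apply: leq_trans (size_polyD _ _) _; rewrite geq_max ha hb.
- by apply: leq_trans ha _; rewrite -!muln2; lia.
- apply: leq_trans (size_polyMleq _ _) _; move: ha hb.
  by move: (size a) (size b) => p q; rewrite -!muln2; lia.
- by rewrite size_poly1.
- by rewrite size_polyN size_poly1.
have -> : (j.+1%:R^-1 : Fp) = (j.+1%:R^-1)%:P.
  apply: (mulrI (nat_unit_poly j)); rewrite mulrV ?nat_unit_poly // -polyC1 -polyCMn -polyCM.
  by rewrite divff // pnatr_eq0.
by rewrite size_polyC; case: (_ != 0).
Qed.

End DegreeFiltration.

Section PolyFamily.
Variables (n : nat) (F : realFieldType) (ix iy : 'I_n) (hxy : ix != iy).
Notation Fp := {poly F}.
Notation degT := (@degT F).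
Implicit Types (f g : fps n Fp).
Let hP := @nat_unit_poly F.

Lemma poly_family : exists G : fps n Fp,
  [/\ forall m, (size (G m) <= (mdeg m).*2.-1)%N,
      fps_comp G (pert_exp ix iy 'X) - G = crossf Fp ix iy ^+ 2,
      fps_comp G (res Fp iy) = 0 & fps_comp G (kap Fp ix iy) = G].
Proof.
have [||G [h1 h2 h3 h4]] := solve_cohom hP hxy (degT_filt F) (l := 'X).
- by rewrite /degT size_polyX.
- by rewrite /degT size_polyXn.
by exists G; split=> // m; have := h1 m; rewrite /degT subn1.
Qed.

Definition low2 f := forall m, 'X^2 %| f m.

Lemma low2D f g : low2 f -> low2 g -> low2 (f + g).
Proof. by move=> hf hg m; rewrite fpsD dvdp_add. Qed.
Lemma low2M f g : low2 f -> low2 (f * g).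
Proof.
move=> hf m; apply: (big_ind (fun p => 'X^2 %| p)) => [|p q|k _]; first exact: dvdp0.
  exact: dvdp_add.
by rewrite dvdp_mulr.
Qed.
Lemma low2_X2 f : low2 ('X^2 *: f).
Proof. by move=> m; rewrite fpsZ dvdp_mulr. Qed.

(** Taylor expansion to first order in l; the displacement of x, being a multiple of l^2, drops
    out. *)
Lemma theta_low2 f : low2 (fps_comp f (theta ix iy 'X) - f
   - 'X *: (crossf Fp ix iy ^+ 2 * fps_deriv iy f)).
Proof.
have vt := ordge_vanish (@theta1 n Fp ix iy 'X).
set F2 := crossf Fp ix iy ^+ 2.
have low0 : low2 0 by move=> m; apply: dvdp0.
apply: (@fps_dense _ _ (fun f => low2 (fps_comp f (theta ix iy 'X) - f - 'X *: (F2 * fps_deriv iy f)))).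
- by move=> a; rewrite compC // derivC mulr0 scaler0 !subr0 subrr.
- move=> i; rewrite compX // derivX /theta -/F2.
  have [->|iix] := eqVneq i ix.
    rewrite eq_sym (negbTE hxy) mulr0 scaler0 subr0 addrAC subrr add0r; exact: low2_X2.
  rewrite (eq_sym iy); case: eqP => [->|_]; last by rewrite mulr0 scaler0 subr0 subrr.
  rewrite mulr1; have -> : fps_X Fp iy + 'X *: crossf Fp ix iy ^+ 2 - fps_X Fp iy - 'X *: F2 = 0 by rewrite -/F2; ring.
  exact: low0.
- move=> u w hu hw; rewrite compD // derivD mulrDr scalerDr.
  set a := fps_comp u _; set b := fps_comp w _; set c := _ *: _; set d := 'X *: _.
  have -> : a + b - (u + w) - (c + d) = (a - u - c) + (b - w - d) by ring.
  exact: low2D.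
- move=> u w hu hw; rewrite compM // derivM.
  set a := fps_comp u _ in hu *; set b := fps_comp w _ in hw *.
  have -> : a * b - u * w - 'X *: (F2 * (fps_deriv iy u * w + u * fps_deriv iy w)) =
    (a - u - 'X *: (F2 * fps_deriv iy u)) * b + (b - w - 'X *: (F2 * fps_deriv iy w)) *
      (u + 'X *: (F2 * fps_deriv iy u)) +
      'X^2 *: (F2 * fps_deriv iy u * (F2 * fps_deriv iy w)).
    by rewrite !scaleE rmorphXn /=; ring.
  by apply: low2D; [apply: low2D; apply: low2M|apply: low2_X2].
(* Agreement up to degree [mdeg m] + 1, because the formula contains a derivative. *)
move=> h hf m; have [g hg fg] := hf (mdeg m).+2.
have := hg m; congr (is_true (_ %| _)).
have o1 : ordge (mdeg m).+1 (fps_comp h (theta ix iy 'X) - h - 'X *: (F2 * fps_deriv iy h)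
   - (fps_comp g (theta ix iy 'X) - g - 'X *: (F2 * fps_deriv iy g))).
  have -> : fps_comp h (theta ix iy 'X) - h - 'X *: (F2 * fps_deriv iy h)
   - (fps_comp g (theta ix iy 'X) - g - 'X *: (F2 * fps_deriv iy g)) =
    fps_comp (h - g) (theta ix iy 'X) - (h - g) - 'X *: (F2 * fps_deriv iy (h - g)).
    by rewrite compB // derivB !scaleE; ring.
  have fg' := ordgeW (leqnSn _) fg.
  apply: ordgeB; first by apply: ordgeB => //; apply: fps_comp_ordge.
  by rewrite scaleE; apply/ordgeMr/ordgeMr/deriv_ordge.
by have /eqP := o1 m (ltnSn _); rewrite fpsB subr_eq0 => /eqP.
Qed.

Lemma coefp_semi (i : nat) (b : F) (a : Fp) : coefp i (polyC b * a) = b * coefp i a.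
Proof. by rewrite /coefp coefCM. Qed.

(** The coefficients of l^0 and l^1 in the cohomological equation, as required by [K1_coef]. *)
Lemma poly_coef_eqs (G : fps n Fp) :
  fps_comp G (pert_exp ix iy 'X) - G = crossf Fp ix iy ^+ 2 -> fps_comp G (res Fp iy) = 0 ->
  let G0 := mapp (coefp 0) G in let K1 := mapp (coefp 1) G in
  [/\ expv (crossX F ix iy) G0 - G0 = crossf F ix iy ^+ 2,
      expv (crossX F ix iy) K1 + crossf F ix iy ^+ 2 * fps_deriv iy (expv (crossX F ix iy) G0) = K1,
      fps_comp K1 (res F iy) = 0 &
      forall m, (fps_comp G (branch2 Fp ix iy) m)`_1 = fps_comp K1 (branch2 F ix iy) m].
Proof.
move=> eG rG G0 K1; pose e := expv (crossX Fp ix iy) G.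
have hs := coefp_semi.
have pe i : mapp (coefp i) e = expv (crossX F ix iy) (mapp (coefp i) G).
  have -> : e = op (fun j => mapf polyC (crossX F ix iy j)) (polyC \o (fun j => j`!%:R^-1)) G.
    rewrite /e /expv; have -> : (fun j => mapf polyC (crossX F ix iy j)) = crossX Fp ix iy.
      by apply/funext => j; apply: mapf_Xb.
    apply: op_ext => j /=; apply: (mulrI (fact_unit hP j)).
    by rewrite mulrV ?fact_unit // -polyC1 -polyCMn -polyCM divff // pnatr_eq0 -lt0n fact_gt0.
  exact: (mapp_op (hs i)).
have ff2C : crossf Fp ix iy ^+ 2 = mapf polyC (crossf F ix iy ^+ 2) by rewrite mapfXn mapf_ff.
have low := theta_low2 e.
have eq1 : fps_comp e (theta ix iy 'X) = crossf Fp ix iy ^+ 2 + G.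
  by rewrite -(comp_phi hP) -eG subrK.
have lowc i : (i < 2)%N -> mapp (coefp i) (fps_comp e (theta ix iy 'X) - e
   - 'X *: (crossf Fp ix iy ^+ 2 * fps_deriv iy e)) = 0.
  move=> i2; apply/funext => m; rewrite /mapp /=.
  by have /dvdpP[q ->] := low m; rewrite coefMXn i2.
have pC i : mapp (coefp i) (crossf Fp ix iy ^+ 2) = (i == 0%N)%:R *: crossf F ix iy ^+ 2.
  by apply/funext => m; rewrite /mapp ff2C /mapf fpsZ /= coefC; case: (i == 0%N); rewrite ?mul1r ?mul0r.
have pX0 h : mapp (coefp 0) ('X *: h) = 0.
  by apply/funext => m; rewrite /mapp fpsZ /= coefXM.
have pX1 h : mapp (coefp 1) ('X *: h) = mapp (coefp 0) h.
  by apply/funext => m; rewrite /mapp fpsZ /= coefXM.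
split.
- have := lowc 0%N isT; rewrite eq1 !mappB mappD pC eqxx scale1r pX0 subr0 pe.
  by move/eqP; rewrite subr_eq0 -/G0 => /eqP <-; rewrite addrK.
- have := lowc 1%N isT; rewrite eq1 !mappB mappD pC scale0r add0r pX1 pe.
  rewrite ff2C (mapp_mul (hs 0%N)) mapp_deriv pe -/G0 -/K1 => /eqP.
  by rewrite -addrA -opprD subr_eq0 => /eqP <-.
- rewrite /K1; have -> : res F iy = (fun i => res F iy i) by [].
  rewrite -(mapp_comp (hs 1%N)).
  have -> : fps_comp G (fun i => mapf polyC (res F iy i)) = fps_comp G (res Fp iy).
    by apply: comp_eq => i; apply: mapf_res.
  by rewrite rG mapp0.
move=> m; rewrite /K1; have -> : branch2 F ix iy = (fun i => branch2 F ix iy i) by [].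
rewrite -(mapp_comp (hs 1%N)).
have -> : fps_comp G (fun i => mapf polyC (branch2 F ix iy i)) = fps_comp G (branch2 Fp ix iy).
  by apply: comp_eq => i; apply: mapf_io2.
by [].
Qed.

End PolyFamily.

(** * Factorials and Lagrange interpolation *)

Lemma fact_expn_le (a b : nat) : (a ^ b * a`! <= (a + b)`!)%N.
Proof.
elim: b => [|b IH]; first by rewrite expn0 mul1n addn0.
rewrite expnS addnS factS -mulnA leq_mul //.
exact: leq_trans (leq_addr b a) (leqnSn _).
Qed.

Lemma bin_expn_le (a b : nat) : ('C(a, b) <= 2 ^ a)%N.
Proof.
elim: a b => [|a IH] [|b] //; first by rewrite bin0 expn_gt0.
by rewrite binS expnS mul2n -addnn leq_add.
Qed.

(** From D^D D! <= (2 D)! and the bound 4^D on the central binomial coefficient. *)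
Lemma expn_fact_le (D : nat) : (D ^ D <= 4 ^ D * D`!)%N.
Proof.
rewrite -(leq_pmul2r (fact_gt0 D)); apply: leq_trans (fact_expn_le D D) _.
rewrite -(bin_fact (leq_addr D D)) addKn -!mulnA leq_mul2r; apply/orP; right.
by apply: leq_trans (bin_expn_le _ _) _; rewrite addnn -mul2n expnM.
Qed.

(** With truncated subtraction (i - j) + (j - i) is |i - j|: this is the Lagrange denominator for
    equidistant nodes. *)
Lemma dist_prod (i e : nat) :
  (\prod_(j < (i + e).+1 | j != i :> nat) ((i - j) + (j - i)) = i`! * e`!)%N.
Proof.
elim: e => [|e IH]; rewrite ?addn0 ?addnS big_mkcond big_ord_recr /=.
  rewrite eqxx !muln1 (reindex_inj rev_ord_inj) /= fact_prod big_add1 big_mkord /=.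
  by apply: eq_bigr => j _; have := ltn_ord j; case: eqP => /= h; lia.
rewrite -big_mkcond /= IH ifT; last by rewrite neq_ltn ltnS leq_addr orbT.
by rewrite factS -mulnA [(e`! * _)%N]mulnC; congr (_ * (_ * _))%N; lia.
Qed.

Section PolyCoef.
Variable R : realType.
Implicit Types (p q : {poly R}) (a b c M : R).

Lemma prod_XsubC_coef (s : seq R) (i : nat) : (forall c, c \in s -> `|c| <= 2%:R) ->
  `|(\prod_(c <- s) ('X - c%:P))`_i| <= 3%:R ^+ size s.
Proof.
elim: s i => [|c s IH] i hs.
  by rewrite big_nil coef1 expr0; case: eqP => _; rewrite ?normr1 ?normr0 ?ler01.
rewrite big_cons; set q := \prod_(_ <- _) _.
have {}IH j : `|q`_j| <= 3%:R ^+ size s.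
  by apply: IH => d ds; apply: hs; rewrite inE ds orbT.
have hc : `|c| <= 2%:R by apply: hs; rewrite inE eqxx.
have h0 : 0 <= (3%:R : R) ^+ size s by rewrite exprn_ge0.
rewrite mulrBl coefB coefXM coefCM; apply: le_trans (ler_normB _ _) _.
have -> : 3%:R ^+ size (c :: s) = 3%:R ^+ size s + 2%:R * 3%:R ^+ size s :> R.
  by rewrite /= exprS; ring.
apply: lerD; first by case: eqP => _ //; rewrite normr0.
by rewrite normrM; apply: ler_pM.
Qed.

Lemma lagrange_sum (D : nat) (x : 'I_D.+1 -> R) p : injective x -> (size p <= D.+1)%N ->
  p = \sum_i (p.[x i] / \prod_(j in predC1 i) (x i - x j)) *:
      \prod_(j in predC1 i) ('X - (x j)%:P).
Proof.
move=> xinj sp; apply/eqP; rewrite -subr_eq0; apply/eqP.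
pose L i := \prod_(j in predC1 i) ('X - (x j)%:P).
have sL i : size (L i) = D.+1.
  by rewrite /L -big_enum size_prod_XsubC -cardE cardC1 card_ord.
have Lij i j : (L i).[x j] = \prod_(k in predC1 i) (x j - x k).
  by rewrite horner_prod; apply: eq_bigr => k _; rewrite hornerXsubC.
apply: (@roots_geq_poly_eq0 _ _ [seq x i | i <- enum 'I_D.+1]).
- apply/allP => _ /mapP[j _ ->]; rewrite rootE hornerD hornerN horner_sum subr_eq0.
  rewrite (bigD1 j) //= [X in _ + X]big1 ?addr0 => [|i ij].
    rewrite hornerZ Lij divfK //; apply/prodf_neq0 => k; rewrite inE => kj.
    by rewrite subr_eq0; apply: contra kj => /eqP /xinj ->.
  rewrite hornerZ Lij [X in _ * X](bigD1 j) /=; last by rewrite inE eq_sym.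
  by rewrite subrr mul0r mulr0.
- by rewrite map_inj_uniq ?enum_uniq.
rewrite size_map size_enum_ord; apply: leq_trans (size_polyD _ _) _.
rewrite size_polyN geq_max sp; apply: leq_trans (size_sum _ _ _) _.
by apply/bigmax_leqP => i _; apply: leq_trans (size_scale_leq _ _) _; rewrite sL.
Qed.

(** Lagrange interpolation at equidistant nodes. The constant is 24 = 3 . 8: the numerators have
    coefficients at most 3^D since all nodes are at most 2, and D^D / (i! (D - i)!) is at most 4^D
    2^D. *)
Lemma poly_coef_bound (D : nat) a b M p (k : nat) : 1 <= a -> a < b -> b <= 2%:R ->
  (size p <= D.+1)%N -> (forall c, a <= c <= b -> `|p.[c]| <= M) ->
  `|p`_k| <= D.+1%:R * M * (24%:R / (b - a)) ^+ D.
Proof.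
(* The spacing (b - a) / D of the nodes requires D > 0; constants are treated apart. *)
move=> a1 ab b2 sp hM; case: D sp => [|D] sp.
  have M0 : 0 <= M by apply: le_trans (hM a _); rewrite ?lexx ?(ltW ab).
  rewrite mul1r expr0 mulr1; have [c ep] : exists c, p = c%:P by exists p`_0; apply: size1_polyC.
  have := hM a; rewrite ep hornerC coefC lexx (ltW ab) => /(_ isT).
  by case: eqP => // _; rewrite normr0.
set N := D.+1 in sp *.
have N0 : (0 : R) < N%:R by rewrite ltr0n.
have w0 : 0 < b - a by rewrite subr_gt0.
pose h := (b - a) / N%:R; have h0 : 0 < h by rewrite divr_gt0.
pose x (i : 'I_N.+1) := a + h * i%:R.
have xin i : a <= x i <= b.
  rewrite /x lerDl mulr_ge0 ?ler0n ?(ltW h0) //=.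
  rewrite -lerBrDl /h -mulrA ger_pMr // mulrC ler_pdivrMr // mul1r ler_nat -ltnS.
  exact: ltn_ord.
have xd i j : x i - x j = h * (i%:R - j%:R) by rewrite /x; ring.
have xinj : injective x.
  move=> i j /eqP; rewrite -subr_eq0 xd mulf_eq0 (gt_eqF h0) /= subr_eq0 eqr_nat => /eqP e.
  exact: val_inj.
have M0 : 0 <= M by apply: le_trans (hM a _); rewrite ?lexx ?(ltW ab).
rewrite [p](lagrange_sum xinj sp) coef_sum; apply: le_trans (ler_norm_sum _ _ _) _.
have -> : N.+1%:R * M * (24%:R / (b - a)) ^+ N = \sum_(i < N.+1) M * (24%:R / (b - a)) ^+ N.
  by rewrite sumr_const card_ord -mulrA mulr_natl.
apply: ler_sum => i _; rewrite coefZ normrM normrM -mulrA.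
apply: ler_pM => //; [by rewrite mulr_ge0|exact: hM|].
have e1 : `|(\prod_(j in predC1 i) (x i - x j))^-1| = (h ^+ N * (i`! * (N - i)`!)%:R)^-1.
  rewrite normfV; congr _^-1; rewrite normr_prod.
  have iN : (i <= N)%N by rewrite -ltnS.
  rewrite -dist_prod subnKC // natr_prod /=.
  have -> : h ^+ N = \prod_(j in predC1 i) h by rewrite prodr_const cardC1 card_ord.
  rewrite [X in _ * X](_ : _ = \prod_(j in predC1 i) ((i - j) + (j - i))%N%:R); last first.
    by apply: eq_bigl => j; rewrite inE.
  rewrite -big_split /=; apply: eq_bigr => j _; rewrite xd normrM gtr0_norm //.
  congr (_ * _); case: (leqP i j) => ij.
    rewrite (eqP (ij : (i - j == 0)%N)) add0n natrB // distrC ger0_norm // subr_ge0 ler_nat //.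
  have ji := ltnW ij.
  by rewrite (eqP (ji : (j - i == 0)%N)) addn0 natrB // ger0_norm // subr_ge0 ler_nat.
have e2 : `|(\prod_(j in predC1 i) ('X - (x j)%:P))`_k| <= 3%:R ^+ N.
  have := @prod_XsubC_coef [seq x j | j <- enum (predC1 i)] k.
  rewrite size_map -cardE cardC1 card_ord big_map big_enum /=; apply=> c /mapP[j _ ->].
  have /andP[h1 h2] := xin j.
  by rewrite ger0_norm; [exact: le_trans b2|apply: le_trans h1; apply: le_trans a1].
rewrite e1; apply: le_trans (ler_wpM2l _ e2) _.
  by rewrite invr_ge0 mulr_ge0 // exprn_ge0 // ltW.
have p1 : (0 : R) < (i`! * (N - i)`!)%:R by rewrite ltr0n muln_gt0 !fact_gt0.
have p2 : 0 < h ^+ N by rewrite exprn_gt0.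
rewrite mulrC ler_pdivrMr ?mulr_gt0 //.
have -> : (24%:R / (b - a)) ^+ N * (h ^+ N * (i`! * (N - i)`!)%:R) =
   24%:R ^+ N / N%:R ^+ N * (i`! * (N - i)`!)%:R.
  rewrite mulrA -exprMn -expr_div_n; congr (_ ^+ _ * _); rewrite /h.
  by field; rewrite !gt_eqF.
rewrite mulrAC ler_pdivlMr ?exprn_gt0 // -!natrX -!natrM ler_nat.
have iN : (i <= N)%N by rewrite -ltnS.
rewrite -[24%N]/(3 * 8)%N expnMn -mulnA leq_mul2l; apply/orP; right.
apply: leq_trans (expn_fact_le N) _.
rewrite -[8%N]/(4 * 2)%N expnMn -mulnA leq_mul2l; apply/orP; right.
by rewrite -(bin_fact iN) leq_mul2r bin_expn_le orbT.
Qed.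

End PolyCoef.

(** * Uniform bounds over an interval of parameters *)

Section UniformBound.
Variable R : realType.
Implicit Types (p q : {poly R}) (a b c M r : R) (t : nat -> {poly R}).

Lemma nat_ge (c : R) : exists k : nat, c <= k.+1%:R.
Proof.
exists (Num.Def.archi_bound `|c|); apply: le_trans (ler_norm c) _.
by apply: le_trans (ltW (archi_boundP (normr_ge0 c))) _; rewrite ler_nat.
Qed.

Lemma nested_intervals (I : nat -> R * R) : (forall k, (I k).1 < (I k).2) ->
  (forall k, (I k).1 <= (I k.+1).1 /\ (I k.+1).2 <= (I k).2) ->
  exists c, forall k, (I k).1 <= c <= (I k).2.
Proof.
move=> h1 h2; have mono j e : (I j).1 <= (I (j + e)%N).1 /\ (I (j + e)%N).2 <= (I j).2.
  elim: e => [|e [a b]]; first by rewrite addn0.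
  rewrite addnS; have [a' b'] := h2 (j + e)%N.
  by split; [apply: le_trans a'|apply: le_trans b].
have cross j k : (I j).1 <= (I k).2.
  have [a _] := mono j k; have [_ b] := mono k j; rewrite addnC in b.
  by apply: le_trans a _; apply: le_trans b; apply: ltW.
pose E := [set x | exists k, x = (I k).1]%classic.
have ubE k : ubound E (I k).2 by move=> x [j ->].
exists (sup E) => k; apply/andP; split.
  by apply: ub_le_sup; [exists (I 0%N).2|exists k].
by apply: ge_sup; [exists (I 0%N).1; exists 0%N|].
Qed.

(** Baire's argument by nested intervals: if every bound k^(N+1) failed on every subinterval,
    continuity would give intervals on which the successive bounds fail, and a common point would
    contradict the bound assumed there. A single integer k replaces the pair r, B. *)
Lemma baire_interval t :
  (forall c, 1 <= c <= 2%:R -> exists r B, 0 < r /\ forall N, `|(t N).[c]| * r ^+ N <= B) ->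
  exists a b k, [/\ 1 <= a, a < b, b <= 2%:R &
    forall c N, a <= c <= b -> `|(t N).[c]| <= k.+1%:R ^+ N.+1].
Proof.
move=> ht; apply: contrapT => hn.
pose ok (I : R * R) := [/\ 1 <= I.1, I.1 < I.2 & I.2 <= 2%:R].
have step (k : nat) (I : {I | ok I}) : exists J : {J | ok J},
    [/\ (sval I).1 <= (sval J).1, (sval J).2 <= (sval I).2 &
      exists N, forall c, (sval J).1 <= c <= (sval J).2 -> k.+1%:R ^+ N.+1 < `|(t N).[c]|].
  case: I => -[a b] [/= a1 ab b2].
  have [c [N [/andP[ac cb] hc]]] : exists c N, a <= c <= b /\ k.+1%:R ^+ N.+1 < `|(t N).[c]|.
    apply: contrapT => h; apply: hn; exists a, b, k; split=> // c N abc.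
    by rewrite leNgt; apply/negP => hlt; apply: h; exists c, N.
  have [d d0 hd] : exists2 d, 0 < d & forall y, `|y - c| < d -> `|(t N).[y] - (t N).[c]| < `|(t N).[c]| - k.+1%:R ^+ N.+1 by apply: poly_cont; rewrite subr_gt0.
  have hd' y : c - d / 2%:R <= y <= c + d / 2%:R -> k.+1%:R ^+ N.+1 < `|(t N).[y]|.
    move=> /andP[y1 y2]; have /hd : `|y - c| < d by rewrite ltr_norml; apply/andP; split; lra.
    have := ler_distD (t N).[y] (t N).[c] 0; rewrite !subr0 distrC => h1 h2; lra.
  have d2 : 0 < d / 2%:R by rewrite divr_gt0.
  (* A neighbourhood of c may leave [a, b]: the interval is taken to the right of c, or to the left
     when c = b. *)
  pose J : R * R := if c < b then (c, Num.min b (c + d / 2%:R)) else (Num.max a (c - d / 2%:R), c).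
  have [J1 J2 J3] : [/\ a <= J.1, J.2 <= b & J.1 < J.2].
    rewrite /J; case: ltP => hcb /=; split=> //; first by rewrite ge_min lexx.
    - by rewrite lt_min hcb /= ltrDl.
    - by rewrite le_max lexx.
    by rewrite gt_max; apply/andP; split; lra.
  have okJ : ok J by split=> //; [exact: le_trans J1|exact: le_trans J2 b2].
  exists (exist _ J okJ); split=> //=; exists N => y /andP[y1 y2]; apply: hd'; move: y1 y2.
  rewrite /J; case: ltP => hcb /=; rewrite ?le_min ?ge_max => y1 y2.
    by case/andP: y2 => _ y2; apply/andP; split; lra.
  by case/andP: y1 => _ y1; apply/andP; split; lra.
have [F hF] : exists F : nat -> {I | ok I} -> {I | ok I}, forall k I,
    [/\ (sval I).1 <= (sval (F k I)).1, (sval (F k I)).2 <= (sval I).2 &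
      exists N, forall c, (sval (F k I)).1 <= c <= (sval (F k I)).2 ->
        k.+1%:R ^+ N.+1 < `|(t N).[c]|].
  have h k : exists f : {I | ok I} -> {I | ok I}, forall I,
    [/\ (sval I).1 <= (sval (f I)).1, (sval (f I)).2 <= (sval I).2 &
      exists N, forall c, (sval (f I)).1 <= c <= (sval (f I)).2 ->
        k.+1%:R ^+ N.+1 < `|(t N).[c]|] by have [f hf] := choice (step k); exists f.
  by have [F hF] := choice h; exists F.
have ok0 : ok (1, 2%:R) by split; rewrite //= ltr1n.
pose I := fix I k := if k is k'.+1 then F k' (I k') else exist _ (1, 2%:R) ok0.
have [c hc] := @nested_intervals (fun k => sval (I k))
   (fun k => let: And3 _ h _ := svalP (I k) in h)
   (fun k => let: And3 h h' _ := hF k (I k) in conj h h').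
have /ht[r [B [r0 hB]]] : 1 <= c <= 2%:R by exact: hc 0%N.
have [k1 hk1] := nat_ge B; have [k2 hk2] := nat_ge r^-1.
pose k := maxn k1 k2; have [_ _ [N hN]] := hF k (I k).
have := hN c (hc k.+1); rewrite ltNge => /negP; apply.
have := hB N; rewrite -ler_pdivlMr ?exprn_gt0 // => h; apply: le_trans h _.
rewrite exprS -exprVn; apply: ler_pM.
- by apply: le_trans (hB 0%N); rewrite expr0 mulr1.
- by rewrite exprn_ge0 // invr_ge0 ltW.
- by apply: le_trans hk1 _; rewrite ler_nat ltnS leq_maxl.
apply: lerXn2r; rewrite ?nnegrE ?ler0n ?invr_ge0 ?(ltW r0) //.
by apply: le_trans hk2 _; rewrite ler_nat ltnS leq_maxr.
Qed.

Lemma family_coef_bound t (i : nat) : (forall N, (size (t N) <= N.*2.+1)%N) ->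
  (forall c, 1 <= c <= 2%:R -> exists r B, 0 < r /\ forall N, `|(t N).[c]| * r ^+ N <= B) ->
  exists r B, 0 < r /\ forall N, `|(t N)`_i| * r ^+ N <= B.
Proof.
move=> st /baire_interval[a [b [k [a1 ab b2 hk]]]].
have w0 : 0 < b - a by rewrite subr_gt0.
(* The degree 2 N squares the interpolation constant, and 4^N absorbs the factor 2 N + 1. *)
pose q : R := 4%:R * k.+1%:R * (24%:R / (b - a)) ^+ 2.
have q0 : 0 < q.
  apply: mulr_gt0; first by rewrite mulr_gt0 ?ltr0n.
  by rewrite exprn_gt0 // divr_gt0 ?ltr0n.
exists q^-1, k.+1%:R; split=> [|N]; first by rewrite invr_gt0.
rewrite exprVn ler_pdivrMr ?exprn_gt0 //.
apply: le_trans (poly_coef_bound i a1 ab b2 (st N) (fun c => hk c N)) _.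
have -> : k.+1%:R * q ^+ N = 4%:R ^+ N * k.+1%:R ^+ N.+1 * (24%:R / (b - a)) ^+ N.*2.
  by rewrite -mul2n exprM /q !exprMn exprS; ring.
rewrite ler_wpM2r ?exprn_ge0 ?divr_ge0 ?(ltW w0) // ler_wpM2r ?exprn_ge0 //.
rewrite -natrX ler_nat; elim: N {st} => // N IH; rewrite expnS doubleS; lia.
Qed.

Lemma fact_beats_expr (c q : R) :
  exists2 m : nat, (0 < m)%N & c * q ^+ (2 * m) < (2 * m)`!%:R.
Proof.
have [k1 hk1] := nat_ge c; have [k2 hk2] := nat_ge (q ^+ 2).
(* (2 m)! >= m^m >= 2^m (k2 + 1)^m by the first summand, and 2^m > m >= k1 + 1 by the second. *)
pose m := (2 * k2.+1 + k1.+1)%N; have m0 : (0 < m)%N by rewrite /m addnS.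
exists m => //; apply: (@le_lt_trans _ _ (k1.+1%:R * k2.+1%:R ^+ m)).
  rewrite exprM; apply: (@le_trans _ _ (k1.+1%:R * (q ^+ 2) ^+ m)).
    by rewrite ler_wpM2r // exprn_ge0 // sqr_ge0.
  by rewrite ler_wpM2l // lerXn2r ?nnegrE // sqr_ge0.
rewrite -natrX -natrM ltr_nat mul2n -addnn.
apply: leq_trans (fact_expn_le m m); apply: leq_trans (leq_pmulr _ (fact_gt0 m)).
apply: (@leq_trans ((2 * k2.+1) ^ m)%N); last by rewrite leq_exp2r // /m leq_addr.
rewrite expnMn ltn_mul2r expn_gt0 /=; apply: leq_ltn_trans (_ : _ <= m)%N (ltn_expl _ _) => //.
by rewrite /m leq_addl.
Qed.

End UniformBound.

(** * Existence of a non-embeddable member *)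

Section Assembly.
Variables (R : realType) (n : nat) (ix iy : 'I_n) (hxy : ix != iy).
Notation C := (complex R).
Notation normc := (@ComplexField.Normc.normc R).
Notation io2 K := (branch2 K ix iy).

Let n0 : (0 < n)%N. Proof. exact: leq_ltn_trans (leq0n ix) (ltn_ord ix). Qed.
Let hC := @nat_unit C.

(** H = x - l^2 G is invariant under phi, hence a first integral of log phi, and [rigidity] applies
    to it. G is recovered from H because l is nonzero. *)
Lemma embeddable_gb (l : C) (G : fps n C) : l != 0 ->
  fps_comp G (pert_exp ix iy l) - G = crossf C ix iy ^+ 2 ->
  fps_comp G (res C iy) = 0 -> fps_comp G (kap C ix iy) = G ->
  embeddable (pert_exp ix iy l) -> gb normc (fps_comp G (io2 C)).
Proof.
move=> l0 Gphi Gres Gkap [sig [Y [[vsig usig] cY [tau [[vtau _] sK tK] conj]]]].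
have hnu := normc_abs_val R.
have [V [V2 VF Vphi]] := log_phi_exists hxy l.
have phi2 := phi_ord2 hxy l.
have eL := log_expv n0 phi2 V2 Vphi.
have vphi := phi_vanish ix iy l.
have [Z hZ] : exists Z, forall i, V i = crossX C ix iy i + crossf C ix iy ^+ 2 * Z i.
  have /choice[Z hZ] : forall i, exists q, V i - crossX C ix iy i = crossf C ix iy ^+ 2 * q by exact: VF.
  by exists Z => i; rewrite -hZ addrC subrK.
pose H := fps_X C ix - l ^+ 2 *: G.
have vio := ordge_vanish (@io21 n C ix iy).
have Hphi : fps_comp H (pert_exp ix iy l) = H.
  have ex : pert_exp ix iy l ix = fps_X C ix + l ^+ 2 *: crossf C ix iy ^+ 2.
    rewrite /pert_exp expv_X // compX /theta ?eqxx //.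
    exact: ordge_vanish (@theta1 n C ix iy l).
  by rewrite /H compB // compX // compZ // ex -Gphi scalerBr; ring.
have VH : vf_act V H = 0.
  apply: expv_fixed => //; rewrite (expv_comp V2 hC) -[RHS]Hphi.
  exact: comp_eq.
have vres := @res_vanish n C iy; have vkap := ordge_vanish (@kap1 n C ix iy).
have gH : gb normc (fps_comp H (io2 C)).
  apply: (rigidity hnu hC hxy hZ vsig usig vtau sK tK _ VH).
  (* The conjugacy relation, applied to the coordinate x_j. *)
  - move=> j; have -> : fps_comp (vf_act V (sig j)) tau = Y j.
      by rewrite -[Y j](vfX Y) -conj eL compX.
    exact: convergent_gb.
  - by rewrite /H compB // compZ // Gkap compX // /kap eqxx.
  by rewrite /H compB // compZ // Gres scaler0 subr0 compX // /res (negbTE hxy).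
have -> : fps_comp G (io2 C) = (l ^+ 2)^-1 *: (branch2 C ix iy ix - fps_comp H (io2 C)).
  rewrite /H compB // compX // opprB addrC subrK compZ // scalerA mulVf ?scale1r //.
  by rewrite expf_neq0.
apply: (gbZ hnu); apply: (gbB hnu) => //; rewrite /branch2 eqxx.
by apply: (gbN hnu); apply: (gbMn hnu); apply: (gbX hnu).
Qed.

Lemma some_phi_not_embeddable : exists2 c : R, 1 <= c <= 2%:R &
  ~ embeddable (pert_exp ix iy c%:C%C).
Proof.
apply: contrapT => hn.
have emb (c : R) : 1 <= c <= 2%:R -> embeddable (pert_exp ix iy c%:C%C).
  by move=> hc; apply: contrapT => h; apply: hn; exists c.
have [G [sG Gphi Gres Gkap]] := poly_family R hxy.
pose t N := fps_comp G (io2 {poly R}) (U_(iy) *+ N)%MM.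
have dU N : mdeg (U_(iy) *+ N : 'X_{1..n})%MM = N by rewrite mdegMn mdeg1 mul1n.
have st N : (size (t N) <= N.*2.+1)%N.
  have hT := degT_filt R.
  have fG : fil (@degT R) 1 G by move=> m; rewrite subn1; apply: sG.
  have fi i : fil (@degT R) 1 (io2 {poly R} i).
    rewrite /branch2; case: eqP => _; last exact: (fil_X hT).
    by apply: (filN hT); apply: (filMn hT); apply: (fil_X hT).
  have := fil_comp hT fi fG (U_(iy) *+ N)%MM; rewrite dU subn1 /degT => h.
  by apply: leq_trans h _; apply: leq_trans (leq_pred _) _.
have ht c : 1 <= c <= 2%:R -> exists r B, 0 < r /\ forall N, `|(t N).[c]| * r ^+ N <= B.
  move=> hc; have [ev evE] : exists ev : {rmorphism {poly R} -> C}, forall p, ev p = (p.[c])%:C%C.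
    by exists (real_complex R \o horner_eval c).
  have hP := @nat_unit_poly R.
  have c0 : c%:C%C != 0 :> C.
    have /andP[c1 _] := hc; rewrite -(rmorph0 (real_complex R)) (inj_eq (@complexI R)).
    by rewrite gt_eqF // (lt_le_trans ltr01).
  have e1 : fps_comp (mapf ev G) (pert_exp ix iy c%:C%C) - mapf ev G = crossf C ix iy ^+ 2.
    have := congr1 (mapf ev) Gphi; rewrite mapfB mapf_comp mapfXn mapf_ff => <-.
    rewrite (@comp_eq _ _ _ (pert_exp ix iy c%:C%C) (fun i => mapf ev (pert_exp ix iy 'X i))) // => i.
    by rewrite (mapf_phi ev hP) evE hornerX.
  have e2 : fps_comp (mapf ev G) (res C iy) = 0.
    have := congr1 (mapf ev) Gres; rewrite mapf_comp mapf0 => <-.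
    by apply: comp_eq => i; rewrite (mapf_res ev).
  have e3 : fps_comp (mapf ev G) (kap C ix iy) = mapf ev G.
    have := congr1 (mapf ev) Gkap; rewrite mapf_comp => {2}<-.
    by apply: comp_eq => i; rewrite (mapf_kap ev).
  have [r [B [r0 hB]]] := embeddable_gb c0 e1 e2 e3 (emb c hc).
  exists r, B; split=> // N; have := nb_coef (U_(iy) *+ N)%MM hB.
  rewrite dU; have -> : fps_comp (mapf ev G) (io2 C) (U_(iy) *+ N)%MM = ev (t N).
    have -> : ev (t N) = mapf ev (fps_comp G (io2 {poly R})) (U_(iy) *+ N)%MM by [].
    by rewrite mapf_comp; congr ((_ : fps n C) _); apply: comp_eq => i; rewrite mapf_io2.
  by rewrite evE normc_real.
have [r [B [r0 hB]]] := family_coef_bound 1 st ht.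
have [E0 E1 K1r K1t] := poly_coef_eqs hxy Gphi Gres.
have [gam [is_ [hgam his hbig]]] := bernoulli_bound R.
(* 720 = 60 . 12: the exponent 2 m + 1 of 60 in [bernoulli_bound] leaves one factor 60, and 12 comes
   from [ff2_gk]. The coefficient sits in degree 2 m + 5, whence r^5. *)
have [m m0 hm] := fact_beats_expr (720%:R * B / r ^+ 5) (60%:R / r).
have N1 : (2 * m)%N != 1%N by apply/eqP; lia.
have := K1_coef (@nat_unit_field R) hxy his hgam E0 E1 K1r N1.
rewrite -K1t -/(t _) => hK.
have := hbig m m0; have := hB (2 * m + 5)%N; move: hK hm.
set T := (t _)`_1; set g := gam _ * _; set F := (2 * m)`!%:R => hK hm h1 h2.
have h3 : `|g| <= 12%:R * `|T|.
  have : `|T *+ 12| = `|g| * 2%:R ^+ (2 * m).+3.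
    by rewrite hK normrN normrM normrX normrN normr_nat.
  rewrite normrMn mulr_natl => ->; by apply: ler_peMr => //; apply: exprn_ege1; rewrite ler1n.
have h4 : F <= 60%:R ^+ (2 * m + 1) * (12%:R * `|T|).
  by rewrite mulrC -ler_pdivrMr ?exprn_gt0 ?ltr0n //; exact: (le_trans h2 h3).
have h5 : `|T| <= B / r ^+ (2 * m + 5) by rewrite ler_pdivlMr // exprn_gt0.
move: hm; rewrite ltNge => /negP; apply; apply: le_trans h4 _.
apply: le_trans (_ : 60%:R ^+ (2 * m + 1) * (12%:R * (B / r ^+ (2 * m + 5))) <= _).
  by rewrite ler_wpM2l ?exprn_ge0 // ler_wpM2l.
rewrite le_eqVlt; apply/orP; left; apply/eqP.
by rewrite !exprD expr_div_n expr1; field; rewrite ?expf_neq0 ?gt_eqF.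
Qed.

End Assembly.

Local Close Scope ring_scope.

Theorem mainTheorem2 (R : realType) (n : nat) (hn : (1 < n)%N) :
  exists phi : 'I_n -> fps n (complex R),
    [/\ unipotent phi, (forall i, convergent (phi i)) & ~ embeddable phi].
Proof.
have [c _ hc] := @some_phi_not_embeddable R n (Ordinal (ltnW hn)) (Ordinal hn) isT.
eexists; split; last exact: hc.
  by apply: unipotent_id (ltnW hn) _ => i; apply: phi_ord2.
by move=> i; apply: gb_convergent; apply: gb_phi; [apply: normc_abs_val|apply: nat_unit].
Qed.
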